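(* Let $(\overline{M},J,\overline{g})$ be a complex space form of real dimension $n+p$ and of constant holomorphic sectional curvature $4c$, where $n\geq 3$ and $p<n$. Let $M$ be an $n$-dimensional CR submanifold of maximal CR dimension in $\overline{M}$, with distinguished unit normal vector field $\xi$. Let $A$ be the shape operator of $M$ with respect to $\xi$, and let $R$ be the Riemannian curvature tensor of $M$. If $RA=0$ on $M$, i.e. $R_{XY}(AZ)=A(R_{XY}Z)$ for all $X,Y,Z$ tangent to $M$, then $\overline{M}$ is a Euclidean space (that is, $\overline{M}$ is flat: $c=0$).
   Context: A complex space form $(\overline{M},J,\overline{g})$ is a Kaehler manifold, with almost complex structure $J$ and metric $\overline{g}$, of constant holomorphic sectional curvature, here denoted $4c$ with $c\in\mathbb{R}$. The number $n+p$ is its real dimension. $M$ is an $n$-dimensional real submanifold of $\overline{M}$ (immersed, with the induced Riemannian metric $g$ and Levi-Civita connection $\nabla$). For $x\in M$ put $H_x(M)=JT_x(M)\cap T_x(M)$, the maximal complex subspace of $T_x(M)$. If $\dim_{\mathbb{C}}H_x(M)$ is constant over $M$, then $M$ is called a CR submanifold and this constant is its CR dimension. If $\dim_{\mathbb{C}}H_x(M)=\frac{n-1}{2}$ for every $x\in M$, then $M$ is called a CR submanifold of maximal CR dimension. In that case there is a unit vector field $\xi$ normal to $M$ such that $JT_x(M)\subset T_x(M)\oplus \mathrm{span}\{\xi_x\}$ for every $x\in M$; this $\xi$ is the distinguished normal vector field. With $\overline{\nabla}$ the Levi-Civita connection of $\overline{M}$ and $D$ the normal connection induced by $\overline{\nabla}$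 in the normal bundle of $M$, the shape operator $A$ of $\xi$ is the symmetric endomorphism of $T(M)$ defined by the Weingarten formula $\overline{\nabla}_X\xi=-AX+D_X\xi$ for $X$ tangent to $M$. $R$ is the Riemannian curvature tensor of $(M,g)$: $R_{XY}Z=\nabla_X\nabla_YZ-\nabla_Y\nabla_XZ-\nabla_{[X,Y]}Z$. It acts on $A$ as a derivation, $(R_{XY}A)Z=R_{XY}(AZ)-A(R_{XY}Z)$, and $RA=0$ means that this vanishes for all $X,Y,Z$ tangent to $M$. *)

(* Defs.v *)
(* MathComp-Analysis.  Tangent vectors are coordinate row vectors, so linear
   maps act by right multiplication, and [jacobian f y] is the matrix whose
   i-th row is the i-th partial derivative of [f].  Tensor fields on a manifold
   are families of chart expressions obeying the transformation law. *)
From HB Require Import structures.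
From mathcomp Require Import all_boot all_order all_algebra.
From mathcomp Require Import all_classical all_reals all_analysis.

Set Implicit Arguments.
Unset Strict Implicit.
Unset Printing Implicit Defensive.

Import Order.TTheory GRing.Theory Num.Theory.
Import numFieldNormedType.Exports.
Local Open Scope classical_set_scope.
Local Open Scope ring_scope.

(* For [U] open, [Ck_on U k.+1 f] says that [f] is differentiable on [U] with
   all its directional derivatives of class C^k on [U]. *)
Fixpoint Ck_on (R : realType) (V W : normedModType R) (U : set V) (k : nat)
    (f : V -> W) : Prop :=
  match k with
  | 0 => forall x, U x -> {for x, continuous f}
  | k'.+1 => (forall x, U x -> differentiable f x) /\
             (forall v, Ck_on U k' (fun x => 'D_v f x))
  end.

Definition smooth_on (R : realType) (V W : normedModType R) (U : set V)
    (f : V -> W) : Prop :=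
  forall k, Ck_on U k f.

Record manifold (R : realType) (n : nat) := Manifold {
  carrier :> topologicalType;
  man_hausdorff : hausdorff_space carrier;
  man_second_countable : @second_countable carrier;
  man_nonempty : [set: carrier] !=set0;
  chart_index : Type;
  dom : chart_index -> set carrier;
  coord : chart_index -> carrier -> 'rV[R]_n;
  param : chart_index -> 'rV[R]_n -> carrier;
  dom_open : forall i, open (dom i);
  dom_cover : forall x, exists i, dom i x;
  img_open : forall i, open (coord i @` dom i);
  coordK : forall i x, dom i x -> param i (coord i x) = x;
  coord_continuous : forall i x, dom i x -> {for x, continuous (coord i)};
  param_continuous :
    forall i y, (coord i @` dom i) y -> {for y, continuous (param i)};
  transition_smooth : forall i j,
    smooth_on (coord i @` (dom i `&` dom j)) (coord j \o param i)
}.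

Definition img (R : realType) (n : nat) (M : manifold R n)
    (i : chart_index M) : set 'rV[R]_n :=
  coord i @` dom i.

Definition transition (R : realType) (n : nat) (M : manifold R n)
    (i j : chart_index M) : 'rV[R]_n -> 'rV[R]_n :=
  coord j \o param i.

Section LocalGeometry.
Variables (R : realType) (n : nat).
Implicit Types (g : 'rV[R]_n -> 'M[R]_n) (X Y Z : 'rV[R]_n -> 'rV[R]_n).
Implicit Types (u v w y : 'rV[R]_n).

Definition form (G : 'M[R]_n) u v : R := (u *m G *m v^T) 0 0.

(* Christoffel symbols of the first kind,
   (d_u g(v,w) + d_v g(u,w) - d_w g(u,v)) / 2 for constant u, v, w. *)
Definition christoffel1 g y u v w : R :=
  2^-1 * (form ('D_u g y) v w + form ('D_v g y) u w - form ('D_w g y) u v).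

Definition christoffel g y u v : 'rV[R]_n :=
  (\row_k christoffel1 g y u v (delta_mx 0 k)) *m invmx (g y).

(* The Levi-Civita connection of [g]: derivative of [Y] along [v] at [y]. *)
Definition nabla g v Y y : 'rV[R]_n := 'D_v Y y + christoffel g y v (Y y).

Definition bracket X Y y : 'rV[R]_n := 'D_(X y) Y y - 'D_(Y y) X y.

Definition curvature g X Y Z y : 'rV[R]_n :=
  nabla g (X y) (fun z => nabla g (Y z) Z z) y
  - nabla g (Y y) (fun z => nabla g (X z) Z z) y
  - nabla g (bracket X Y y) Z y.

(* The curvature tensor on tangent vectors at [y].  By tensoriality any
   extensions to vector fields may be used; these are constant in the chart. *)
Definition Riem g y u v w : 'rV[R]_n :=
  curvature g (fun=> u) (fun=> v) (fun=> w) y.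

Definition sectional g y u v : R :=
  form (g y) (Riem g y u v v) u /
  (form (g y) u u * form (g y) v v - form (g y) u v ^+ 2).

End LocalGeometry.

Record metric (R : realType) (n : nat) (M : manifold R n) := Metric {
  metric_at :> chart_index M -> 'rV[R]_n -> 'M[R]_n;
  metric_smooth : forall i, smooth_on (img i) (metric_at i);
  metric_sym : forall i y, img i y -> (metric_at i y)^T = metric_at i y;
  metric_pos : forall i y v, img i y -> v != 0 -> 0 < form (metric_at i y) v v;
  metric_compat : forall i j x, dom i x -> dom j x ->
    let T := jacobian (transition i j) (coord i x) in
    metric_at i (coord i x) = T *m metric_at j (coord j x) *m T^T
}.

Record endo_field (R : realType) (n : nat) (M : manifold R n) := EndoField {
  endo_at :> chart_index M -> 'rV[R]_n -> 'M[R]_n;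
  endo_smooth : forall i, smooth_on (img i) (endo_at i);
  endo_compat : forall i j x, dom i x -> dom j x ->
    let T := jacobian (transition i j) (coord i x) in
    endo_at i (coord i x) *m T = T *m endo_at j (coord j x)
}.

Definition flat (R : realType) (n : nat) (M : manifold R n) (g : metric M) :
    Prop :=
  forall (i : chart_index M) y u v w, img i y -> Riem (g i) y u v w = 0.

Definition kaehler (R : realType) (n : nat) (M : manifold R n)
    (g : metric M) (J : endo_field M) : Prop :=
  forall (i : chart_index M) y, img i y ->
    [/\ J i y *m J i y = - 1%:M,
        forall u v, form (g i y) (u *m J i y) (v *m J i y) = form (g i y) u v &
        forall v (Y : 'rV[R]_n -> 'rV[R]_n), smooth_on (img i) Y ->
          nabla (g i) v (fun z => Y z *m J i z) y
          = nabla (g i) v Y y *m J i y].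

Definition complex_space_form (R : realType) (n : nat) (M : manifold R n)
    (g : metric M) (J : endo_field M) (k : R) : Prop :=
  kaehler g J /\
  forall (i : chart_index M) y v, img i y -> v != 0 ->
    sectional (g i) y v (v *m J i y) = k.

Section Submanifold.
Variables (R : realType) (n m : nat) (M : manifold R n) (N : manifold R m).
Variable f : M -> N.

Definition loc_dom (i : chart_index M) (j : chart_index N) : set 'rV[R]_n :=
  [set y | img i y /\ dom j (f (param i y))].

Definition loc (i : chart_index M) (j : chart_index N) :
    'rV[R]_n -> 'rV[R]_m :=
  coord j \o f \o param i.

(* The rows of [tangent i j y] span the image of the tangent space of [M]. *)
Definition tangent (i : chart_index M) (j : chart_index N) (y : 'rV[R]_n) :
    'M[R]_(n, m) :=
  jacobian (loc i j) y.

Definition smooth_map : Prop :=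
  continuous f /\ forall i j, smooth_on (loc_dom i j) (loc i j).

Definition immersion : Prop :=
  smooth_map /\ forall i j y, loc_dom i j y -> row_free (tangent i j y).

Definition isometric (g : metric M) (h : metric N) : Prop :=
  forall i j y, loc_dom i j y ->
    g i y = tangent i j y *m h j (loc i j y) *m (tangent i j y)^T.

(* Smooth vector fields of [N] along [f]; [field_at j x] is the coordinate
   vector, in the chart [j] of [N], of the value at the point [x] of [M]. *)
Record field_along := FieldAlong {
  field_at :> chart_index N -> M -> 'rV[R]_m;
  field_smooth : forall i j, smooth_on (loc_dom i j) (field_at j \o param i);
  field_compat : forall j k x, dom j (f x) -> dom k (f x) ->
    field_at k x = field_at j x *m jacobian (transition j k) (coord j (f x))
}.

(* The Levi-Civita connection of [h], pulled back to vector fields along [f]. *)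
Definition nabla_along (h : metric N) (xi : field_along) i j
    (X y : 'rV[R]_n) : 'rV[R]_m :=
  'D_X (xi j \o param i) y
  + christoffel (h j) (loc i j y) (X *m tangent i j y) (xi j (param i y)).

Definition normal_at (h : metric N) i j (y : 'rV[R]_n) (v : 'rV[R]_m) : Prop :=
  forall X : 'rV[R]_n, form (h j (loc i j y)) (X *m tangent i j y) v = 0.

Definition holomorphic_tangent (J : endo_field N) i j (y : 'rV[R]_n) :
    'M[R]_m :=
  ((tangent i j y *m J j (loc i j y)) :&: tangent i j y)%MS.

(* Half of the real dimension, which is even since the subspace is
   J-invariant. *)
Definition CR_dim_at (J : endo_field N) i j (y : 'rV[R]_n) : nat :=
  (\rank (holomorphic_tangent J i j y))./2.

Definition maximal_CR (J : endo_field N) : Prop :=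
  forall i j y, loc_dom i j y -> n = (CR_dim_at J i j y).*2.+1.

Definition distinguished_normal (h : metric N) (J : endo_field N)
    (xi : field_along) : Prop :=
  forall i j y, loc_dom i j y ->
    let v := xi j (param i y) in
    [/\ form (h j (loc i j y)) v v = 1,
        normal_at h i j y v &
        (tangent i j y *m J j (loc i j y) <= tangent i j y + v)%MS].

(* Weingarten formula; [D] is the normal covariant derivative of [xi]. *)
Definition shape_operator (h : metric N) (xi : field_along)
    (A : endo_field M) : Prop :=
  forall i j y, loc_dom i j y -> forall X : 'rV[R]_n,
    exists2 D : 'rV[R]_m, normal_at h i j y D &
      nabla_along h xi i j X y = - (X *m A i y *m tangent i j y) + D.

End Submanifold.

Definition curvature_commutes (R : realType) (n : nat) (M : manifold R n)
    (g : metric M) (A : endo_field M) : Prop :=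
  forall (i : chart_index M) y X Y Z, img i y ->
    Riem (g i) y X Y (Z *m A i y) = Riem (g i) y X Y Z *m A i y.

(* Main.v *)
Require Import Defs.
From HB Require Import structures.
From mathcomp Require Import all_boot all_order all_algebra.
From mathcomp Require Import all_classical all_reals all_analysis.
From mathcomp Require Import ring lra zify.

Import Order.TTheory GRing.Theory Num.Theory.
Import numFieldNormedType.Exports.
Local Open Scope ring_scope.

Local Notation form := Defs.form.

(** Why the theorem holds.  Suppose [c] is not zero and work at one point, in
    one chart of each manifold.  Let T be the tangent space of M, F the
    tangential part of J on T and U = - J xi.  Since [n] is odd, T is not
    J-invariant; this forces U to be a unit vector of T, and F is a complex
    structure on its orthogonal complement H, the maximal complex subspace.

    By the Gauss equation the curvature of M is R = S + A /\ A, where S collects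
    the space form tensor and the part sigma of the second fundamental form
    orthogonal to xi.  As J is parallel, sigma is complex linear in each
    argument from H, so S is F-invariant in two arguments from H ([pcF]) and its
    bisectional curvature is computed by [pc_bisectional].  Only p - 1 normal
    directions are left besides xi and p < n, so any linear map from T to them
    kills a nonzero vector of H ([normal_kernel]).  With [c] nonzero, these two
    facts show that S has no nullity ([pc_nullity]).

    The hypothesis RA = 0 and the pair symmetry of R give
    R(AX, Y) = R(X, AY) ([RmA]), which restricts A as follows.

    If A is singular but not zero ([singular_shape]), then S(X, Y) = 0 for X in
    ker A and Y in im A.  Such an orthogonal splitting of T is incompatible with
    F, whether U has components in both summands ([split_both]) or lies in one
    of them ([split_one]).

    If A is invertible, then AX /\ Y - X /\ AY is a difference of two values of
    S, hence F-invariant on H ([shape_testF]).  For n at least 4 linear algebra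
    then gives A U = mu U and A = lam on H; for n = 3 the same follows by
    computing with the entries of A in a frame ([shape_small]).

    This also holds if A = 0.  Choosing x in H with sigma(U, x) = 0, the equation
    R(AU, y) = R(U, Ay) for y = x and y = F x yields (lam - mu) (c + lam mu) = 0
    ([eta_umbilical]).  In the directions x and F x the field xi is parallel in
    the normal bundle, and the Codazzi equation for them gives
    c = lam ^ 2 - mu lam ([local_flat]).  The two relations imply c = 0.

    Finally the curvature tensor of a Kaehler metric is determined by its
    holomorphic sectional curvature ([space_form_curvatureE]), so c = 0 makes
    the ambient metric flat.

    The identities of Riemannian geometry are obtained from one operation, the
    covariant derivative [cov] of vector fields along a map: it is compatible
    with the metric, torsion free, and its commutator is the curvature.  The
    Gauss equation, for example, is the derivative of
    < D_v (d phi w), d phi t > = < Gamma(v, w), t >. *)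

(** * Calculus of matrix-valued maps *)

Section Calc.
Context {R : realType}.

Lemma near_eq_differentiable {V W : normedModType R} (f g : V -> W) (x : V) :
  {near x, f =1 g} -> differentiable f x -> differentiable g x.
Proof.
move=> fg df.
have dc : continuous ('d f x) by exact: diff_continuous.
have E : g \o shift x = cst (g x) + 'd f x +o_ (0 : V) id.
  have /diff_locallyP [_ /eqaddoP fo] := df.
  apply/eqaddoP => e e0; have := fo e e0.
  rewrite -!nbhs_nearE; apply: filter_app.
  have := fg; rewrite (near_shift 0)/= => /filterS; apply => h /=.
  by rewrite subr0 => fgh; rewrite -(nbhs_singleton fg) !fctE /= -fgh.
have D := diff_unique dc E.
by apply/diff_locallyP; rewrite D; split.
Qed.

Lemma differentiable_mxE {V : normedModType R} {m n : nat}
    (M : V -> 'M[R]_(m, n)) x :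
  differentiable M x <-> forall i j, differentiable (fun y => M y i j) x.
Proof.
split=> [dM i j|dM].
  by apply: (@differentiable_comp _ _ _ _ M (fun N : 'M[R]_(m, n) => N i j)) => //;
    exact: differentiable_coord.
have -> : M = \sum_(i < m) \sum_(j < n) (fun y => M y i j *: delta_mx i j).
  apply/funext => y; rewrite [LHS]matrix_sum_delta fct_sumE.
  by apply: eq_bigr => i _; rewrite fct_sumE.
apply: differentiable_sum => i; apply: differentiable_sum => j.
exact: differentiableZl.
Qed.

Lemma derive_mx_entry {V : normedModType R} {m n : nat}
    (M : V -> 'M[R]_(m, n)) x v i j : differentiable M x ->
  ('D_v M x) i j = 'D_v (fun y => M y i j) x.
Proof. by move=> dM; rewrite derive_mx ?mxE//; exact: diff_derivable. Qed.

Lemma derive_chain {U V W : normedModType R} (f : V -> W) (p : U -> V) y v :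
  differentiable p y -> differentiable f (p y) ->
  'D_v (f \o p) y = 'D_('D_v p y) f (p y).
Proof.
move=> dp df; have dc := differentiable_comp dp df.
by rewrite (deriveE _ dc) (deriveE _ dp) (deriveE _ df) diff_comp.
Qed.

Definition bilin {p q : nat} {W : lmodType R}
    (B : 'rV[R]_p -> 'rV[R]_q -> W) : Prop :=
  (forall w, linear (B^~ w)) /\ (forall u, linear (B u)).

Lemma linear_row_sum {p : nat} {W : lmodType R} {L : 'rV[R]_p -> W} u :
  linear L -> L u = \sum_i u 0 i *: L (delta_mx 0 i).
Proof.
move=> lL; pose LM := GRing.isLinear.Build _ _ _ _ L lL.
pose LL : {linear _ -> _} := HB.pack L LM.
rewrite [u in LHS]row_sum_delta -[L]/(LL : _ -> _) linear_sum.
by apply: eq_bigr => i _; rewrite linearZ.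
Qed.

Lemma bilin_row_sum {p q : nat} {W : lmodType R}
    {B : 'rV[R]_p -> 'rV[R]_q -> W} u w : bilin B ->
  B u w = \sum_i \sum_j (u 0 i * w 0 j) *: B (delta_mx 0 i) (delta_mx 0 j).
Proof.
move=> [Bl Br]; rewrite (linear_row_sum u (Bl w)); apply: eq_bigr => i _.
rewrite (linear_row_sum w (Br _)) scaler_sumr.
by apply: eq_bigr => j _; rewrite scalerA.
Qed.

(** Expanding [K z] on the standard bases turns the function into a finite sum of
    products of scalar functions, so that the dependence of [K z] on [z] only
    has to be controlled for fixed arguments [u] and [w]. *)
Lemma derive_bilin_scalar {V Z : normedModType R} {p q : nat} {O : set Z}
    (K : Z -> 'rV[R]_p -> 'rV[R]_q -> R) (f : V -> Z)
    (a : V -> 'rV[R]_p) (b : V -> 'rV[R]_q) (y v : V) :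
  open O -> O (f y) -> (forall z, O z -> bilin (K z)) ->
  (forall u w, differentiable (fun z => K z u w) (f y)) ->
  differentiable f y -> differentiable a y -> differentiable b y ->
  differentiable (fun y => K (f y) (a y) (b y)) y /\
  'D_v (fun y => K (f y) (a y) (b y)) y =
    'D_('D_v f y) (fun z => K z (a y) (b y)) (f y)
    + K (f y) ('D_v a y) (b y) + K (f y) (a y) ('D_v b y).
Proof.
move=> oO Oy Kb dK df da db.
have nO : \forall z \near f y, O z by exact: open_nbhs_nbhs.
have nf : \forall x \near y, O (f x).
  exact: (differentiable_continuous df).
pose e i : 'rV[R]_p := delta_mx 0 i; pose e' j : 'rV[R]_q := delta_mx 0 j.
pose S := \sum_i \sum_j
   (fun x => a x 0 i * b x 0 j * K (f x) (e i) (e' j)) : V -> R.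
have SE : {near y, S =1 (fun x => K (f x) (a x) (b x))}.
  near=> x; rewrite (bilin_row_sum (a x) (b x) (Kb (f x) _)); last first.
    by near: x.
  by rewrite /S fct_sumE; apply: eq_bigr => i _; rewrite fct_sumE.
have da' i : differentiable (fun x => a x 0 i) y.
  by have /differentiable_mxE := da; apply.
have db' i : differentiable (fun x => b x 0 i) y.
  by have /differentiable_mxE := db; apply.
have dKf i j : differentiable (fun x => K (f x) (e i) (e' j)) y.
  by apply: (differentiable_comp df (dK _ _)).
have dS : differentiable S y.
  apply: differentiable_sum => i; apply: differentiable_sum => j.
  by apply: differentiableM => //; apply: differentiableM.
split; first exact: near_eq_differentiable SE dS.
rewrite -(near_eq_derive v SE) /S.
rewrite derive_sum; last first.
  move=> i; apply/diff_derivable; apply: differentiable_sum => j.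
  by apply: differentiableM => //; apply: differentiableM.
have -> : 'D_('D_v f y) (fun z => K z (a y) (b y)) (f y) =
   \sum_i \sum_j a y 0 i * b y 0 j *
      'D_('D_v f y) (fun z => K z (e i) (e' j)) (f y).
  rewrite (@near_eq_derive _ _ _ _ (\sum_i \sum_j
   (a y 0 i * b y 0 j) *: (fun z => K z (e i) (e' j)) : Z -> R)); last first.
    near=> z; rewrite (bilin_row_sum (a y) (b y) (Kb z _)); last first.
      by near: z.
    by rewrite fct_sumE; apply: eq_bigr => i _; rewrite fct_sumE.
  rewrite derive_sum; last first.
    move=> i; apply/diff_derivable; apply: differentiable_sum => j.
    exact: differentiableZ.
  apply: eq_bigr => i _; rewrite derive_sum; last first.
    by move=> j; apply/diff_derivable; exact: differentiableZ.
  by apply: eq_bigr => j _; rewrite deriveZ//; exact/diff_derivable.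
rewrite (bilin_row_sum ('D_v a y) (b y) (Kb _ Oy)).
rewrite (bilin_row_sum (a y) ('D_v b y) (Kb _ Oy)).
rewrite -!big_split; apply: eq_bigr => i _ /=.
rewrite -!big_split derive_sum; last first.
  move=> j; apply/diff_derivable.
  by apply: differentiableM => //; apply: differentiableM.
apply: eq_bigr => j _ /=.
rewrite (@deriveM _ _ (fun x => a x 0 i * b x 0 j)); first last.
- exact/diff_derivable.
- by apply/diff_derivable/differentiableM.
rewrite (@deriveM _ _ (fun x => a x 0 i)); first last.
- exact/diff_derivable.
- exact/diff_derivable.
rewrite (derive_chain (fun z => K z (e i) (e' j)) f) //.
rewrite -!derive_mx_entry //= /GRing.scale /= -/(e i) -/(e' j); ring.
Unshelve. all: by end_near. Qed.

End Calc.

(** * Symmetry of second derivatives *)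

Section Young.
Local Open Scope classical_set_scope.
Local Open Scope ring_scope.
Context {R : realType} {V : normedModType R}.

Lemma is_derive_line (f : V -> R) (a u : V) (s : R) :
  differentiable f (s *: u + a) ->
  is_derive s 1 (fun t : R => f (t *: u + a)) ('D_u f (s *: u + a)).
Proof.
move=> df.
have dl : is_diff s (fun t : R => t *: u + a) (fun t : R => t *: u).
  by apply: is_diff_eq; rewrite /= addr0.
have dl' : differentiable (fun t : R => t *: u + a) s by [].
have dc : differentiable (f \o (fun t : R => t *: u + a)) s.
  exact: differentiable_comp.
apply: DeriveDef; first exact: diff_derivable.
rewrite derive_chain// (deriveE _ dl') diff_val scale1r //.
Qed.

Let delta2 (f : V -> R) x u v (h : R) : R :=
  f (h *: u + (h *: v + x)) - f (h *: u + x) - (f (h *: v + x) - f x).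

(** The mean value theorem for t |-> f (x + t u + h v) - f (x + t u) turns the
    second difference into a difference of two values of ['D_u f] near [x],
    which differentiability of ['D_u f] at [x] evaluates up to o(h). *)
Lemma second_difference (f : V -> R) (x u v : V) (e : R) : 0 < e ->
  (\forall y \near x, differentiable f y) -> differentiable ('D_u f) x ->
  \forall h \near 0^'+,
   `|delta2 f x u v h - h ^+ 2 * 'D_v ('D_u f) x| <=
      e * h ^+ 2 * (2 * (`|u| + `|v|)).
Proof.
move=> e0 nf dg.
set g := 'D_u f in dg *; pose L := 'd g x.
have /eqaddoP/(_ e e0) := diff_locally dg.
rewrite -nbhs_nearE => ng.
have nf' : \forall k \near (0 : V), differentiable f (k + x).
  by have := nf; rewrite (near_shift 0)/= => /filterS; apply => k /=; rewrite subr0.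
have ng' : nbhs (0 : V)
   (fun k : V => `|(g \o shift x - (cst (g x) + 'd g x)) k| <= e * `|k|) := ng.
have [r /= r0 rP] := (nbhs_norm0P).1 (filterI ng' nf').
have {}rP k : `|k| < r -> `|g (k + x) - g x - L k| <= e * `|k| /\
   differentiable f (k + x).
  move=> kr; have [A B] := rP k kr.
  by split => //; move: A; rewrite !fctE opprD addrA.
pose C := `|u| + `|v|.
have C0 : 0 <= C by rewrite addr_ge0.
have C1 : 0 < C + 1 by rewrite ltr_wpDl.
near=> h.
have h0 : 0 < h by near: h; exact: nbhs_right_gt.
have hr : h * (C + 1) < r.
  rewrite -ltr_pdivlMr//; near: h; apply: nbhs_right_lt.
  exact: (divr_gt0 r0 C1).
have hCr : h * C < r by apply: le_lt_trans hr; rewrite ler_pM2l// lerDl.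
have n1 s : 0 <= s <= h -> `|s *: u + h *: v| <= h * C.
  move=> /andP[s0 sh]; rewrite (le_trans (ler_normD _ _))// !normrZ.
  by rewrite !ger0_norm ?(ltW h0)// mulrDr lerD// ler_wpM2r.
have n2 s : 0 <= s <= h -> `|s *: u| <= h * C.
  move=> /andP[s0 sh]; rewrite normrZ ger0_norm// mulrDr.
  by rewrite -[leLHS]addr0 lerD// ?ler_wpM2r// mulr_ge0// ltW.
have dF s : 0 <= s <= h -> is_derive s (1 : R)
   (fun t : R => f (t *: u + (h *: v + x)) - f (t *: u + x))
   (g (s *: u + (h *: v + x)) - g (s *: u + x)).
  move=> sh; apply: is_deriveB; apply: is_derive_line.
    by rewrite addrA; apply: (rP _ _).2; exact: le_lt_trans (n1 _ sh) _.
  by apply: (rP _ _).2; exact: le_lt_trans (n2 _ sh) _.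
have [|||s sh] := @MVT_segment R
   (fun t : R => f (t *: u + (h *: v + x)) - f (t *: u + x))
   (fun s => g (s *: u + (h *: v + x)) - g (s *: u + x)) 0 h.
- exact: ltW.
- by move=> s; rewrite in_itv /= => /andP[s0 sh]; apply: dF; rewrite !ltW.
- apply: derivable_within_continuous => s; rewrite in_itv /= => sh.
  by have := dF s sh => -[].
rewrite !scale0r !add0r subr0 => E.
rewrite /delta2 E deriveE// -/L.
have sh' : 0 <= s <= h by move: sh; rewrite in_itv.
have [A _] := rP _ (le_lt_trans (n1 s sh') hCr).
have [B _] := rP _ (le_lt_trans (n2 s sh') hCr).
have Lh : L (h *: v) = h * L v by rewrite linearZ.
rewrite linearD Lh -(addrA (s *: u)) in A.
have -> : (g (s *: u + (h *: v + x)) - g (s *: u + x)) * h - h ^+ 2 * L v =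
  h * ((g (s *: u + (h *: v + x)) - g x - (L (s *: u) + h * L v))
   - (g (s *: u + x) - g x - L (s *: u))) by ring.
rewrite normrM gtr0_norm// expr2 -!mulrA.
have -> : e * (h * (h * (2 * (`|u| + `|v|)))) =
   h * (e * (h * C) + e * (h * C)) by rewrite /C; ring.
rewrite ler_pM2l// (le_trans (ler_normB _ _))// lerD//.
  by rewrite (le_trans A)// ler_pM2l// n1.
by rewrite (le_trans B)// ler_pM2l// n2.
Unshelve. all: by end_near. Qed.

(** The second difference is symmetric in [u] and [v], and divided by h ^ 2 it
    tends to both mixed derivatives. *)
Lemma derive_commute_scalar (f : V -> R) (x u v : V) :
  (\forall y \near x, differentiable f y) ->
  differentiable ('D_u f) x -> differentiable ('D_v f) x ->
  'D_u ('D_v f) x = 'D_v ('D_u f) x.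
Proof.
move=> nf du dv; apply/eqP; rewrite -subr_eq0 -normr_le0; apply/ler_addgt0Pl => e e0.
rewrite addr0; pose C := 4 * (`|u| + `|v|) + 1.
have C0 : 0 < C by rewrite ltr_wpDl// mulr_ge0// addr_ge0.
have e1 : 0 < e / C by rewrite divr_gt0.
have A := second_difference f x u v (e / C) e1 nf du.
have B := second_difference f x v u (e / C) e1 nf dv.
have [h [h0 [hA hB]]] : exists h : R, 0 < h /\
   (`|delta2 f x u v h - h ^+ 2 * 'D_v ('D_u f) x| <=
      e / C * h ^+ 2 * (2 * (`|u| + `|v|)) /\
   `|delta2 f x v u h - h ^+ 2 * 'D_u ('D_v f) x| <=
      e / C * h ^+ 2 * (2 * (`|v| + `|u|))).
  near (0 : R)^'+ => h; exists h; split; first by near: h; exact: nbhs_right_gt.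
  by split; near: h.
have dd : delta2 f x v u h = delta2 f x u v h.
  by rewrite /delta2 (addrCA (h *: v)); ring.
rewrite dd in hB.
move: hA hB; move: (delta2 f x u v h) ('D_u ('D_v f) x) ('D_v ('D_u f) x).
move=> d a b hA hB.
have h2 : 0 < h ^+ 2 by rewrite exprn_gt0.
rewrite -(ler_pM2l h2) -[X in X * `|_|]gtr0_norm// -normrM.
have -> : h ^+ 2 * (a - b) = (d - h ^+ 2 * b) - (d - h ^+ 2 * a) by ring.
rewrite (le_trans (ler_normB _ _))// (le_trans (lerD hA hB))//.
have -> : e / C * h ^+ 2 * (2 * (`|u| + `|v|)) + e / C * h ^+ 2 * (2 * (`|v| + `|u|))
  = h ^+ 2 * (e * ((C - 1) / C)) by rewrite /C; ring.
rewrite ler_pM2l// -[leRHS]mulr1 ler_pM2l// ler_pdivrMr// mul1r.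
by rewrite gerBl.
Unshelve. all: by end_near. Qed.

Lemma derive_commute {m n : nat} (f : V -> 'M[R]_(m, n)) (x u v : V) :
  (\forall y \near x, differentiable f y) ->
  (\forall y \near x, differentiable ('D_u f) y) ->
  (\forall y \near x, differentiable ('D_v f) y) ->
  'D_u ('D_v f) x = 'D_v ('D_u f) x.
Proof.
move=> nf nu nv; apply/matrixP => i j.
have E w : \forall y \near x, ('D_w f) y i j = 'D_w (fun z => f z i j) y.
  by near=> y; rewrite derive_mx_entry//; near: y.
have dE w : (\forall y \near x, differentiable ('D_w f) y) ->
    differentiable ('D_w (fun z => f z i j)) x.
  move=> nw; apply: near_eq_differentiable (E w) _.
  by have /differentiable_mxE := nbhs_singleton nw; apply.
have du : differentiable ('D_u f) x := nbhs_singleton nu.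
have dv : differentiable ('D_v f) x := nbhs_singleton nv.
have Euv := derive_mx_entry ('D_v f) x u i j dv.
have Evu := derive_mx_entry ('D_u f) x v i j du.
rewrite [LHS]Euv [RHS]Evu.
rewrite [LHS](near_eq_derive _ (E v)) [RHS](near_eq_derive _ (E u)).
apply: derive_commute_scalar; [|exact: dE|exact: dE].
near=> y; have /differentiable_mxE : differentiable f y by near: y.
exact.
Unshelve. all: by end_near. Qed.

End Young.

(** * Bilinear forms given by matrices *)

Section Forms.
Context {R : realType}.

Section FormAlgebra.
Context {n : nat} {G : 'M[R]_n}.
Implicit Types u v w : 'rV[R]_n.

Lemma formDl u v w : form G (u + v) w = form G u w + form G v w.
Proof. by rewrite /form !mulmxDl mxE. Qed.
Lemma formDr u v w : form G u (v + w) = form G u v + form G u w.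
Proof. by rewrite /form linearD mulmxDr mxE. Qed.
Lemma formZl a u w : form G (a *: u) w = a * form G u w.
Proof. by rewrite /form -!scalemxAl mxE. Qed.
Lemma formZr a u w : form G u (a *: w) = a * form G u w.
Proof. by rewrite /form linearZ /= -scalemxAr mxE. Qed.
Lemma formNl u w : form G (- u) w = - form G u w.
Proof. by rewrite -scaleN1r formZl mulN1r. Qed.
Lemma formNr u w : form G u (- w) = - form G u w.
Proof. by rewrite -scaleN1r formZr mulN1r. Qed.
Lemma form0l w : form G 0 w = 0.
Proof. by rewrite -(scale0r 0) formZl mul0r. Qed.
Lemma form0r w : form G w 0 = 0.
Proof. by rewrite -(scale0r 0) formZr mul0r. Qed.
Lemma form_bilin : bilin (form G).
Proof.
by split=> [w a u v|u a v w]; rewrite ?formDl ?formDr ?formZl ?formZr.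
Qed.
Lemma formC u v : G^T = G -> form G u v = form G v u.
Proof.
move=> Gs; rewrite /form -[in LHS](trmxK (u *m G *m v^T)) mxE.
by rewrite !trmx_mul trmxK Gs mulmxA.
Qed.

Hypothesis Gpos : forall v, v != 0 -> 0 < form G v v.

Lemma form_ge0 v : 0 <= form G v v.
Proof.
by have [->|/Gpos/ltW//] := eqVneq v 0; rewrite form0l.
Qed.
Lemma form_eq0 v : (form G v v == 0) = (v == 0).
Proof.
have [->|v0] := eqVneq v 0; first by rewrite form0l eqxx.
by rewrite gt_eqF ?Gpos.
Qed.

Lemma form_nondeg u : (forall v, form G u v = 0) -> u = 0.
Proof. by move=> /(_ u)/eqP; rewrite form_eq0 => /eqP. Qed.

Lemma form_inj u v : (forall w, form G u w = form G v w) -> u = v.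
Proof.
move=> uv; apply/eqP; rewrite -subr_eq0; apply/eqP/form_nondeg => w.
by rewrite formDl formNl uv subrr.
Qed.

Lemma form_unitmx : G \in unitmx.
Proof.
rewrite -row_free_unit; apply: inj_row_free => v vG.
by apply: form_nondeg => w; rewrite /form vG mul0mx mxE.
Qed.

End FormAlgebra.

Lemma form_mulmx {n m : nat} (T : 'M[R]_(n, m)) (G : 'M[R]_m) u v :
  form (T *m G *m T^T) u v = form G (u *m T) (v *m T).
Proof. by rewrite /form trmx_mul !mulmxA. Qed.

Lemma formM {n : nat} (F G : 'M[R]_n) u v :
  form (F + G) u v = form F u v + form G u v.
Proof. by rewrite /form mulmxDr mulmxDl mxE. Qed.

Context {V : normedModType R}.

Lemma differentiable_bigsum {I : Type} (r : seq I) (f : I -> V -> R) x :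
  (forall i, differentiable (f i) x) ->
  differentiable (fun y => \sum_(i <- r) f i y) x.
Proof.
move=> df; elim: r => [|i r IH].
  by under eq_fun do rewrite big_nil; exact: differentiable_cst.
by under eq_fun do rewrite big_cons; exact: differentiableD.
Qed.

Lemma differentiable_bigprod {I : Type} (r : seq I) (f : I -> V -> R) x :
  (forall i, differentiable (f i) x) ->
  differentiable (fun y => \prod_(i <- r) f i y) x.
Proof.
move=> df; elim: r => [|i r IH].
  by under eq_fun do rewrite big_nil; exact: differentiable_cst.
by under eq_fun do rewrite big_cons; exact: differentiableM.
Qed.

Lemma differentiable_mulmx {m n p : nat} (A : V -> 'M[R]_(m, n))
    (B : V -> 'M[R]_(n, p)) x :
  differentiable A x -> differentiable B x ->
  differentiable (fun y => A y *m B y) x.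
Proof.
move=> /differentiable_mxE dA /differentiable_mxE dB.
apply/differentiable_mxE => i j; under eq_fun do rewrite mxE.
by apply: differentiable_bigsum => k; apply: differentiableM.
Qed.

Lemma differentiable_trmx {m n : nat} (A : V -> 'M[R]_(m, n)) x :
  differentiable A x -> differentiable (fun y => (A y)^T) x.
Proof.
move=> /differentiable_mxE dA; apply/differentiable_mxE => i j.
by under eq_fun do rewrite mxE.
Qed.

Lemma differentiable_det {n : nat} (A : V -> 'M[R]_n) x :
  differentiable A x -> differentiable (fun y => \det (A y)) x.
Proof.
move=> /differentiable_mxE dA; rewrite /determinant.
apply: differentiable_bigsum => s; apply: differentiableM.
  exact: differentiable_cst.
by apply: differentiable_bigprod => i.
Qed.

(** By Cramer's rule the entries of the inverse are quotients of determinants. *)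
Lemma differentiable_invmx {n : nat} (A : V -> 'M[R]_n) x :
  (\forall y \near x, A y \in unitmx) ->
  differentiable A x -> differentiable (fun y => invmx (A y)) x.
Proof.
move=> Au dA.
apply: (@near_eq_differentiable _ _ _
    (fun y => (\det (A y))^-1 *: \adj (A y))).
  by near=> y; rewrite /invmx (_ : A y \in unitmx)//; near: y.
apply/differentiable_mxE => i j; under eq_fun do rewrite !mxE.
apply: differentiableM.
  apply: differentiableV; first exact: differentiable_det.
  by have := nbhs_singleton Au; rewrite unitmxE unitfE.
apply: differentiableM; first exact: differentiable_cst.
apply: differentiable_det; apply/differentiable_mxE => k l.
under eq_fun do rewrite !mxE.
by have /differentiable_mxE := dA; apply.
Unshelve. all: by end_near. Qed.

Lemma derive_form {n : nat} (M : V -> 'M[R]_n) (a b : V -> 'rV[R]_n) y v :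
  differentiable M y -> differentiable a y -> differentiable b y ->
  differentiable (fun y => form (M y) (a y) (b y)) y /\
  'D_v (fun y => form (M y) (a y) (b y)) y =
    form ('D_v M y) (a y) (b y) + form (M y) ('D_v a y) (b y)
    + form (M y) (a y) ('D_v b y).
Proof.
move=> dM da db.
have E u w : (fun z : 'M[R]_n => form z u w) =
  \sum_i \sum_j (u 0 i * w 0 j) *: (fun z : 'M[R]_n => z i j : R).
  apply/funext => z; rewrite (bilin_row_sum _ _ (form_bilin (G := z))).
  rewrite fct_sumE; apply: eq_bigr => i _; rewrite fct_sumE.
  apply: eq_bigr => j _; rewrite fctE /form -rowE trmx_delta -colE !mxE//.
have dK u w (z : 'M[R]_n) : differentiable (fun z => form z u w) z.
  rewrite E; apply: differentiable_sum => i; apply: differentiable_sum => j.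
  exact/differentiableZ/differentiable_coord.
have [D ->] := @derive_bilin_scalar R V 'M[R]_n n n setT (@Defs.form R n) M a b y v
   openT I (fun z _ => form_bilin (G := z)) (fun u w => dK u w (M y)) dM da db.
split => //; congr (_ + _ + _).
rewrite E derive_sum; last first.
  move=> i; apply/diff_derivable; apply: differentiable_sum => j.
  exact/differentiableZ/differentiable_coord.
rewrite (bilin_row_sum _ _ (form_bilin (G := 'D_v M y))).
apply: eq_bigr => i _; rewrite derive_sum; last first.
  move=> j; apply/diff_derivable; exact/differentiableZ/differentiable_coord.
apply: eq_bigr => j _; rewrite deriveZ; last first.
  exact/diff_derivable/differentiable_coord.
rewrite -(derive_mx_entry id) // derive_id.
by rewrite /form -rowE trmx_delta -colE !mxE.
Qed.

End Forms.

(** * The Levi-Civita connection along a map *)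

(** The three tactics below replace the values of forms, derivatives and
    Christoffel symbols in a goal by variables, which leaves an identity between
    plain numbers or vectors. *)
Ltac gen_form := repeat match goal with
  |- context [Defs.form ?G ?u ?v] => generalize (Defs.form G u v); intro end.

Ltac gen_derive := repeat match goal with
  |- context [derive ?f ?x ?v] => generalize (derive f x v); intro end.

Ltac gen_christoffel := repeat match goal with
  |- context [christoffel ?f ?x ?v ?w] =>
    generalize (christoffel f x v w); intro end.

Section Connection.
Local Open Scope classical_set_scope.
Local Open Scope ring_scope.
Context {R : realType}.

Lemma derive_mulmx {V : normedModType R} {m n p : nat} (A : V -> 'M[R]_(m, n))
    (B : V -> 'M[R]_(n, p)) x v :
  differentiable A x -> differentiable B x ->
  'D_v (fun y => A y *m B y) x = 'D_v A x *m B x + A x *m 'D_v B x.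
Proof.
move=> dA dB; have dAB := differentiable_mulmx _ _ _ dA dB.
have /differentiable_mxE eA := dA; have /differentiable_mxE eB := dB.
apply/matrixP => i j; rewrite (derive_mx_entry _ _ v i j dAB).
have -> : (fun y => (A y *m B y) i j) =
    \sum_k ((fun y => A y i k) * (fun y => B y k j)).
  by apply/funext => y; rewrite mxE fct_sumE.
rewrite derive_sum; last by move=> k; apply/diff_derivable/differentiableM.
rewrite !mxE -big_split; apply: eq_bigr => k _ /=.
rewrite deriveM; [|exact/diff_derivable|exact/diff_derivable].
rewrite (derive_mx_entry _ _ v i k dA).
rewrite (derive_mx_entry _ _ v k j dB).
by rewrite addrC; congr (_ + _); exact: mulrC.
Qed.

Lemma derive_bilin {V Z : normedModType R} {p q m : nat} (O : set Z)
    (K : Z -> 'rV[R]_p -> 'rV[R]_q -> 'rV[R]_m) (f : V -> Z)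
    (a : V -> 'rV[R]_p) (b : V -> 'rV[R]_q) (y v : V) :
  open O -> O (f y) -> (forall z, O z -> bilin (K z)) ->
  (forall u w, differentiable (fun z => K z u w) (f y)) ->
  differentiable f y -> differentiable a y -> differentiable b y ->
  differentiable (fun y => K (f y) (a y) (b y)) y /\
  'D_v (fun y => K (f y) (a y) (b y)) y =
    'D_('D_v f y) (fun z => K z (a y) (b y)) (f y)
    + K (f y) ('D_v a y) (b y) + K (f y) (a y) ('D_v b y).
Proof.
move=> oO Oy Kb dK df da db.
have E j := derive_bilin_scalar (fun z u w => K z u w 0 j) f a b y v
  oO Oy.
have Kbj j z : O z -> bilin (fun u w => K z u w 0 j).
  by move=> /Kb[Kl Kr]; split=> [w c u u'|u c w w']; rewrite ?Kl ?Kr !mxE.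
have dKj j u w : differentiable (fun z => K z u w 0 j) (f y).
  by have /differentiable_mxE := dK u w; apply.
have {}E j := E j (Kbj j) (dKj j) df da db.
have dF : differentiable (fun y => K (f y) (a y) (b y)) y.
  by apply/differentiable_mxE => i j; rewrite ord1; apply: (E j).1.
split => //; apply/rowP => j.
rewrite (derive_mx_entry _ _ v 0 j dF) (E j).2 !mxE.
by rewrite (derive_mx_entry _ _ _ 0 j (dK _ _)).
Qed.

Lemma formZM n k (M : 'M[R]_n) u v : form (k *: M) u v = k * form M u v.
Proof. by rewrite /form -scalemxAr -scalemxAl mxE. Qed.

Lemma scaler_mulE (a b : R) : a *: (b : R^o) = a * b.
Proof. by []. Qed.

Context {N : nat}.

(** The properties of a metric in one chart on which the curvature identities
    rest; two derivatives suffice because the curvature contains no more. *)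
Record metric_on (O : set 'rV[R]_N) (Gm : 'rV[R]_N -> 'M[R]_N) : Prop :=
  MetricOn {
    mo_open : open O;
    mo_diff : forall z, O z -> differentiable Gm z;
    mo_diff2 : forall a z, O z -> differentiable ('D_a Gm) z;
    mo_sym : forall z, O z -> (Gm z)^T = Gm z;
    mo_pos : forall z v, O z -> v != 0 -> 0 < form (Gm z) v v }.

Record map_into (O : set 'rV[R]_N) {V : normedModType R} (Om : set V)
    (phi : V -> 'rV[R]_N) : Prop :=
  MapInto {
    mi_open : open Om;
    mi_in : forall y, Om y -> O (phi y);
    mi_diff : forall y, Om y -> differentiable phi y;
    mi_diff2 : forall a y, Om y -> differentiable ('D_a phi) y }.

#[global] Arguments mo_open {O Gm} _.
#[global] Arguments mo_diff {O Gm} _.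
#[global] Arguments mo_diff2 {O Gm} _.
#[global] Arguments mo_sym {O Gm} _.
#[global] Arguments mo_pos {O Gm} _.
#[global] Arguments mi_open {O V Om phi} _.
#[global] Arguments mi_in {O V Om phi} _.
#[global] Arguments mi_diff {O V Om phi} _.
#[global] Arguments mi_diff2 {O V Om phi} _.

(** The covariant derivative along [phi] of the vector field [W], which assigns
    to [y] a tangent vector at [phi y].  For [phi] the identity this is the
    Levi-Civita connection. *)
Definition cov (Gm : 'rV[R]_N -> 'M[R]_N) {V : normedModType R}
    (phi : V -> 'rV[R]_N) (u : V) (W : V -> 'rV[R]_N) (y : V) : 'rV[R]_N :=
  'D_u W y + christoffel Gm (phi y) ('D_u phi y) (W y).

Lemma open_near {V : normedModType R} {O : set V} {z} :
  open O -> O z -> \forall y \near z, O y.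
Proof. by move=> oO Oz; exact: open_nbhs_nbhs. Qed.

Section Metric.
Context {O : set 'rV[R]_N} {Gm : 'rV[R]_N -> 'M[R]_N}.
Hypothesis GO : metric_on O Gm.
Let nO z : O z -> \forall y \near z, O y.
Proof. exact/open_near/(mo_open GO). Qed.

Lemma derive_metric_sym z a : O z -> ('D_a Gm z)^T = 'D_a Gm z.
Proof.
move=> Oz; have dG := mo_diff GO z Oz.
apply/matrixP => i j; rewrite mxE !(derive_mx_entry _ _ a _ _ dG).
apply: near_eq_derive; near=> y.
have Oy : O y by near: y; exact: nO.
by have /matrixP/(_ i j) := mo_sym GO y Oy; rewrite mxE.
Unshelve. all: by end_near. Qed.

Lemma derive_linear_dir z : O z -> linear (fun a => 'D_a Gm z).
Proof.
by move=> Oz k a b; rewrite !(deriveE _ (mo_diff GO z Oz)) linearP.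
Qed.

Lemma christoffel1_linear_w z u v : O z -> linear (christoffel1 Gm z u v : _ -> R).
Proof.
move=> Oz k a b; rewrite /christoffel1.
have -> : 'D_(k *: a + b) Gm z = k *: 'D_a Gm z + 'D_b Gm z.
  exact: derive_linear_dir.
gen_derive; rewrite !formDr !formZr formM formZM scaler_mulE; gen_form; ring.
Qed.

Lemma christoffel1_bilin z w : O z ->
  bilin (fun u v => christoffel1 Gm z u v w).
Proof.
move=> Oz; split=> [v k a b|u k a b]; rewrite /christoffel1;
have -> : 'D_(k *: a + b) Gm z = k *: 'D_a Gm z + 'D_b Gm z by
  exact: derive_linear_dir.
- gen_derive; rewrite formM formZM !formDl !formZl scaler_mulE; gen_form; ring.
- gen_derive; rewrite formM formZM formDl formDr formZl formZr scaler_mulE; gen_form; ring.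
Qed.

Lemma christoffel1_sym z u v w : O z ->
  christoffel1 Gm z u v w = christoffel1 Gm z v u w.
Proof.
move=> Oz; rewrite /christoffel1.
have := formC u v (derive_metric_sym z w Oz).
gen_derive => ->; gen_form; ring.
Qed.

(** The infinitesimal form of metric compatibility: the other two terms of the
    Koszul formula cancel in the sum. *)
Lemma christoffel1_metric z u v w : O z ->
  christoffel1 Gm z u v w + christoffel1 Gm z u w v = form ('D_u Gm z) v w.
Proof.
move=> Oz; rewrite /christoffel1.
have := formC w v (derive_metric_sym z u Oz).
gen_derive => ->; gen_form; by field.
Qed.

Let Gunit z : O z -> Gm z \in unitmx.
Proof. by move=> Oz; apply: form_unitmx => v; exact: (mo_pos GO). Qed.

Lemma form_christoffel z u v w : O z ->
  form (Gm z) (christoffel Gm z u v) w = christoffel1 Gm z u v w.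
Proof.
move=> Oz; rewrite /form /christoffel mulmxKV ?Gunit// mxE.
rewrite (linear_row_sum w (christoffel1_linear_w z u v Oz)).
by apply: eq_bigr => k _; rewrite !mxE mulrC.
Qed.

Lemma christoffel_bilin z : O z -> bilin (christoffel Gm z).
Proof.
move=> Oz; have P v := mo_pos GO z v Oz.
split=> [v k a b|u k a b]; apply: (form_inj P) => w;
rewrite formDl formZl !form_christoffel//; have [L1 L2] := christoffel1_bilin z w Oz.
- exact: L1.
- exact: L2.
Qed.

Lemma christoffel_sym z u v : O z -> christoffel Gm z u v = christoffel Gm z v u.
Proof.
move=> Oz; apply: (form_inj (fun v => mo_pos GO z v Oz)) => w.
by rewrite !form_christoffel// christoffel1_sym.
Qed.

Lemma differentiable_christoffel z u v : O z ->
  differentiable (fun z => christoffel Gm z u v) z.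
Proof.
move=> Oz; apply: differentiable_mulmx; last first.
  apply: differentiable_invmx; last exact: (mo_diff GO).
  by near=> y; apply: Gunit; near: y; exact: nO.
apply/differentiable_mxE => i j; under eq_fun do rewrite mxE.
have D a b c : differentiable (fun z => form ('D_a Gm z) b c) z.
  apply: (derive_form _ _ _ _ 0 _ _ _).1 => //.
  exact: (mo_diff2 GO).
apply: differentiableM => //.
by apply: differentiableB => //; apply: differentiableD.
Unshelve. all: by end_near. Qed.

Section Along.
Context {V : normedModType R} {Om : set V} {phi : V -> 'rV[R]_N}.

Hypothesis phiO : map_into O Om phi.
Local Notation covp := (cov Gm phi).
Let nOm y : Om y -> \forall x \near y, Om x.
Proof. exact/open_near/(mi_open phiO). Qed.

Lemma cov_near u W1 W2 y :
  (\forall x \near y, W1 x = W2 x) -> covp u W1 y = covp u W2 y.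
Proof. by move=> E; rewrite /cov (near_eq_derive _ E) (nbhs_singleton E). Qed.

Lemma differentiable_metric_along y : Om y ->
  differentiable (fun y => Gm (phi y)) y.
Proof.
move=> Oy; apply: (@differentiable_comp _ _ _ _ phi Gm); first exact: (mi_diff phiO).
by apply: (mo_diff GO); exact: (mi_in phiO).
Qed.

Lemma cov_metric u W1 W2 y : Om y -> differentiable W1 y -> differentiable W2 y ->
  'D_u (fun y => form (Gm (phi y)) (W1 y) (W2 y)) y =
  form (Gm (phi y)) (covp u W1 y) (W2 y) + form (Gm (phi y)) (W1 y) (covp u W2 y).
Proof.
move=> Oy d1 d2; have Oz := mi_in phiO y Oy; have dp := mi_diff phiO y Oy.
rewrite (derive_form _ _ _ _ u (differentiable_metric_along y Oy) d1 d2).2.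
rewrite (derive_chain Gm phi _ _ dp (mo_diff GO _ Oz)).
rewrite /cov formDl formDr form_christoffel//.
rewrite (formC (W1 y) (christoffel _ _ _ _) (mo_sym GO _ Oz)).
rewrite form_christoffel// -(christoffel1_metric _ _ _ _ Oz); ring.
Qed.

Lemma field_derive_commute (W : V -> 'rV[R]_N) u v y : Om y ->
  (forall x, Om x -> differentiable W x) ->
  (forall a x, Om x -> differentiable ('D_a W) x) ->
  'D_u ('D_v W) y = 'D_v ('D_u W) y.
Proof.
move=> Oy dW dW'; apply: derive_commute.
- near=> x; apply: dW; near: x; exact: nOm.
- near=> x; apply: dW'; near: x; exact: nOm.
- near=> x; apply: dW'; near: x; exact: nOm.
Unshelve. all: by end_near. Qed.

(** Both terms of [cov u ('D_v phi)] are symmetric, the derivative by symmetry of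
    second derivatives and the other one by symmetry of the Christoffel
    symbols. *)
Lemma cov_torsion u v y : Om y -> covp u ('D_v phi) y = covp v ('D_u phi) y.
Proof.
move=> Oy; rewrite /cov.
have -> := christoffel_sym _ ('D_u phi y) ('D_v phi y) (mi_in phiO y Oy).
by have -> := field_derive_commute phi u v y Oy (mi_diff phiO) (mi_diff2 phiO).
Qed.

Lemma derive_christoffel_along u a b y : Om y ->
  differentiable a y -> differentiable b y ->
  differentiable (fun y => christoffel Gm (phi y) (a y) (b y)) y /\
  'D_u (fun y => christoffel Gm (phi y) (a y) (b y)) y =
   'D_('D_u phi y) (fun z => christoffel Gm z (a y) (b y)) (phi y)
   + christoffel Gm (phi y) ('D_u a y) (b y)
   + christoffel Gm (phi y) (a y) ('D_u b y).
Proof.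
move=> Oy da db; have Oz := mi_in phiO y Oy.
exact: (derive_bilin O (christoffel Gm) phi a b y u (mo_open GO)
  Oz christoffel_bilin (fun u' w => differentiable_christoffel _ u' w Oz)
  (mi_diff phiO y Oy) da db).
Qed.

Lemma differentiable_cov u W y : Om y -> differentiable W y ->
  differentiable ('D_u W) y -> differentiable (covp u W) y.
Proof.
move=> Oy dW dW'; apply: differentiableD => //.
apply: (derive_christoffel_along 0 _ _ _ _ _ _).1 => //; exact: (mi_diff2 phiO).
Qed.

Lemma RiemE z a b c : Riem Gm z a b c =
  'D_a (fun z => christoffel Gm z b c) z - 'D_b (fun z => christoffel Gm z a c) z
  + christoffel Gm z a (christoffel Gm z b c)
  - christoffel Gm z b (christoffel Gm z a c) - christoffel Gm z 0 c.
Proof.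
have E u : (fun z0 => nabla Gm u (fun=> c) z0) = (fun z0 => christoffel Gm z0 u c).
  by apply/funext => x; rewrite /nabla derive_cst add0r.
rewrite /Riem /curvature /bracket !E /nabla !derive_cst subrr add0r.
by rewrite !opprD !addrA; congr (_ - _ - _); rewrite addrAC.
Qed.

(** In the commutator the second derivatives of [W] and of [phi] cancel by
    symmetry and the terms with a first derivative of [W] cancel in pairs; what
    is left depends on [W y] only and is the expression of [RiemE]. *)
Lemma cov_curvature u v W y : Om y ->
  (forall x, Om x -> differentiable W x) ->
  (forall a x, Om x -> differentiable ('D_a W) x) ->
  covp u (covp v W) y - covp v (covp u W) y =
  Riem Gm (phi y) ('D_u phi y) ('D_v phi y) (W y).
Proof.
move=> Oy dW dW'; have Oz := mi_in phiO y Oy.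
have [Kl Kr] := christoffel_bilin _ Oz.
have add0 c : christoffel Gm (phi y) 0 c = 0.
  by have := Kl c (-1) 0 0; rewrite scaler0 addr0 scaleN1r addNr.
have Dr a b c : christoffel Gm (phi y) a (b + c) =
   christoffel Gm (phi y) a b + christoffel Gm (phi y) a c.
  by have := Kr a 1 b c; rewrite !scale1r.
have half a b : covp a (covp b W) y =
  'D_a ('D_b W) y +
   ('D_('D_a phi y) (fun z => christoffel Gm z ('D_b phi y) (W y)) (phi y)
   + christoffel Gm (phi y) ('D_a ('D_b phi) y) (W y)
   + christoffel Gm (phi y) ('D_b phi y) ('D_a W y))
  + (christoffel Gm (phi y) ('D_a phi y) ('D_b W y) +
    christoffel Gm (phi y) ('D_a phi y) (christoffel Gm (phi y) ('D_b phi y) (W y))).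
  have dbp := mi_diff2 phiO b y Oy.
  have [D1 D2] := derive_christoffel_along a _ _ y Oy dbp (dW y Oy).
  rewrite {1}/cov deriveD; [|exact/diff_derivable/dW'|exact/diff_derivable].
  by rewrite D2 /cov Dr.
rewrite !half RiemE add0 subr0.
have -> := field_derive_commute W u v y Oy dW dW'.
have -> := field_derive_commute phi u v y Oy (mi_diff phiO) (mi_diff2 phiO).
gen_derive; gen_christoffel; move=> *; apply/rowP => j; rewrite !mxE; ring.
Qed.

End Along.
End Metric.
End Connection.

(** * Algebraic curvature tensors *)

Section CurvatureLike.
Context {R : realType} {V : lmodType R} {D : V -> V -> V -> V -> R}.
Hypothesis a12 : forall x y z w, D y x z w = - D x y z w.
Hypothesis a34 : forall x y z w, D x y w z = - D x y z w.
Hypothesis bianchi : forall x y z w, D x y z w + D y z x w + D z x y w = 0.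
Hypothesis lin4 : forall x y z w w' k,
  D x y z (k *: w + w') = k * D x y z w + D x y z w'.

(** Pair symmetry: a signed sum of the four cyclic identities on [x, y, z, w]. *)
Lemma curv_pair x y z w : D z w x y = D x y z w.
Proof.
have b1 := bianchi x y z w; have b2 := bianchi y z w x.
have b3 := bianchi z w x y; have b4 := bianchi w x y z.
have := a34 y z x w; have := a34 z w x y; have := a34 x y z w.
have := a12 x z y w; have := a34 x z y w; have := a12 y w z x.
have := a34 y w x z; have := a34 w x z y.
lra.
Qed.

Lemma curvD4 x y z w w' : D x y z (w + w') = D x y z w + D x y z w'.
Proof. by have := lin4 x y z w w' 1; rewrite scale1r mul1r. Qed.
Lemma curv04 x y z : D x y z 0 = 0.
Proof. by have := curvD4 x y z 0 0; rewrite addr0; lra. Qed.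
Lemma curvN4 x y z w : D x y z (- w) = - D x y z w.
Proof. by have := lin4 x y z w 0 (-1); rewrite addr0 scaleN1r curv04; lra. Qed.
Lemma curvD3 x y z w z' : D x y (z + z') w = D x y z w + D x y z' w.
Proof. by rewrite a34 curvD4 opprD -!a34. Qed.
Lemma curvN3 x y z w : D x y (- z) w = - D x y z w.
Proof. by rewrite a34 curvN4 -a34. Qed.
Lemma curvD1 x y z w x' : D (x + x') y z w = D x y z w + D x' y z w.
Proof. by rewrite -!(curv_pair _ _ z w) curvD3. Qed.
Lemma curvN1 x y z w : D (- x) y z w = - D x y z w.
Proof. by rewrite -!(curv_pair _ _ z w) curvN3. Qed.
Lemma curvD2 x y z w y' : D x (y + y') z w = D x y z w + D x y' z w.
Proof. by rewrite -!(curv_pair _ _ z w) curvD4. Qed.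
Lemma curvN2 x y z w : D x (- y) z w = - D x y z w.
Proof. by rewrite -!(curv_pair _ _ z w) curvN4. Qed.

(** Polarizing in [y], then in [x], shows that [D] is skew in [x] and [z] too; a
    tensor skew in all pairs of its first three arguments vanishes by the cyclic
    identity. *)
Lemma sectional_zero : (forall x y, D x y x y = 0) ->
  forall x y z w, D x y z w = 0.
Proof.
move=> s0.
have s1 x y w : D x y x w = 0.
  have := s0 x (y + w); rewrite !curvD2 !curvD4 !s0.
  have := curv_pair x w x y; lra.
have s2 x y z w : D x y z w = - D z y x w.
  have := s1 (x + z) y w; rewrite !curvD1 !curvD3 !s1; lra.
move=> x y z w; have := bianchi x y z w.
have := s2 x y z w; have := s2 z x y w; have := a12 z y x w.
have := a12 y x z w; lra.
Qed.

Context {J : V -> V}.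
Hypothesis JD : forall x y, J (x + y) = J x + J y.
Hypothesis JN : forall x, J (- x) = - J x.
Hypothesis JJ : forall x, J (J x) = - x.
Hypothesis DJ : forall x y z w, D x y (J z) (J w) = D x y z w.
Hypothesis hol0 : forall x, D x (J x) (J x) x = 0.

(** Polarizing D(x, Jx, x, Jx) = 0 at x + y and x - y, and using the cyclic
    identity, gives 3 D(x, Jy, x, Jy) + D(x, y, x, y) = 0.  With [J y] for [y] this is
    D(x, Jy, x, Jy) + 3 D(x, y, x, y) = 0, so all sectional curvatures vanish. *)
Lemma holomorphic_sectional_zero x y z w : D x y z w = 0.
Proof.
apply: sectional_zero => {z w} {}x {}y.
have DJ1 x' y' z w : D (J x') (J y') z w = D x' y' z w.
  by rewrite -!(curv_pair _ _ z w) DJ.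
have sw x' y' z w : D y' (J x') z w = D x' (J y') z w.
  by rewrite -DJ1 JJ curvN2 -a12.
have sw' x' y' z w : D z w y' (J x') = D z w x' (J y').
  by rewrite !(curv_pair _ _ z w) sw.
have q0 x' : D x' (J x') x' (J x') = 0 by rewrite a34 hol0 oppr0.
have H x' y' : 3 * D x' (J y') x' (J y') + D x' y' x' y' = 0.
  have := q0 (x' + y'); have := q0 (x' - y').
  rewrite !JD !JN !(curvD1, curvN1, curvD2, curvN2, curvD3, curvN3, curvD4, curvN4).
  rewrite !q0 !(sw x' y') !(sw' x' y') (curv_pair x' (J x') y' (J y')).
  have := bianchi x' (J x') y' (J y'); have := a12 y' (J x') x' (J y').
  rewrite (sw x' y') a12 (a12 x' y') DJ; lra.
have := H x y; have := H x (J y); rewrite !JJ curvN2 curvN4; lra.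
Qed.

End CurvatureLike.

Lemma isometry_skew {R : realType} {N : nat} {G J : 'M[R]_N} u v :
  J *m J = - 1%:M ->
  (forall u v, form G (u *m J) (v *m J) = form G u v) ->
  form G (u *m J) v = - form G u (v *m J).
Proof.
move=> JJ Ji.
by rewrite -(Ji u (v *m J)) -mulmxA JJ mulmxN mulmx1 formNr opprK.
Qed.

Section SpaceFormTensor.
Context {R : realType} {N : nat} {G J : 'M[R]_N} (c : R).
Hypothesis Gs : G^T = G.
Let g := form G.
Hypothesis formJl : forall u v, g (u *m J) v = - g u (v *m J).

(** The curvature tensor of constant holomorphic sectional curvature [4 * c].  On a
    CR submanifold the same expression with the tangential part of [J] is the
    tangential part of the ambient tensor. *)
Definition space_form_curvature (x y z w : 'rV[R]_N) : R :=
  c * (g y z * g x w - g x z * g y w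
       + g (y *m J) z * g (x *m J) w - g (x *m J) z * g (y *m J) w
       - 2 * g (x *m J) y * g (z *m J) w).

Let gC u v : g u v = g v u.
Proof. exact: formC. Qed.

Let sk u v : g (u *m J) v = - g (v *m J) u.
Proof. by rewrite formJl gC. Qed.

Lemma sfc12 x y z w : space_form_curvature y x z w = - space_form_curvature x y z w.
Proof. rewrite /space_form_curvature (sk y x); ring. Qed.

Lemma sfc34 x y z w : space_form_curvature x y w z = - space_form_curvature x y z w.
Proof. rewrite /space_form_curvature (sk w z); ring. Qed.

Lemma sfc_bianchi x y z w : space_form_curvature x y z w
  + space_form_curvature y z x w + space_form_curvature z x y w = 0.
Proof.
rewrite /space_form_curvature (sk y x) (sk z y) (sk x z) (gC y x) (gC z y) (gC x z).
ring.
Qed.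

Lemma sfc_lin4 x y z w w' k : space_form_curvature x y z (k *: w + w') =
  k * space_form_curvature x y z w + space_form_curvature x y z w'.
Proof. rewrite /space_form_curvature /g !formDr !formZr; ring. Qed.

Hypothesis JJ : J *m J = - 1%:M.
Hypothesis Jiso : forall u v, form G (u *m J) (v *m J) = form G u v.

Lemma sfcJ x y z w :
  space_form_curvature x y (z *m J) (w *m J) = space_form_curvature x y z w.
Proof.
have mJJ u : u *m J *m J = - u by rewrite -mulmxA JJ mulmxN mulmx1.
have gJ u v : g u (v *m J) = - g (u *m J) v by rewrite formJl opprK.
rewrite /space_form_curvature !gJ !mJJ /g !formNl; ring.
Qed.

Context {K : 'rV[R]_N -> 'rV[R]_N -> 'rV[R]_N -> 'rV[R]_N}.
Hypothesis K12 : forall x y z, K y x z = - K x y z.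
Hypothesis K34 : forall x y z w, g (K x y w) z = - g (K x y z) w.
Hypothesis Kbianchi : forall x y z, K x y z + K y z x + K z x y = 0.
Hypothesis KJ : forall x y z, K x y (z *m J) = K x y z *m J.
Hypothesis Khol : forall x,
  g (K x (x *m J) (x *m J)) x = 4 * c * g x x ^+ 2.

(** The difference of the two tensors has the symmetries of a Kaehler curvature
    tensor and zero holomorphic sectional curvature. *)
Lemma space_form_curvatureE x y z w :
  g (K x y z) w = space_form_curvature x y z w.
Proof.
apply/eqP; rewrite -subr_eq0; apply/eqP.
have JE u : u *m J *m J = - u by rewrite -mulmxA JJ mulmxN mulmx1.
apply: (@holomorphic_sectional_zero R _
  (fun x y z w => g (K x y z) w - space_form_curvature x y z w) _ _ _ _ (mulmx^~ J)).
- by move=> {}x {}y {}z {}w; rewrite K12 sfc12 /g formNl opprB addrC opprK.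
- by move=> {}x {}y {}z {}w; rewrite K34 sfc34 opprB addrC opprK.
- move=> {}x {}y {}z {}w; have := sfc_bianchi x y z w.
  have : g (K x y z + K y z x + K z x y) w = 0 by rewrite Kbianchi /g form0l.
  rewrite /g !formDl => A B; rewrite -[RHS](subrr 0) -{1}A -B; ring.
- by move=> {}x {}y {}z {}w w' k; rewrite sfc_lin4 /g formDr formZr; ring.
- by move=> *; rewrite mulmxDl.
- by move=> *; rewrite mulNmx.
- exact: JE.
- by move=> {}x {}y {}z {}w; rewrite KJ sfcJ /g Jiso.
- move=> {}x; rewrite Khol /space_form_curvature.
  have s0 : g (x *m J) x = 0 by have := sk x x; lra.
  have n1 : g (x *m J) (x *m J) = g x x by exact: Jiso.
  have nl u v : g (- u) v = - g u v by exact: formNl.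
  rewrite JE !nl (gC x (x *m J)) s0 n1; ring.
Qed.

End SpaceFormTensor.

Arguments space_form_curvature {R N} G J c x y z w.

(** * The curvature of a Kaehler metric *)

Section KaehlerCurvature.
Local Open Scope classical_set_scope.
Local Open Scope ring_scope.
Context {R : realType} {N : nat}.

(** Parallelism of [J] is only recorded on constant fields: by the product rule it
    then holds for all fields, also along a map ([cov_J]). *)
Record kaehler_on (O : set 'rV[R]_N) (Gm J : 'rV[R]_N -> 'M[R]_N) : Prop :=
  KaehlerOn {
    ko_diff : forall z, O z -> differentiable J z;
    ko_diff2 : forall a z, O z -> differentiable ('D_a J) z;
    ko_sq : forall z, O z -> J z *m J z = - 1%:M;
    ko_iso : forall z u v, O z ->
      form (Gm z) (u *m J z) (v *m J z) = form (Gm z) u v;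
    ko_par : forall z v w, O z ->
      nabla Gm v (fun z => w *m J z) z = nabla Gm v (fun=> w) z *m J z }.

#[global] Arguments ko_diff {O Gm J} _.
#[global] Arguments ko_diff2 {O Gm J} _.
#[global] Arguments ko_sq {O Gm J} _.
#[global] Arguments ko_iso {O Gm J} _.
#[global] Arguments ko_par {O Gm J} _.

Context {O : set 'rV[R]_N} {Gm J : 'rV[R]_N -> 'M[R]_N}.
Hypothesis GO : metric_on O Gm.

Lemma map_into_id : map_into O O (@id 'rV[R]_N).
Proof.
split => //; first exact: (mo_open GO).
move=> a y _; have -> : 'D_a (@id 'rV[R]_N) = cst a.
  by apply/funext => z; rewrite derive_id.
exact: differentiable_cst.
Qed.

Let covid := cov Gm (@id 'rV[R]_N).

Let dcst (w : 'rV[R]_N) x : O x -> differentiable (fun=> w : 'rV[R]_N) x.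
Proof. by move=> _; exact: differentiable_cst. Qed.
Let dcst2 (w : 'rV[R]_N) a x : O x ->
  differentiable ('D_a (fun=> w : 'rV[R]_N)) x.
Proof.
move=> _; have -> : 'D_a (fun=> w : 'rV[R]_N) = cst (0 : 'rV[R]_N).
  by apply/funext => z; rewrite derive_cst.
exact: differentiable_cst.
Qed.

(** Tensoriality: any field through the given vector computes the curvature. *)
Lemma Riem_cov u v (W : 'rV[R]_N -> 'rV[R]_N) z : O z ->
  (forall x, O x -> differentiable W x) ->
  (forall a x, O x -> differentiable ('D_a W) x) ->
  Riem Gm z u v (W z) = covid u (covid v W) z - covid v (covid u W) z.
Proof.
move=> Oz dW dW'.
have E := cov_curvature GO map_into_id u v W z Oz dW dW'.
have Du : 'D_u (@id 'rV[R]_N) z = u by exact: derive_id.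
have Dv : 'D_v (@id 'rV[R]_N) z = v by exact: derive_id.
by rewrite Du Dv in E; rewrite -[RHS]/(_ - _) E.
Qed.

Lemma Riem_cst u v w z : O z ->
  Riem Gm z u v w = covid u (covid v (fun=> w)) z - covid v (covid u (fun=> w)) z.
Proof. move=> Oz; exact: (Riem_cov u v (fun=> w) z Oz (dcst w) (dcst2 w)). Qed.

Lemma Riem12 z u v w : O z -> Riem Gm z v u w = - Riem Gm z u v w.
Proof. by move=> Oz; rewrite !Riem_cst// opprB. Qed.

Lemma covid_sym u v z : O z -> covid u (fun=> v) z = covid v (fun=> u) z.
Proof.
move=> Oz; have := cov_torsion GO map_into_id u v z Oz.
have E a : 'D_a (@id 'rV[R]_N) = (fun=> a).
  by apply/funext => y; rewrite derive_id.
by rewrite !E.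
Qed.

Lemma Riem_bianchi z u v w : O z ->
  Riem Gm z u v w + Riem Gm z v w u + Riem Gm z w u v = 0.
Proof.
move=> Oz; have nO := open_near (mo_open GO) Oz.
have E a b c : covid a (covid b (fun=> c)) z = covid a (covid c (fun=> b)) z.
  by apply: cov_near; near=> x; apply: covid_sym; near: x.
rewrite !Riem_cst// (E w v u) (E v u w) (E u w v).
move: (covid _ _ z) (covid _ _ z) (covid _ _ z) => a b c.
by apply/rowP => j; rewrite !mxE; ring.
Unshelve. all: by end_near. Qed.

(** Differentiating the function g(w, t) twice by metric compatibility and
    exchanging the derivatives leaves g(R w, t) + g(w, R t) = 0, the mixed terms
    being symmetric. *)
Lemma Riem34 z u v w t : O z ->
  form (Gm z) (Riem Gm z u v w) t = - form (Gm z) (Riem Gm z u v t) w.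
Proof.
move=> Oz; have nO := open_near (mo_open GO) Oz.
pose f z := form (Gm z) w t.
have dM := mo_diff GO.
have Df a y : O y -> 'D_a f y = form ('D_a Gm y) w t.
  move=> Oy; have [_ ->] := derive_form Gm (fun=> w) (fun=> t) y a
    (dM y Oy) (dcst w y Oy) (dcst t y Oy).
  by rewrite !derive_cst form0l form0r !addr0.
have df y : O y -> differentiable f y.
  by move=> Oy; exact: (derive_form Gm (fun=> w) (fun=> t) y 0
    (dM y Oy) (dcst w y Oy) (dcst t y Oy)).1.
have ddf a : differentiable ('D_a f) z.
  apply: (@near_eq_differentiable _ _ _ (fun y => form ('D_a Gm y) w t)).
    by near=> y; rewrite Df//; near: y.
  exact: (derive_form _ (fun=> w) (fun=> t) z 0
    (mo_diff2 GO a z Oz) (dcst w z Oz) (dcst t z Oz)).1.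
have C : 'D_u ('D_v f) z = 'D_v ('D_u f) z.
  by apply: derive_commute_scalar => //; near=> y; apply: df; near: y.
have dc a W : differentiable W z -> differentiable ('D_a W) z ->
    differentiable (covid a W) z.
  move=> dW dW'.
  exact: (differentiable_cov GO map_into_id a W z Oz dW dW').
have half a b : 'D_a ('D_b f) z =
   form (Gm z) (covid a (covid b (fun=> w)) z) t
   + form (Gm z) (covid b (fun=> w) z) (covid a (fun=> t) z)
   + (form (Gm z) (covid a (fun=> w) z) (covid b (fun=> t) z)
   + form (Gm z) w (covid a (covid b (fun=> t)) z)).
  have E : \forall y \near z, 'D_b f y =
     form (Gm y) (covid b (fun=> w) y) t + form (Gm y) w (covid b (fun=> t) y).
    near=> y; have Oy : O y by near: y.
    exact: (cov_metric GO map_into_id b _ _ y Oy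
      (dcst w y Oy) (dcst t y Oy)).
  rewrite (near_eq_derive _ E).
  have d1 := dc b _ (dcst w z Oz) (dcst2 w b z Oz).
  have d2 := dc b _ (dcst t z Oz) (dcst2 t b z Oz).
  have [D1 _] := derive_form Gm (covid b (fun=> w)) (fun=> t) z 0
    (dM z Oz) d1 (dcst t z Oz).
  have [D2 _] := derive_form Gm (fun=> w) (covid b (fun=> t)) z 0
    (dM z Oz) (dcst w z Oz) d2.
  rewrite deriveD; [|exact: diff_derivable D1|exact: diff_derivable D2].
  have -> := cov_metric GO map_into_id a _ _ z Oz
    d1 (dcst t z Oz).
  by have -> := cov_metric GO map_into_id a _ _ z Oz
    (dcst w z Oz) d2.
move: C; rewrite (half u v) (half v u).
have -> := Riem_cst u v w z Oz; have -> := Riem_cst u v t z Oz.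
have Gs := mo_sym GO z Oz.
move: (covid u (covid v (fun=> w)) z) (covid v (covid u (fun=> w)) z).
move: (covid u (covid v (fun=> t)) z) (covid v (covid u (fun=> t)) z).
move: (covid u (fun=> w) z) (covid v (fun=> w) z).
move: (covid u (fun=> t) z) (covid v (fun=> t) z) => ct dt cw dw b1 b2 a1 a2.
rewrite (formC w b1 Gs) (formC w b2 Gs) !formDl !formNl.
gen_form; lra.
Unshelve. all: by end_near. Qed.

Hypothesis JO : kaehler_on O Gm J.

Lemma derive_cst_mulmx (w : 'rV[R]_N) z a : O z ->
  'D_a (fun y => w *m J y) z = w *m 'D_a J z.
Proof.
move=> Oz; have dJ := ko_diff JO z Oz.
have D := derive_mulmx (fun=> w) J z a (dcst w z Oz) dJ.
by rewrite D derive_cst mul0mx add0r.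
Qed.

Lemma cov_J {V : normedModType R} {Om : set V} {phi} u (W : V -> 'rV[R]_N) y :
  map_into O Om phi -> Om y -> differentiable W y ->
  cov Gm phi u (fun y => W y *m J (phi y)) y
  = cov Gm phi u W y *m J (phi y).
Proof.
move=> phiO Oy dW; have Oz := mi_in phiO y Oy.
have dJ := ko_diff JO _ Oz; have dp := mi_diff phiO y Oy.
set d := 'D_u phi y.
have D1 : 'D_u (fun y => W y *m J (phi y)) y =
   'D_u W y *m J (phi y) + W y *m 'D_d J (phi y).
  rewrite /d -(derive_chain J phi y u dp dJ).
  exact: (derive_mulmx W (J \o phi) y u dW (differentiable_comp dp dJ)).
have D2 := derive_cst_mulmx (W y) _ d Oz.
have := ko_par JO _ d (W y) Oz.
have D3 : 'D_d (fun=> W y : 'rV[R]_N) (phi y) = 0 by exact: derive_cst.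
rewrite /nabla D2 D3 add0r => E.
by rewrite /cov D1 mulmxDl -addrA E.
Qed.

(** [J] commutes with covariant derivatives, hence with their commutator applied to
    the field [w *m J]. *)
Lemma RiemJ z u v w : O z -> Riem Gm z u v (w *m J z) = Riem Gm z u v w *m J z.
Proof.
move=> Oz; have nO := open_near (mo_open GO) Oz.
have dJ y : O y -> differentiable (fun y => w *m J y) y.
  by move=> Oy; apply: differentiable_mulmx; [exact: dcst Oy|exact: (ko_diff JO)].
have dJ2 a y : O y -> differentiable ('D_a (fun y => w *m J y)) y.
  move=> Oy; apply: (@near_eq_differentiable _ _ _ (fun y => w *m 'D_a J y)).
    near=> x; apply/esym; apply: derive_cst_mulmx; near: x; exact: open_near (mo_open GO) Oy.
  by apply: differentiable_mulmx; [exact: dcst Oy|exact: (ko_diff2 JO)].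
rewrite (Riem_cov u v (fun y => w *m J y) z Oz dJ dJ2) Riem_cst// mulmxBl.
have half a b : covid a (covid b (fun y => w *m J y)) z =
   covid a (covid b (fun=> w)) z *m J z.
  rewrite -(cov_J a (covid b (fun=> w)) z map_into_id Oz); last first.
    exact: (differentiable_cov GO map_into_id b _ z Oz
      (dcst w z Oz) (dcst2 w b z Oz)).
  apply: cov_near; near=> y.
  have Oy : O y by near: y.
  exact: (cov_J b (fun=> w) y map_into_id Oy (dcst w y Oy)).
by congr (_ - _); exact: half.
Unshelve. all: by end_near. Qed.

Lemma Riem_space_form (c : R) z : O z ->
  (forall v, v != 0 -> sectional Gm z v (v *m J z) = 4 * c) ->
  forall x y w t, form (Gm z) (Riem Gm z x y w) t =
    space_form_curvature (Gm z) (J z) c x y w t.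
Proof.
move=> Oz hs; have JJ := ko_sq JO z Oz.
have Gs := mo_sym GO z Oz.
have Ji u v := ko_iso JO z u v Oz.
apply: space_form_curvatureE => //.
- by move=> *; exact: isometry_skew.
- by move=> *; exact: Riem12.
- by move=> *; exact: Riem34.
- by move=> *; exact: Riem_bianchi.
- by move=> *; exact: RiemJ.
move=> x; have [->|x0] := eqVneq x 0.
  by rewrite !form0r expr0n/= mulr0.
have := hs x x0; rewrite /sectional Ji.
have -> : form (Gm z) x (x *m J z) = 0.
  have := isometry_skew x x JJ Ji; rewrite (formC _ _ Gs); lra.
have p : form (Gm z) x x != 0 by rewrite form_eq0// => v; exact: (mo_pos GO).
move=> /(congr1 (fun s => s * form (Gm z) x x ^+ 2)) <-; field.
by rewrite p.
Qed.

End KaehlerCurvature.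

(** * Curvature of a CR tangent space at one point *)

Section Pointwise.
Context {R : realType} {n N : nat}.
Context {G F : 'M[R]_n} {U : 'rV[R]_n} (c : R).
Context {Gb Jb Pn : 'M[R]_N} {Sg : 'rV[R]_n -> 'rV[R]_n -> 'rV[R]_N}.

(** The linear algebra of a CR submanifold of maximal CR dimension at one point:
    [G], [F], [U] are the metric, the tangential part of the complex structure and
    the image of the normal [xi] under its opposite; [Gb], [Jb] are the ambient
    metric and complex structure, [Pn] is the projection onto the normals
    orthogonal to [xi], and [Sg] the second fundamental form followed by [Pn].
    [cr_ker] expresses the bound on the codimension: the orthogonal complement of
    [U] has larger dimension than the range of [Pn]. *)
Record cr_data : Prop := CRData {
  cr_sym : G^T = G;
  cr_pos : forall v, v != 0 -> 0 < form G v v;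
  cr_FF : forall x, x *m F *m F = - x + form G x U *: U;
  cr_Fsk : forall x y, form G (x *m F) y = - form G x (y *m F);
  cr_UU : form G U U = 1;
  cr_symb : Gb^T = Gb;
  cr_JJ : Jb *m Jb = - 1%:M;
  cr_Jsk : forall u v, form Gb (u *m Jb) v = - form Gb u (v *m Jb);
  cr_Sg_lin : forall k (x x' y : 'rV[R]_n), Sg (k *: x + x') y = k *: Sg x y + Sg x' y;
  cr_SgC : forall x y, Sg x y = Sg y x;
  cr_SgJ : forall x y, form G y U = 0 -> Sg x (y *m F) = Sg x y *m Jb;
  cr_SgP : forall x y, Sg x y *m Pn = Sg x y;
  cr_ker : forall M : 'M[R]_(n, N), exists v,
    [/\ v != 0, form G v U = 0 & v *m (M *m Pn) = 0] }.

Hypothesis D : cr_data.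
Local Notation g := (form G).
Local Notation h := (form Gb).

Let gC x y : g x y = g y x. Proof. exact/formC/cr_sym. Qed.
Let hC x y : h x y = h y x. Proof. exact/formC/cr_symb. Qed.
Let gsk := cr_Fsk D.
Let FF := cr_FF D.

Lemma cr_UF : U *m F = 0.
Proof.
apply/eqP; rewrite -(form_eq0 (cr_pos D)); apply/eqP.
by rewrite gsk FF (cr_UU D) scale1r addNr form0r oppr0.
Qed.

Lemma cr_FU x : g (x *m F) U = 0.
Proof. by rewrite gsk cr_UF form0r oppr0. Qed.

Lemma cr_gFF x y : g (x *m F) (y *m F) = g x y - g x U * g y U.
Proof.
by rewrite gsk FF formDr formNr formZr opprD opprK mulrC.
Qed.

Lemma cr_FFH x : g x U = 0 -> x *m F *m F = - x.
Proof. by move=> xU; rewrite FF xU scale0r addr0. Qed.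

Lemma Sg_linr k (x y y' : 'rV[R]_n) : Sg x (k *: y + y') = k *: Sg x y + Sg x y'.
Proof. by rewrite ![Sg x _](cr_SgC D) (cr_Sg_lin D). Qed.
Lemma Sg0r x : Sg x 0 = 0.
Proof. by have := Sg_linr (-1) x 0 0; rewrite scaler0 addr0 scaleN1r addNr. Qed.
Lemma SgFF x y : g x U = 0 -> g y U = 0 -> Sg (x *m F) (y *m F) = - Sg x y.
Proof.
move=> xU yU; rewrite (cr_SgJ D)// (cr_SgC D) (cr_SgJ D)//.
by rewrite -mulmxA (cr_JJ D) mulmxN mulmx1 (cr_SgC D).
Qed.

Let hJJ u v : h (u *m Jb) (v *m Jb) = h u v.
Proof.
by rewrite (cr_Jsk D) -mulmxA (cr_JJ D) mulmxN mulmx1 formNr opprK.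
Qed.

(** The right-hand side of the Gauss equation without the terms of the shape
    operator of [xi]. *)
Definition partial_curvature x y z w : R :=
  space_form_curvature G F c x y z w
  + (h (Sg y z) (Sg x w) - h (Sg x z) (Sg y w)).
Local Notation S := partial_curvature.

Lemma pc12 x y z w : S y x z w = - S x y z w.
Proof.
rewrite /partial_curvature (sfc12 _ (cr_sym D) gsk); gen_form; ring.
Qed.
Lemma pc34 x y z w : S x y w z = - S x y z w.
Proof.
rewrite /partial_curvature (sfc34 _ (cr_sym D) gsk).
rewrite (hC (Sg y w)) (hC (Sg x w)); gen_form; ring.
Qed.
Lemma pc_bianchi x y z w : S x y z w + S y z x w + S z x y w = 0.
Proof.
have := sfc_bianchi c (cr_sym D) gsk x y z w.
rewrite /partial_curvature.
rewrite (cr_SgC D y x) (cr_SgC D z y) (cr_SgC D z x).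
move: (space_form_curvature _ _ _ _ _ _ _) => s1.
move: (space_form_curvature _ _ _ _ _ _ _) => s2.
move: (space_form_curvature _ _ _ _ _ _ _) => s3; gen_form; lra.
Qed.
Lemma pc_lin4 x y z w w' k : S x y z (k *: w + w') = k * S x y z w + S x y z w'.
Proof.
rewrite /partial_curvature sfc_lin4 !Sg_linr !formDr !formZr; gen_form.
by move: (space_form_curvature _ _ _ _ _ _ _) (space_form_curvature _ _ _ _ _ _ _) => *; ring.
Qed.
Let pair x y z w := curv_pair pc12 pc34 pc_bianchi x y z w.
Let SD2 := curvD2 pc12 pc34 pc_bianchi pc_lin4.
Let SN2 := curvN2 pc12 pc34 pc_bianchi pc_lin4.
Let SD3 := curvD3 pc34 pc_lin4.
Let SD4 := curvD4 pc_lin4.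
Let S04 x y z : S x y z 0 = 0.
Proof. exact: curv04 pc_lin4 _ _ _. Qed.

(** [F] acts isometrically on the complement of [U] and [Sg] intertwines it with the
    isometry [Jb]; the first four terms of the space form tensor are exchanged in
    pairs. *)
Lemma pcF x y z w : g z U = 0 -> g w U = 0 ->
  S x y (z *m F) (w *m F) = S x y z w.
Proof.
move=> zU wU; rewrite /partial_curvature !(cr_SgJ D)// !hJJ; congr (_ + _).
have gF a b : g a (b *m F) = - g (a *m F) b by rewrite gsk opprK.
rewrite /space_form_curvature !cr_gFF zU wU (gF y z) (gF x w) (gF x z) (gF y w).
gen_form; ring.
Qed.

(** The bisectional curvature: Sg(Fy, Fy) = - Sg(y, y) makes the terms with
    Sg(x, x) cancel, and those with Sg(x, y) add up. *)
Lemma pc_bisectional x y : g y U = 0 ->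
  S x y y x + S x (y *m F) (y *m F) x =
  2 * c * (g x x * g y y + g x y ^+ 2 + g x (y *m F) ^+ 2)
  - 2 * h (Sg x y) (Sg x y).
Proof.
move=> yU; rewrite /partial_curvature /space_form_curvature.
rewrite SgFF// !(cr_SgJ D x)// (cr_SgC D y x).
rewrite (cr_SgC D _ x) (cr_SgJ D x)// hJJ.
rewrite cr_FFH// cr_gFF yU.
have gxF : g (x *m F) y = - g x (y *m F) by rewrite gsk.
have gxFF : g (x *m F) (y *m F) = g x y by rewrite cr_gFF yU mulr0 subr0.
have gyy : g (y *m F) y = 0 by have := gsk y y; rewrite (gC y); lra.
have gxx : g (x *m F) x = 0 by have := gsk x x; rewrite (gC x); lra.
have gyF : g y (y *m F) = 0 by rewrite gC.
rewrite !(formNl, formNr) gxF gxFF gyy gxx gyF (gC (y *m F) x) (gC y x).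
gen_form; ring.
Qed.

Lemma cr_kernel (Phi : 'rV[R]_n -> 'rV[R]_N) : linear Phi ->
  (forall v, Phi v *m Pn = Phi v) -> exists v,
    [/\ v != 0, g v U = 0 & Phi v = 0].
Proof.
move=> lP PP.
pose LM := GRing.isLinear.Build _ _ _ _ Phi lP.
pose LL : {linear _ -> _} := HB.pack Phi LM.
have [v [v0 vU vM]] := cr_ker D (lin1_mx LL).
by exists v; split => //; rewrite -PP -vM mulmxA mul_rV_lin1.
Qed.

(** Some [y] orthogonal to [U] is killed by Sg(p, -); its bisectional curvature with
    [p] is a positive multiple of [c]. *)
Lemma pc_nullity p : p != 0 -> (forall y z w, S p y z w = 0) -> c = 0.
Proof.
move=> p0 S0; have [||y [y0 yU Sy]] := cr_kernel (Sg p).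
- by move=> k a b; exact: Sg_linr.
- by move=> v; exact: cr_SgP.
have := pc_bisectional p y yU; rewrite !S0 Sy form0l mulr0 subr0 addr0 => /esym/eqP.
have pp := cr_pos D _ p0; have yy := cr_pos D _ y0.
rewrite -mulrA mulf_eq0 pnatr_eq0/= mulf_eq0 => /orP[/eqP//|].
by rewrite gt_eqF// ltr_wpDr ?sqr_ge0// ltr_wpDr ?sqr_ge0// mulr_gt0.
Qed.

(** Here [e] is an orthogonal projection of the tangent space with S(x, y) = 0 for
    [x] in its range and [y] in its kernel; then S is the sum of a tensor on the
    range and one on the kernel ([split_block]).  The statements about the kernel
    carry over to the range by exchanging [e] with [1%:M - e]. *)
Section Splitting.
Variable e : 'M[R]_n.
Hypothesis ee : e *m e = e.
Hypothesis esa : forall x y, g (x *m e) y = g x (y *m e).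
Hypothesis Se : forall x y z w, S (x *m e) (y - y *m e) z w = 0.

Let xee (x : 'rV[R]_n) : x *m e *m e = x *m e. Proof. by rewrite -mulmxA ee. Qed.

Lemma split_pc x y z w : S (x *m e) y z w = S (x *m e) (y *m e) z w.
Proof. by have := Se x y z w; rewrite SD2 SN2; lra. Qed.

Lemma split_mixed x y z w : x *m e = x -> y *m e = 0 -> S x y z w = 0.
Proof. by move=> xe ye; have := Se x y z w; rewrite xe ye subr0. Qed.

Lemma split_block x y z w : x *m e = x -> y *m e = y -> z *m e = 0 ->
  S x y z w = 0.
Proof.
move=> xe ye ze.
have -> : w = w *m e + (w - w *m e) by rewrite addrC subrK.
rewrite SD4; have we : (w - w *m e) *m e = 0 by rewrite mulmxBl xee subrr.
have -> : S x y z (w *m e) = 0 by rewrite pc34 -pair split_mixed// oppr0.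
have := pc_bianchi x y z (w - w *m e).
rewrite (split_mixed y z)// [S z x _ _]pc12 (split_mixed x z)//; lra.
Qed.

(** The component [p] of [z *m F] in the range of [e] is a nullity vector.  For x, y
    in the range and w = F w' orthogonal to U,
    S(x, y, p, w) = S(x, y, Fz, Fw') = S(x, y, z, w') = 0, and S(x, y, p, -) also
    vanishes on the component of U in the kernel of [e]; as this component is not
    orthogonal to U, S(x, y, p, -) = 0. *)
Lemma split_F_kernel z : U - U *m e != 0 -> z *m e = 0 -> g z U = 0 -> c != 0 ->
  z *m F *m e = 0.
Proof.
move=> UQ0 ze zU /negP c0; apply/eqP; apply/negPn/negP => p0; apply: c0.
apply/eqP; apply: (pc_nullity _ p0).
set p := z *m F *m e; have pe : p *m e = p by rewrite /p xee.
set UQ := U - U *m e in UQ0.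
have UQe : UQ *m e = 0 by rewrite /UQ mulmxBl xee subrr.
have zFq : (z *m F - p) *m e = 0 by rewrite mulmxBl pe subrr.
have H x y w : x *m e = x -> y *m e = y -> g w U = 0 -> S x y p w = 0.
  move=> xe ye wU; have wF := cr_FU w.
  have -> : w = - (w *m F) *m F by rewrite mulNmx cr_FFH// opprK.
  have := pcF x y z (- (w *m F)) zU; rewrite formNl wF oppr0 => /(_ erefl).
  rewrite (split_block x y z)// -{1}[z *m F](subrK p) SD3.
  by rewrite (split_block x y _ _ xe ye zFq) add0r.
have HT x y w : x *m e = x -> y *m e = y -> S x y p w = 0.
  move=> xe ye; have -> : w = (w - g w U *: U) + g w U *: U by rewrite subrK.
  rewrite SD4 H//; last first.
    by rewrite formDl formNl formZl (cr_UU D) mulr1 subrr.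
  rewrite add0r -[_ *: U]addr0 pc_lin4 S04 addr0.
  suff -> : S x y p U = 0 by rewrite mulr0.
  pose t := g UQ U.
  have t0 : t != 0.
    rewrite /t; have -> : g UQ U = g UQ UQ.
      rewrite /UQ [RHS]formDr formNr -esa mulmxBl xee subrr form0l subr0//.
    by rewrite (form_eq0 (cr_pos D)).
  have -> : U = (U - t^-1 *: UQ) + t^-1 *: UQ by rewrite subrK.
  rewrite SD4 H//; last first.
    by rewrite formDl formNl formZl (cr_UU D) mulVf// subrr.
  rewrite add0r -[_ *: UQ]addr0 pc_lin4 S04 addr0.
  by rewrite -pair split_mixed// mulr0.
move=> y z' w; rewrite -pe split_pc pe.
have q (x : 'rV[R]_n) : (x - x *m e) *m e = 0 by rewrite mulmxBl xee subrr.
rewrite -(subrK (z' *m e) z') -(subrK (w *m e) w).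
move: (z' - _) (w - _) (q z') (q w) => zq wq zqe wqe; rewrite SD3 !SD4.
rewrite -(pair p (y *m e) zq wq) -(pair p (y *m e) zq (w *m e)).
rewrite -(pair p (y *m e) (z' *m e) wq) -(pair p (y *m e) (z' *m e) (w *m e)).
rewrite (HT (z' *m e) (w *m e))// (split_mixed (z' *m e) wq)//.
rewrite (pc12 (w *m e)) (split_mixed (w *m e))// -(pair zq wq).
by rewrite (split_block p)// oppr0 !addr0.
Qed.

End Splitting.

Section SplittingRange.
Variable e : 'M[R]_n.
Hypothesis ee : e *m e = e.
Hypothesis esa : forall x y, g (x *m e) y = g x (y *m e).
Hypothesis Se : forall x y z w, S (x *m e) (y - y *m e) z w = 0.
Hypothesis c0 : c != 0.
Let xee (x : 'rV[R]_n) : x *m e *m e = x *m e. Proof. by rewrite -mulmxA ee. Qed.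

Definition compl (e : 'M[R]_n) : 'M[R]_n := 1%:M - e.
Lemma complE m (x : 'M[R]_(m, n)) : x *m compl e = x - x *m e.
Proof. by rewrite /compl mulmxBr mulmx1. Qed.
Lemma compl_idem : compl e *m compl e = compl e.
Proof. by rewrite complE /compl mulmxBl mul1mx ee subrr subr0. Qed.
Lemma compl_sa x y : g (x *m compl e) y = g x (y *m compl e).
Proof. by rewrite !complE formDl formDr formNl formNr esa. Qed.
Lemma compl_split x y z w : S (x *m compl e) (y - y *m compl e) z w = 0.
Proof. by rewrite !complE subKr pc12 Se oppr0. Qed.

Lemma split_F_range z : U *m e != 0 -> z *m e = z -> g z U = 0 ->
  z *m F *m e = z *m F.
Proof.
move=> U0 ze zU.
have := split_F_kernel (compl e) compl_idem compl_sa compl_split z.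
rewrite !complE subKr ze subrr => /(_ U0 erefl zU c0)/eqP.
by rewrite subr_eq0 => /eqP <-.
Qed.

(** Besides the vectors of the range of [e] orthogonal to [U], which [F] preserves,
    only the component [P] of [U] has to be tested: [P] is a combination of [U],
    which [F] kills, and of the vector v = P / |P|^2 - Q / |Q|^2 itself, and g(Fv, v) = 0
    as [F] is skew. *)
Lemma split_v_half P Q z : U *m e = P -> U - P = Q ->
  P != 0 -> Q != 0 -> z *m e = z ->
  g (((g P P)^-1 *: P - (g Q Q)^-1 *: Q) *m F) z = 0.
Proof.
move=> PE QE P0 Q0 ze.
have Pe : P *m e = P by rewrite -PE xee.
have Qe : Q *m e = 0 by rewrite -QE mulmxBl Pe PE subrr.
have PQ : g P Q = 0 by rewrite -Pe esa Qe form0r.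
have UE : U = P + Q by rewrite -QE addrC subrK.
have P0' : U *m e != 0 by rewrite PE.
have aa : g P P != 0 by rewrite (form_eq0 (cr_pos D)).
have bb : g Q Q != 0 by rewrite (form_eq0 (cr_pos D)).
have PU : g P U = g P P by rewrite UE formDr PQ addr0.
have QU : g Q U = g Q Q by rewrite UE formDr (gC Q P) PQ add0r.
have ab : g P P + g Q Q = 1.
  by have := cr_UU D; rewrite {1}UE formDl PU QU.
pose z' := z - (g z U / g P P) *: P.
have z'e : z' *m e = z' by rewrite /z' mulmxBl -scalemxAl Pe ze.
have z'U : g z' U = 0.
  by rewrite /z' formDl formNl formZl PU divfK// subrr.
have z'F := split_F_range z' P0' z'e z'U.
set v := _ - _; have vz' : g (v *m F) z' = 0.
  rewrite gsk /v formDl formNl !formZl.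
  have -> : g Q (z' *m F) = 0.
    by rewrite -z'F -esa Qe form0l.
  have -> : g P (z' *m F) = 0.
    by rewrite -[LHS]addr0 -PE esa z'F gC cr_FU addr0.
  by rewrite !mulr0 subr0 oppr0.
have vP : g (v *m F) P = 0.
  have -> : P = g P P *: U + (g P P * g Q Q) *: v.
    rewrite /v {1}UE scalerDr scalerBr !scalerA mulrAC mulfV// mul1r.
    by rewrite mulfK// addrACA -scalerBl subrr scale0r addr0 -scalerDl ab scale1r.
  rewrite formDr !formZr cr_FU.
  have -> : g (v *m F) v = 0 by have := gsk v v; rewrite (gC v); lra.
  by rewrite !mulr0 addr0.
by rewrite -(subrK ((g z U / g P P) *: P) z) -/z' formDr formZr vz' vP mulr0 addr0.
Qed.

End SplittingRange.

(** Were [c] not zero, v = P / |P|^2 - Q / |Q|^2 would be a nonzero vector orthogonal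
    to [U] and killed by [F], for [P] and [Q] the components of [U]. *)
Lemma split_both (e : 'M[R]_n) : e *m e = e ->
  (forall x y, g (x *m e) y = g x (y *m e)) ->
  (forall x y z w, S (x *m e) (y - y *m e) z w = 0) ->
  U *m e != 0 -> U - U *m e != 0 -> c = 0.
Proof.
move=> ee esa Se P0 Q0; apply/eqP/negPn/negP => c0.
have [P PE] : exists P, U *m e = P by exists (U *m e).
have [Q QE] : exists Q, U - P = Q by exists (U - P).
rewrite PE QE in P0 Q0.
have Pe : P *m e = P by rewrite -PE -mulmxA ee.
have Qe : Q *m e = 0 by rewrite -QE mulmxBl Pe PE subrr.
have UE : U = P + Q by rewrite -QE addrC subrK.
pose v := (g P P)^-1 *: P - (g Q Q)^-1 *: Q.
have h1 z : z *m e = z -> g (v *m F) z = 0.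
  exact: (split_v_half e ee esa Se c0 P Q).
have h2 z : z *m e = 0 -> g (v *m F) z = 0.
  move=> ze.
  have := split_v_half (compl e) (compl_idem _ ee) (compl_sa _ esa)
    (compl_split _ Se) c0 Q P z.
  have UQ : U - Q = P by rewrite -QE subKr.
  rewrite !complE PE QE ze subr0 => /(_ erefl UQ Q0 P0 erefl).
  by rewrite -opprB mulNmx formNl => /eqP; rewrite oppr_eq0 => /eqP.
have vF : v *m F = 0.
  apply: (form_nondeg (cr_pos D)) => z.
  have -> : z = z *m e + (z - z *m e) by rewrite addrC subrK.
  have xee : z *m e *m e = z *m e by rewrite -mulmxA ee.
  have qe : (z - z *m e) *m e = 0 by rewrite mulmxBl xee subrr.
  by rewrite formDr (h1 _ xee) (h2 _ qe) addr0.
have PQ : g P Q = 0 by rewrite -Pe esa Qe form0r.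
have aa : g P P != 0 by rewrite (form_eq0 (cr_pos D)).
have bb : g Q Q != 0 by rewrite (form_eq0 (cr_pos D)).
have vU : g v U = 0.
  rewrite UE /v formDl formNl !formZl !formDr PQ.
  by rewrite (gC Q P) PQ add0r addr0 !mulVf// subrr.
have := cr_FFH _ vU; rewrite vF mul0mx => /eqP; rewrite eq_sym oppr_eq0 => /eqP v0.
have : g v P = 0 by rewrite v0 form0l.
rewrite /v formDl formNl !formZl mulVf// (gC Q P) PQ mulr0 subr0 => /eqP.
by rewrite oner_eq0.
Qed.

(** With [U] in the range of [e] and [X0] in the kernel, the vanishing of S(X, Z)
    for [X] in the kernel and [Z] in the range gives, for [Z] in the kernel and [Y] in
    the range orthogonal to [U],
    |Sg(U, Z)|^2 = c |Z|^2, |Sg(X0, Y)|^2 = c |X0|^2 |Y|^2 and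
    < Sg(U, Z), Sg(X0, Y) > = 0.  So the map sending Z + Y to
    Sg(U, Z) + Sg(X0, Y) is injective on the complement of [U] if [c] is not zero,
    against the dimension bound [cr_ker]. *)
Lemma split_one (e : 'M[R]_n) (X0 : 'rV[R]_n) : e *m e = e ->
  (forall x y, g (x *m e) y = g x (y *m e)) ->
  (forall x y z w, S (x *m e) (y - y *m e) z w = 0) ->
  U *m e = U -> X0 != 0 -> X0 *m e = 0 -> c = 0.
Proof.
move=> ee esa Se Ue X00 X0e; apply/eqP/negPn/negP => c0.
have U0 : U != 0.
  by rewrite -(form_eq0 (cr_pos D)) (cr_UU D) oner_eq0.
have PF (z : 'rV[R]_n) : z *m e = z -> g z U = 0 -> z *m F *m e = z *m F.
  by apply: split_F_range => //; rewrite Ue.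
have QU (x : 'rV[R]_n) : x *m e = 0 -> g x U = 0.
  by move=> xe; rewrite -Ue -esa xe form0l.
have QF (x : 'rV[R]_n) : x *m e = 0 -> x *m F *m e = 0.
  move=> xe; apply: (form_nondeg (cr_pos D)) => z.
  rewrite esa gsk; pose z' := z *m e - g (z *m e) U *: U.
  have z'e : z' *m e = z' by rewrite /z' mulmxBl -scalemxAl Ue -mulmxA ee.
  have z'U : g z' U = 0.
    by rewrite /z' formDl formNl formZl (cr_UU D) mulr1 subrr.
  have -> : z *m e *m F = z' *m F.
    by rewrite /z' mulmxBl -scalemxAl cr_UF scaler0 subr0.
  by rewrite -PF// -esa xe form0l oppr0.
have SQP (x y z w : 'rV[R]_n) : x *m e = 0 -> y *m e = y -> S x y z w = 0.
  move=> xe ye; have := Se y x z w; rewrite ye xe subr0 pc12 => /eqP.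
  by rewrite oppr_eq0 => /eqP.
have E (X Z W : 'rV[R]_n) : X *m e = 0 -> g Z U = 0 -> g W U = 0 ->
    h (Sg X Z) (Sg U W) = h (Sg U Z) (Sg X W).
  move=> Xe ZU WU; have := SQP X U Z W Xe Ue.
  rewrite /partial_curvature /space_form_curvature cr_UF (gC U Z) (gC U W) ZU WU.
  by rewrite cr_FU !form0l; gen_form; lra.
have I (X Z W : 'rV[R]_n) : X *m e = 0 -> g Z U = 0 -> g W U = 0 ->
    h (Sg U Z *m Jb) (Sg X W) = 0.
  move=> Xe ZU WU; have XU := QU _ Xe.
  have E1 := E (X *m F) Z W (QF _ Xe) ZU WU.
  have E2 := E X (Z *m F) W Xe (cr_FU _) WU.
  rewrite (cr_SgC D (X *m F) Z) (cr_SgC D (X *m F) W) !(cr_SgJ D)// in E1.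
  rewrite (cr_SgC D Z X) (cr_SgC D W X) in E1; rewrite !(cr_SgJ D)// in E2.
  have := cr_Jsk D (Sg U Z) (Sg X W); lra.
have I' (X Z W : 'rV[R]_n) : X *m e = 0 -> g Z U = 0 -> g W U = 0 -> h (Sg U Z) (Sg X W) = 0.
  move=> Xe ZU WU; have := I X (Z *m F) W Xe (cr_FU _) WU.
  rewrite (cr_SgJ D)// -mulmxA (cr_JJ D) mulmxN mulmx1 formNl => /eqP.
  by rewrite oppr_eq0 => /eqP.
have II (Z : 'rV[R]_n) : Z *m e = 0 -> h (Sg U Z) (Sg U Z) = c * g Z Z.
  move=> Ze; have := pc_bisectional U Z (QU _ Ze).
  rewrite (pc12 Z U) (pc12 (Z *m F) U) !(SQP _ U)// ?QF//.
  rewrite (cr_UU D) (gC U Z) (gC U (Z *m F)) cr_FU (QU _ Ze) expr0n /=.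
  gen_form; lra.
have III (Y : 'rV[R]_n) : Y *m e = Y -> g Y U = 0 ->
    h (Sg X0 Y) (Sg X0 Y) = c * (g X0 X0 * g Y Y).
  move=> Ye YU; have := pc_bisectional X0 Y YU.
  rewrite !(SQP X0)// ?PF//.
  have gXP (y : 'rV[R]_n) : y *m e = y -> g X0 y = 0 by move=> <-; rewrite -esa X0e form0l.
  rewrite (gXP Y)// (gXP (Y *m F)) ?PF// expr0n /=; gen_form; lra.
have [||Z [Z0 ZU PZ]] := cr_kernel (fun Z : 'rV[R]_n => Sg U (Z - Z *m e) + Sg X0 (Z *m e)).
- move=> k a b /=; rewrite mulmxDl -scalemxAl opprD addrACA -scalerBr !Sg_linr.
  by rewrite scalerDr addrACA.
- by move=> v /=; rewrite mulmxDl !(cr_SgP D).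
have YU : g (Z *m e) U = 0 by rewrite esa Ue.
have Ye : Z *m e *m e = Z *m e by rewrite -mulmxA ee.
have Qe : (Z - Z *m e) *m e = 0 by rewrite mulmxBl Ye subrr.
have : h (Sg U (Z - Z *m e) + Sg X0 (Z *m e)) (Sg U (Z - Z *m e) + Sg X0 (Z *m e)) = 0.
  by rewrite PZ form0l.
rewrite formDl !formDr (hC (Sg X0 _) (Sg U _)) (I' X0)// ?(QU _ Qe)//.
rewrite II// III// addr0 add0r -mulrDr => /eqP; rewrite mulf_eq0 (negPf c0)/=.
rewrite paddr_eq0; first last.
- by rewrite mulr_ge0// form_ge0//; exact: (cr_pos D).
- by rewrite form_ge0//; exact: (cr_pos D).
rewrite mulf_eq0 !(form_eq0 (cr_pos D)) (negPf X00)/= => /andP[/eqP a /eqP b].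
by move: Z0; rewrite -(subrK (Z *m e) Z) a b addr0 eqxx.
Qed.

End Pointwise.

Arguments cr_data {R n N} G F U Gb Jb Pn Sg.
Arguments partial_curvature {R n N} G F c Gb Sg x y z w.

(** * The shape operator at one point *)

Lemma kernel_lt {R : fieldType} {n m : nat} (M : 'M[R]_(n, m)) :
  (\rank M < n)%N -> exists2 v : 'rV[R]_n, v != 0 & v *m M = 0.
Proof.
move=> rM; have : kermx M != 0 by rewrite kermx_eq0 /row_free ltn_eqF.
case/rowV0Pn => v /sub_kermxP vM v0; by exists v.
Qed.

Section CommutingShape.
Context {R : realType} {n N : nat}.
Context {G F : 'M[R]_n} {U : 'rV[R]_n} (c : R).
Context {Gb Jb Pn : 'M[R]_N} {Sg : 'rV[R]_n -> 'rV[R]_n -> 'rV[R]_N}.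
Context {A : 'M[R]_n}.
Hypothesis D : cr_data G F U Gb Jb Pn Sg.
Local Notation g := (form G).
Local Notation h := (form Gb).
Local Notation S := (partial_curvature G F c Gb Sg).
Let gC x y : g x y = g y x. Proof. exact/formC/(cr_sym D). Qed.
Let UU : g U U = 1 := cr_UU D.
Let gsk := cr_Fsk D.
Let gpos := cr_pos D.
Let FU x : g (x *m F) U = 0 := cr_FU D x.
Let FFH x : g x U = 0 -> x *m F *m F = - x := cr_FFH D x.
Let gFF x y : g (x *m F) (y *m F) = g x y - g x U * g y U :=
  cr_gFF D x y.

(** The right-hand side of the Gauss equation, with [A] the shape operator of the
    distinguished normal. *)
Definition gauss_curvature x y z w : R :=
  S x y z w + (g (y *m A) z * g (x *m A) w - g (x *m A) z * g (y *m A) w).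
Local Notation Rm := gauss_curvature.

Hypothesis Asym : forall x y, g (x *m A) y = g x (y *m A).
Hypothesis RA : forall x y z w, Rm x y (z *m A) w = Rm x y z (w *m A).

Let pc12' := pc12 c D.
Let pc34' := pc34 c D.
Let pcb := pc_bianchi c D.
Let spair := curv_pair pc12' pc34' pcb.

(** Pair symmetry moves the skew action of [A] from the last two arguments, where the
    hypothesis [RA] puts it, to the first two. *)
Lemma RmA x y z w : Rm (x *m A) y z w = Rm x (y *m A) z w.
Proof.
have P x' y' z' w' : Rm z' w' x' y' = Rm x' y' z' w'.
  rewrite /gauss_curvature spair !Asym.
  rewrite (gC w') (gC z') (gC w' (y' *m A)) (gC z' (x' *m A)) !Asym; ring.
by rewrite -!(P _ _ z w) RA.
Qed.

(** The kernel and the range of the symmetric [A] are orthogonal complements, and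
    [RmA] says S(x, y) = 0 for [x] in the kernel and [y] in the range; the projection
    onto the kernel is then a splitting of the kind excluded before. *)
Lemma singular_shape : A != 0 -> A \notin unitmx -> c = 0.
Proof.
move=> A0 Au; apply/eqP/negPn/negP => c0.
have dis (v : 'rV[R]_n) : (v <= kermx A)%MS -> (v <= A)%MS -> v = 0.
  move=> /sub_kermxP vA /submxP [w vE]; apply/eqP.
  by rewrite -(form_eq0 gpos) {2}vE gC Asym vA form0r.
have dx : (kermx A :&: A = 0)%MS.
  apply/eqP/rowV0P => v; rewrite sub_capmx => /andP[v1 v2]; exact: dis.
have full (v : 'rV[R]_n) : (v <= kermx A + A)%MS.
  apply: submx_full; rewrite /row_full mxrank_disjoint_sum// mxrank_ker.
  by rewrite subnK// rank_leq_row.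
pose e := proj_mx (kermx A) A.
have ee : e *m e = e by exact: proj_mx_proj.
have eA (x : 'rV[R]_n) : x *m e *m A = 0 by exact/sub_kermxP/proj_mx_sub.
have qA (x : 'rV[R]_n) : exists w : 'rV[R]_n, x - x *m e = w *m A.
  by have /submxP := proj_mx_compl_sub (full x).
have orth x y : g (x *m e) (y - y *m e) = 0.
  by have [w ->] := qA y; rewrite gC Asym eA form0r.
have esa x y : g (x *m e) y = g x (y *m e).
  rewrite -{1}(subrK (y *m e) y) formDr orth add0r.
  by rewrite -{2}(subrK (x *m e) x) formDl (gC (x - _)) orth add0r.
have Se x y z w : S (x *m e) (y - y *m e) z w = 0.
  have [t ->] := qA y; have := RmA (x *m e) t z w.
  rewrite eA /gauss_curvature eA !form0l mul0r mulr0 subrr addr0 => <-.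
  rewrite !mul0mx !form0l mul0r mulr0 subrr addr0.
  have := curvD1 pc12' pc34' pcb (pc_lin4 c D) 0 t z w 0.
  by rewrite addr0; lra.
have [|k k0 kA] := kernel_lt A.
  by rewrite ltn_neqAle rank_leq_row andbT -/(row_free A) row_free_unit.
have ke : k *m e = k by apply: proj_mx_id => //; apply/sub_kermxP.
have [i Ai] : exists i, row i A != 0.
  by apply/existsP; rewrite -negb_forall; apply: contra A0 => /forallP H;
     apply/eqP/row_matrixP => i; rewrite row0; exact/eqP.
have Qe : row i A *m e = 0 by apply: proj_mx_0 => //; exact: row_sub.
have [U0|U0] := eqVneq (U *m e) 0.
  case/negP: c0; apply/eqP.
  apply: (split_one _ D (compl e) k) => //.
  - exact: compl_idem.
  - exact: compl_sa.
  - by move=> *; exact: (compl_split _ D).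
  - by rewrite complE U0 subr0.
  - by rewrite complE ke subrr.
have [Q0|Q0] := eqVneq (U - U *m e) 0.
  case/negP: c0; apply/eqP.
  apply: (split_one _ D e (row i A)) => //.
  by move/eqP: Q0; rewrite subr_eq0 => /eqP <-.
case/negP: c0; apply/eqP.
exact: (split_both _ D e).
Qed.

Section Invertible.
Hypothesis Au : A \in unitmx.
Hypothesis c0 : c != 0.

(** The tensor Ax /\ y - x /\ Ay. *)
Definition shape_test x y z w : R :=
  (g y z * g (x *m A) w - g (x *m A) z * g y w)
  - (g (y *m A) z * g x w - g x z * g (y *m A) w).

(** [RmA] between the preimages of [x] and [y] under [A] writes [shape_test] as a
    difference of two values of [S], to which [pcF] applies. *)
Lemma shape_testF x y z w : g z U = 0 -> g w U = 0 ->
  shape_test x y (z *m F) (w *m F) = shape_test x y z w.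
Proof.
move=> zU wU.
have E z' w' : shape_test x y z' w' =
   S (x *m invmx A) y z' w' - S x (y *m invmx A) z' w'.
  have := RmA (x *m invmx A) (y *m invmx A) z' w'.
  rewrite /gauss_curvature !mulmxKV// /shape_test; lra.
by rewrite !E !(pcF _ D).
Qed.

Section Large.
Hypothesis n4 : (3 < n)%N.

Lemma orthogonal3 (a b d : 'rV[R]_n) : exists y,
  [/\ y != 0, g y a = 0, g y b = 0 & g y d = 0].
Proof.
pose M : 'M[R]_(1 + (1 + 1), n) := col_mx a (col_mx b d).
have [|y y0 yM] := kernel_lt (G *m M^T).
  by apply: leq_ltn_trans n4; rewrite (leq_trans (rank_leq_col _)).
exists y; split => //; move: yM;
rewrite mulmxA !tr_col_mx !mul_mx_row => /eqP;
rewrite !row_mx_eq0 => /and3P[/eqP h1 /eqP h2 /eqP h3];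
by rewrite /Defs.form ?h1 ?h2 ?h3 mxE.
Qed.

(** Let [a] be the part of [U *m A] orthogonal to [U].  [shape_testF] at U, y, a, y with
    [y] orthogonal to [U], [a] and [F a] reduces to |a|^2 |y|^2 = 0; such a [y]
    exists in dimension at least 4. *)
Lemma shape_U : U *m A = g (U *m A) U *: U.
Proof.
set mu := g (U *m A) U; pose a := U *m A - mu *: U.
apply/eqP; rewrite -subr_eq0 -/a.
have aU : g a U = 0 by rewrite /a formDl formNl formZl UU mulr1 subrr.
have [y [y0 yU ya yaF]] := orthogonal3 U a (a *m F).
have UAE z : g z U = 0 -> g (U *m A) z = g a z.
  by move=> zU; rewrite /a formDl formNl formZl (gC U z) zU mulr0 subr0.
have := shape_testF U y a y aU yU; rewrite /shape_test.
rewrite yaF ya !(gC U) aU yU !FU (gC y (y *m F)).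
have -> : g (y *m F) y = 0 by have := gsk y y; rewrite (gC y); lra.
rewrite (UAE a)// (UAE y)// => E.
have : g a a * g y y = 0 by lra.
by move/eqP; rewrite mulf_eq0 !(form_eq0 gpos) (negPf y0) orbF.
Qed.

Let q x := g (x *m A) x.

Let gxF x : g x (x *m F) = 0.
Proof. by have := gsk x x; rewrite (gC (x *m F)); lra. Qed.

(** For [x] and [y] spanning orthogonal complex lines, [shape_testF] at x, y, x, y
    says that the Rayleigh quotients of [A] at [x] and [y] agree. *)
Lemma shape_q x y : g x U = 0 -> g y U = 0 -> g y x = 0 -> g y (x *m F) = 0 ->
  q x * g y y = q y * g x x.
Proof.
move=> xU yU yx yxF; have := shape_testF x y x y xU yU; rewrite /shape_test.
rewrite yx (gC x y) yx yxF !gxF.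
have -> : g x (y *m F) = 0 by have := gsk y x; rewrite yxF gC => ->; rewrite ?oppr0.
rewrite /q; lra.
Qed.

Let qE k x l y : q (k *: x + l *: y) =
  k ^+ 2 * q x + l ^+ 2 * q y + 2 * k * l * g (x *m A) y.
Proof.
have -> : g (x *m A) y = g (y *m A) x by rewrite Asym gC.
rewrite /q mulmxDl -!scalemxAl !(formDl, formDr, formZl, formZr).
rewrite [g (x *m A) y]Asym (gC x); ring.
Qed.

Let gE k x l y k' x' l' y' : g (k *: x + l *: y) (k' *: x' + l' *: y') =
  k * k' * g x x' + k * l' * g x y' + l * k' * g y x' + l * l' * g y y'.
Proof. rewrite !(formDl, formDr, formZl, formZr); ring. Qed.

Let gU0 k x l y : g x U = 0 -> g y U = 0 -> g (k *: x + l *: y) U = 0.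
Proof. by move=> xU yU; rewrite formDl !formZl xU yU !mulr0 addr0. Qed.

(** [shape_q] applied to x + y and |y|^2 x - |x|^2 y, which again span orthogonal
    complex lines. *)
Lemma shape_orth x y : g x U = 0 -> g y U = 0 -> g y x = 0 ->
  g y (x *m F) = 0 -> g (x *m A) y = 0.
Proof.
move=> xU yU yx yxF.
have [->|x0] := eqVneq x 0; first by rewrite mul0mx form0l.
have [->|y0] := eqVneq y 0; first by rewrite form0r.
have a0 := gpos _ x0; have b0 := gpos _ y0.
have xyF : g x (y *m F) = 0.
  by have := gsk y x; rewrite (gC _ x) yxF oppr0.
have E1 := shape_q x y xU yU yx yxF.
have xy : g x y = 0 by rewrite gC.
have c1 : g (g y y *: x + (- g x x) *: y) (1 *: x + 1 *: y) = 0.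
  by rewrite gE yx xy; ring.
have c2 : g (g y y *: x + (- g x x) *: y) ((1 *: x + 1 *: y) *m F) = 0.
  by rewrite mulmxDl -!scalemxAl gE !gxF yxF xyF; ring.
have := shape_q _ _ (gU0 1 x 1 y xU yU) (gU0 _ x _ y xU yU) c1 c2.
rewrite !qE !gE yx xy.
move: E1 a0 b0; move: (g x x) (g y y) (q x) (q y) (g (x *m A) y).
move=> a b qx qy m E1 a0 b0 E.
have : 4 * (a * b * (a + b)) * m = 0.
  have {}E : (qx + qy + 2 * m) * (b ^+ 2 * a + a ^+ 2 * b) =
    (b ^+ 2 * qx + a ^+ 2 * qy - 2 * b * a * m) * (a + b) by lra.
  have -> : 4 * (a * b * (a + b)) * m = ((qx + qy + 2 * m) * (b ^+ 2 * a + a ^+ 2 * b)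
     - (b ^+ 2 * qx + a ^+ 2 * qy - 2 * b * a * m) * (a + b))
     + (a + b) * (b - a) * (qx * b - qy * a) by ring.
  by rewrite E E1 !subrr mulr0 addr0.
have ab : 0 < a * b * (a + b) by rewrite !mulr_gt0 ?addr_gt0.
move/eqP; rewrite mulf_eq0 mulf_eq0 pnatr_eq0 /=.
by rewrite gt_eqF//= => /eqP.
Qed.

(** It remains to treat the direction [x *m F]: with a [y] orthogonal to the complex
    line of [x], the Rayleigh quotients at x, F x and x + F x all equal the one at
    [y], so the mixed term vanishes. *)
Lemma shape_perp x z : g x U = 0 -> g z U = 0 -> g z x = 0 -> g (x *m A) z = 0.
Proof.
move=> xU zU zx.
have [->|x0] := eqVneq x 0; first by rewrite mul0mx form0l.
have a0 := gpos _ x0.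
have xFF : g (x *m F) (x *m F) = g x x by rewrite gFF xU mul0r subr0.
have xF : g (x *m A) (x *m F) = 0.
  have [y [y0 yU yx yxF]] := orthogonal3 U x (x *m F).
  have E1 := shape_q x y xU yU yx yxF.
  have E2 := shape_q (x *m F) y (FU x) yU yxF.
  rewrite FFH// formNr yx oppr0 xFF in E2; have {}E2 := E2 erefl.
  have := shape_q (1 *: x + 1 *: (x *m F)) y (gU0 _ _ _ _ xU (FU x)) yU.
  rewrite mulmxDl -!scalemxAl FFH// !(formDr, formZr, formNr) yx yxF.
  rewrite oppr0 !mulr0 addr0 qE !(formDl, formZl) !gxF (gC (x *m F) x) gxF xFF.
  move=> /(_ erefl erefl); have b0 := gpos _ y0.
  move: E1 E2 b0; move: (q x) (q y) (q (x *m F)) (g x x) (g y y) (g (x *m A) _).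
  move=> qx qy qz a b m E1 E2 b0 E.
  have : b * m = 0 by lra.
  by move/eqP; rewrite mulf_eq0 gt_eqF//= => /eqP.
pose t := g z (x *m F) / g x x.
have zE : z = (z - t *: (x *m F)) + t *: (x *m F) by rewrite subrK.
rewrite zE formDr formZr xF mulr0 addr0; apply: shape_orth => //.
- by rewrite formDl formNl formZl FU mulr0 zU subr0.
- by rewrite formDl formNl formZl zx (gC (x *m F) x) gxF mulr0 subr0.
- by rewrite formDl formNl formZl xFF /t divfK ?subrr// gt_eqF.
Qed.

(** A quadratic form whose polar form vanishes on orthogonal pairs is a multiple of
    the metric; here this multiple is the Rayleigh quotient at one vector [x0]. *)
Lemma shape_scalar : exists lam, forall x, g x U = 0 -> x *m A = lam *: x.
Proof.
have [x0 [x00 x0U _ _]] := orthogonal3 U U U; have a0 := gpos _ x00.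
pose lam := q x0 / g x0 x0; exists lam.
have q1 z : g z U = 0 -> g z x0 = 0 -> q z = lam * g z z.
  move=> zU zx.
  have := shape_perp (1 *: x0 + 1 *: z) (g z z *: x0 + (- g x0 x0) *: z)
     (gU0 _ _ _ _ x0U zU) (gU0 _ _ _ _ x0U zU).
  rewrite !gE zx (gC x0 z) zx mulmxDl -!scalemxAl !gE [g (z *m A) x0]Asym.
  rewrite (gC z (x0 *m A)) -/(q x0) -/(q z) => E.
  have {}E : g z z * q x0 - g x0 x0 * q z = 0.
    have xz := shape_perp x0 z x0U zU zx; rewrite xz in E.
    by rewrite -E; ring.
  by apply: (mulfI (lt0r_neq0 a0)); rewrite /lam mulrA mulrCA divff ?lt0r_neq0// mulr1; lra.
have q2 z : g z U = 0 -> q z = lam * g z z.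
  move=> zU; pose t := g z x0 / g x0 x0; pose z1 := z - t *: x0.
  have z1U : g z1 U = 0 by rewrite formDl formNl formZl zU x0U mulr0 subr0.
  have z1x : g z1 x0 = 0.
    by rewrite formDl formNl formZl /t divfK ?subrr// gt_eqF.
  have -> : z = t *: x0 + 1 *: z1 by rewrite scale1r addrC subrK.
  rewrite qE gE (gC x0 z1) z1x (shape_perp x0 z1)// (q1 z1)//.
  by rewrite -(divfK (lt0r_neq0 a0) (q x0)) -/lam; ring.
move=> x xU; apply: (form_inj gpos) => w.
have [->|x0'] := eqVneq x 0; first by rewrite mul0mx scaler0.
have b0 := gpos _ x0'.
pose u := g w U; pose s := g w x / g x x; pose w2 := w - u *: U - s *: x.
have wE : w = w2 + s *: x + u *: U by rewrite /w2 !subrK.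
have w2U : g w2 U = 0.
  by rewrite /w2 !(formDl, formNl, formZl) UU xU /u mulr0 subr0 mulr1 subrr.
have w2x : g w2 x = 0.
  rewrite /w2 !(formDl, formNl, formZl) (gC U) xU mulr0 subr0.
  by rewrite /s divfK ?subrr// gt_eqF.
rewrite wE; clearbody w2 s u => {wE}.
rewrite formZl !formDr !formZr.
rewrite (shape_perp x w2)// (gC x w2) w2x -/(q x) q2// Asym shape_U formZr xU.
ring.
Qed.

End Large.

Section Small.
Hypothesis n3 : (n <= 3)%N.

(** Four nonzero pairwise orthogonal vectors would be linearly independent. *)
Lemma orthogonal4 (x1 x2 x3 y : 'rV[R]_n) : x1 != 0 -> x2 != 0 -> x3 != 0 ->
  g x1 x2 = 0 -> g x1 x3 = 0 -> g x2 x3 = 0 ->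
  g y x1 = 0 -> g y x2 = 0 -> g y x3 = 0 -> y = 0.
Proof.
move=> x10 x20 x30 x12 x13 x23 y1 y2 y3; apply/eqP/negPn/negP => y0.
pose f (i : 'I_4) := nth 0 [:: x1; x2; x3; y] i.
have [|k k0] := kernel_lt (\matrix_i f i).
  by rewrite (leq_ltn_trans (rank_leq_col _)).
rewrite mulmx_sum_row !big_ord_recl big_ord0 !rowK /f /= addr0 => kM.
have pr z : g (k 0 0 *: x1 + (k 0 (lift 0 0) *: x2
   + (k 0 (lift 0 (lift 0 0)) *: x3 + k 0 (lift 0 (lift 0 (lift 0 0))) *: y))) z = 0.
  by rewrite kM form0l.
have e1 := pr x1; have e2 := pr x2; have e3 := pr x3; have e4 := pr y.
rewrite !(formDl, formZl) (gC x2 x1) (gC x3 x1) x12 x13 y1 in e1.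
rewrite !(formDl, formZl) (gC x3 x2) x12 x23 y2 in e2.
rewrite !(formDl, formZl) x13 x23 y3 in e3.
rewrite !(formDl, formZl) !(gC _ y) y1 y2 y3 in e4.
have nz (v : 'rV[R]_n) t : v != 0 -> t * g v v = 0 -> t = 0.
  by move=> v0 /eqP; rewrite mulf_eq0 (form_eq0 gpos) (negPf v0) orbF => /eqP.
move/eqP: k0; apply; apply/rowP => i; rewrite mxE.
case: i => -[|[|[|[|//]]]] Hi.
- by rewrite (_ : Ordinal Hi = 0); [apply: (nz x1) => //; lra|exact: val_inj].
- by rewrite (_ : Ordinal Hi = lift 0 0); [apply: (nz x2) => //; lra|exact: val_inj].
- by rewrite (_ : Ordinal Hi = lift 0 (lift 0 0));
    [apply: (nz x3) => //; lra|exact: val_inj].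
- by rewrite (_ : Ordinal Hi = lift 0 (lift 0 (lift 0 0)));
    [apply: (nz y) => //; lra|exact: val_inj].
Qed.

Let U0 : U != 0.
Proof. by rewrite -(form_eq0 gpos) UU oner_eq0. Qed.

Let gxF' x : g x (x *m F) = 0.
Proof. by have := gsk x x; rewrite (gC (x *m F)); lra. Qed.

Lemma expand3 e y : g e e = 1 -> g e U = 0 ->
  y = g y e *: e + g y (e *m F) *: (e *m F) + g y U *: U.
Proof.
move=> ee eU; apply/eqP; rewrite -subr_eq0; apply/eqP.
have fe : g (e *m F) (e *m F) = 1 by rewrite gFF eU mulr0 subr0.
have e0 : e != 0 by rewrite -(form_eq0 gpos) ee oner_eq0.
have f0 : e *m F != 0 by rewrite -(form_eq0 gpos) fe oner_eq0.
apply: (orthogonal4 e (e *m F) U) => //;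
rewrite !(formDl, formNl, formZl) ?(gC U e) ?(gC U (e *m F)) ?eU ?FU
  ?(gC (e *m F) e) ?gxF' ?ee ?fe ?UU; ring.
Qed.

(** In this dimension the complement of [U] is one complex line, spanned over [F] by a
    vector killed by Sg(x, -). *)
Lemma Sg_small x z : g z U = 0 -> Sg x z = 0.
Proof.
move=> zU; have [||v [v0 vU Sv]] := cr_kernel D (Sg x).
- by move=> k a b; exact: (Sg_linr D).
- by move=> v; exact: (cr_SgP D).
pose s := Num.sqrt (g v v); have vv := gpos _ v0.
have s0 : s != 0 by rewrite gt_eqF// sqrtr_gt0.
have ss : s ^+ 2 = g v v by rewrite sqr_sqrtr// ltW.
have ee : g (s^-1 *: v) (s^-1 *: v) = 1.
  by rewrite formZl formZr -ss; field.
have eU : g (s^-1 *: v) U = 0 by rewrite formZl vU mulr0.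
rewrite (expand3 _ z ee eU) zU scale0r addr0 -scalemxAl !scalerA.
have SL := Sg_linr D; have S0 := Sg0r D.
have SZ k y : Sg x (k *: y) = k *: Sg x y.
  by have := SL k x y 0; rewrite S0 !addr0.
apply: (etrans (SL _ _ _ _)); rewrite SZ Sv scaler0 add0r.
by rewrite (cr_SgJ D)// Sv mul0mx scaler0.
Qed.

(** By [Sg_small] the part [Sg] is a multiple of the product of two linear forms, so
    its contribution to the Gauss equation cancels. *)
Lemma gauss_small x y z w : Rm x y z w = space_form_curvature G F c x y z w
  + (g (y *m A) z * g (x *m A) w - g (x *m A) z * g (y *m A) w).
Proof.
rewrite /gauss_curvature /partial_curvature; congr (_ + _).
have SL := Sg_linr D.
have SC := cr_SgC D.
have E a b : Sg a b = (g a U * g b U) *: Sg U U.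
  have H x' y' : Sg x' y' = g y' U *: Sg x' U.
    rewrite -{1}(subrK (g y' U *: U) y') addrC SL (Sg_small x' (y' - _)) ?addr0//.
    by rewrite formDl formNl formZl UU mulr1 subrr.
  by rewrite H SC H scalerA mulrC.
by rewrite [Sg y z]E [Sg x w]E [Sg x z]E [Sg y w]E !(formZl, formZr); ring.
Qed.

(** A unit vector [e] along the part of [U *m A] orthogonal to [U]: in the frame e, Fe,
    U the entry of [A] between Fe and U is zero. *)
Lemma frame3 : exists e, [/\ g e e = 1, g e U = 0 & g (U *m A) (e *m F) = 0].
Proof.
pose mu := g (U *m A) U; pose a := U *m A - mu *: U.
suff [v [v0 vU vA]] : exists v, [/\ v != 0, g v U = 0 & g (U *m A) (v *m F) = 0].
  pose s := Num.sqrt (g v v); have vv := gpos _ v0.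
  have s0 : s != 0 by rewrite gt_eqF// sqrtr_gt0.
  have ss : s ^+ 2 = g v v by rewrite sqr_sqrtr// ltW.
  exists (s^-1 *: v); split.
  - by rewrite formZl formZr -ss; field.
  - by rewrite formZl vU mulr0.
  - by rewrite -scalemxAl formZr vA mulr0.
have UAE v : g (U *m A) (v *m F) = g a (v *m F).
  by rewrite /a formDl formNl formZl (gC U (v *m F)) FU mulr0 subr0.
have [a0|a0] := eqVneq a 0.
  have [v [v0 vU _]] := cr_ker D 0.
  by exists v; split => //; rewrite UAE a0 form0l.
exists a; split => //; first by rewrite /a formDl formNl formZl UU mulr1 subrr.
by rewrite UAE gxF'.
Qed.

(** With the frame of [frame3], the equations [RmA] are polynomial in the five
    remaining entries of [A].  If [a13] is not zero, they force [a12] = 0 and then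
    3 c [a13] = 0.  If [a13] = 0, then [a33] is not zero as [A] is invertible, and
    [a12] or [a11 - a22] being nonzero would give 4 c + a11 a22 - a12^2 = 0 together
    with c + a33 (a11 + a22 - a33) = 0, which [E21] turns into 3 c [a33] = 0. *)
Lemma shape_small :
  (exists mu, U *m A = mu *: U) /\
  exists lam, forall x, g x U = 0 -> x *m A = lam *: x.
Proof.
have [e1 [ee eU eA]] := frame3; pose e2 := e1 *m F.
have ff : g e2 e2 = 1 by rewrite /e2 gFF eU mulr0 subr0.
have fU : g e2 U = 0 by exact: FU.
have ef : g e1 e2 = 0 by exact: gxF'.
have f2 : e2 *m F = - e1 by rewrite /e2 FFH.
have UF : U *m F = 0 := cr_UF D.
pose a11 := g (e1 *m A) e1; pose a12 := g (e1 *m A) e2.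
pose a13 := g (e1 *m A) U; pose a22 := g (e2 *m A) e2; pose a33 := g (U *m A) U.
have A1 : e1 *m A = a11 *: e1 + a12 *: e2 + a13 *: U by exact: expand3.
have A2 : e2 *m A = a12 *: e1 + a22 *: e2.
  rewrite (expand3 _ (e2 *m A) ee eU) -/e2 -/a22.
  have -> : g (e2 *m A) U = 0 by rewrite Asym gC.
  have -> : g (e2 *m A) e1 = a12 by rewrite Asym gC.
  by rewrite scale0r addr0.
have A3 : U *m A = a13 *: e1 + a33 *: U.
  rewrite (expand3 _ (U *m A) ee eU) eA scale0r addr0 -/a33.
  by have -> : g (U *m A) e1 = a13 by rewrite Asym gC.
have a33U : a13 = 0 -> a33 != 0.
  move=> z; apply/eqP => z3; move: A3; rewrite z z3 !scale0r addr0 => UA0.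
  by move: U0; rewrite -(mulmxK Au U) UA0 mul0mx eqxx.
pose v x1 x2 x3 : 'rV[R]_n := x1 *: e1 + x2 *: e2 + x3 *: U.
pose dot x1 x2 x3 y1 y2 y3 : R := x1 * y1 + x2 * y2 + x3 * y3.
have gv x1 x2 x3 y1 y2 y3 : g (v x1 x2 x3) (v y1 y2 y3) = dot x1 x2 x3 y1 y2 y3.
  rewrite /v !(formDl, formZl, formDr, formZr) ee ff UU ef eU fU.
  by rewrite (gC e2 e1) ef (gC U) eU (gC U) fU /dot; ring.
have vF x1 x2 x3 : v x1 x2 x3 *m F = v (- x2) x1 0.
  rewrite /v !mulmxDl -!scalemxAl -/e2 f2 UF scaler0 scale0r !addr0.
  by rewrite scalerN scaleNr addrC.
have vA x1 x2 x3 : v x1 x2 x3 *m A =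
   v (a11 * x1 + a12 * x2 + a13 * x3) (a12 * x1 + a22 * x2) (a13 * x1 + a33 * x3).
  rewrite /v !mulmxDl -!scalemxAl A1 A2 A3.
  by apply/rowP => j; rewrite !mxE; ring.
clearbody v.
(* From here on only coordinates in the frame e1, e2, U occur: [v] is abstract and
   each equation below is one component of [RmA]. *)
have T x1 x2 x3 y1 y2 y3 z1 z2 z3 w1 w2 w3 :=
  RmA (v x1 x2 x3) (v y1 y2 y3) (v z1 z2 z3) (v w1 w2 w3).
have r12 : a12 * (4 * c + a11 * a22 - a12 ^+ 2) = 0.
  have := T 0 1 0 0 1 0 0 1 0 1 0 0.
  rewrite !gauss_small /space_form_curvature !vA !vF !gv /dot; lra.
have r13 : a12 * a13 ^+ 2 = 0.
  have := T 0 0 1 0 0 1 0 1 0 1 0 0.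
  rewrite !gauss_small /space_form_curvature !vA !vF !gv /dot; lra.
have E11 : a13 * (c + a22 * a33) + (a11 - a22) * (a13 * a22) = 0.
  have := T 1 0 0 0 1 0 0 0 1 0 1 0.
  rewrite !gauss_small /space_form_curvature !vA !vF !gv /dot; lra.
have E13 : (a11 - a22) * (4 * c + a11 * a22 - a12 ^+ 2) + a13 ^+ 2 * a22 = 0.
  have := T 1 0 0 0 1 0 0 1 0 1 0 0.
  rewrite !gauss_small /space_form_curvature !vA !vF !gv /dot; lra.
have E21 : (a22 - a33) * (c + a22 * a33) + a12 ^+ 2 * a33 - a13 ^+ 2 * a22 = 0.
  have := T 0 1 0 0 0 1 0 0 1 0 1 0.
  rewrite !gauss_small /space_form_curvature !vA !vF !gv /dot; lra.
have E22 : (a22 - a33) * (- a12 * a33) - a12 * (c + a11 * a33 - a13 ^+ 2)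
    + a12 * a13 ^+ 2 = 0.
  have := T 0 1 0 0 0 1 1 0 0 0 0 1.
  rewrite !gauss_small /space_form_curvature !vA !vF !gv /dot; lra.
have E23 : (a22 - a33) * (- a13 * a22) - a12 ^+ 2 * a13
    + a13 * (4 * c + a11 * a22 - a12 ^+ 2) = 0.
  have := T 0 1 0 0 0 1 0 1 0 1 0 0.
  rewrite !gauss_small /space_form_curvature !vA !vF !gv /dot; lra.
have E32 : (a33 - a11) * (c + a11 * a33 - a13 ^+ 2) - a12 ^+ 2 * a33 = 0.
  have := T 0 0 1 1 0 0 1 0 0 0 0 1.
  rewrite !gauss_small /space_form_curvature !vA !vF !gv /dot; lra.
have cz : c = 0 -> False by move/eqP; rewrite (negPf c0).
have a13z : a13 = 0.
  apply/eqP/negPn/negP => a130.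
  have a12z : a12 = 0.
    by move/eqP: r13; rewrite mulf_eq0 sqrf_eq0 (negPf a130) orbF => /eqP.
  rewrite a12z in E23; apply: cz; apply: (mulfI a130); lra.
have mu0 := a33U a13z; rewrite a13z in E11 E13 E21 E22 E23 E32.
have W : (a12 != 0) || (a11 != a22) -> False.
  move=> ns.
  have [d0 w0] : 4 * c + a11 * a22 - a12 ^+ 2 = 0
      /\ c + a11 * a33 + a22 * a33 - a33 ^+ 2 = 0.
    have [z|nz] := eqVneq a12 0; last first.
      split; apply: (mulfI nz); lra.
    rewrite z eqxx /= in ns; rewrite z in E13 E21 E32.
    have nz : a11 - a22 != 0 by rewrite subr_eq0.
    split; apply: (mulfI nz); rewrite ?z; lra.
  apply: cz; apply: (mulfI mu0).
  have : a22 * (c + a11 * a33 + a22 * a33 - a33 ^+ 2) = 0 by rewrite w0 mulr0.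
  have : a33 * (4 * c + a11 * a22 - a12 ^+ 2) = 0 by rewrite d0 mulr0.
  lra.
have a12z : a12 = 0 by apply/eqP/negPn/negP => nz; apply: W; rewrite nz.
have a11E : a11 = a22.
  by apply/eqP/negPn/negP => nz; apply: W; rewrite nz orbT.
split; first by exists a33; rewrite A3 a13z scale0r add0r.
exists a11 => x xU; rewrite (expand3 _ x ee eU) -/e2 xU scale0r addr0.
rewrite mulmxDl -!scalemxAl A1 A2 a12z a13z !scale0r !addr0 add0r -a11E.
by rewrite scalerDr !scalerA (mulrC a11) (mulrC a11).
Qed.

End Small.
Lemma shape_invertible : exists lam mu,
  U *m A = mu *: U /\ forall x, g x U = 0 -> x *m A = lam *: x.
Proof.
have [n4|n3] := ltnP 3 n.
  have [lam H] := shape_scalar n4; exists lam, (g (U *m A) U); split => //.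
  exact: shape_U n4.
by have [[mu H1] [lam H2]] := shape_small n3; exists lam, mu.
Qed.

End Invertible.

(** The last relation comes from [RmA] on [U] and [y], which for [y] = x and [y] = F x
    reads (lam - mu) (S(U, y, y, U) + lam mu |y|^2) = 0; in the sum
    [pc_bisectional] evaluates the terms of [S] to 2 c |x|^2, since Sg(U, x) = 0. *)
Lemma eta_umbilical : c != 0 -> exists lam mu x,
  [/\ U *m A = mu *: U, forall x, g x U = 0 -> x *m A = lam *: x,
     (lam - mu) * (c + lam * mu) = 0 & [/\ x != 0, g x U = 0 & Sg U x = 0]].
Proof.
move=> c0.
have [lam [mu [HU HH]]] : exists lam mu,
    U *m A = mu *: U /\ forall x, g x U = 0 -> x *m A = lam *: x.
  have [Au|/singular_shape H] := boolP (A \in unitmx).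
    exact: shape_invertible.
  have [->|/H/eqP] := eqVneq A 0; last by rewrite (negPf c0).
  by exists 0, 0; split=> [|x _]; rewrite mulmx0 scale0r.
have [||x [x0 xU Sx]] := cr_kernel D (Sg U).
- by move=> k a b; exact: (Sg_linr D).
- by move=> v; exact: (cr_SgP D).
exists lam, mu, x; split => //.
have xx := gpos _ x0.
have E y : g y U = 0 -> (lam - mu) * (S U y y U + lam * mu * g y y) = 0.
  move=> yU; have := RmA y U y U; rewrite HU (HH y yU) => E.
  have L4 := pc_lin4 c D.
  have Z4 a b d k e : S a b d (k *: e) = k * S a b d e.
    by have := L4 a b d e 0 k; rewrite addr0 (curv04 L4) addr0.
  have Z1 a b d k e : S (k *: a) b d e = k * S a b d e.
    by rewrite -!(spair _ _ d e) pc34' Z4 -mulrN -pc34'.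
  have Z2 a b d k e : S a (k *: b) d e = k * S a b d e.
    by rewrite pc12' Z1 -mulrN -pc12'.
  move: E; rewrite /gauss_curvature Z1 Z2 -!scalemxAl HU (HH y yU).
  rewrite !formZl UU yU (gC U) yU (pc12' U y); lra.
have E1 := E x xU; have E2 := E (x *m F) (FU x).
have := pc_bisectional c D U x xU.
rewrite Sx form0l UU (gC U) xU (gC U) FU !expr0n /= => B.
rewrite gFF xU mulr0 subr0 in E2.
have : g x x * ((lam - mu) * (c + lam * mu)) = 0.
  have : (lam - mu) * (S U x x U + S U (x *m F) (x *m F) U) =
    (lam - mu) * (2 * c * (1 * g x x + 0 + 0) - 2 * 0) by rewrite B.
  lra.
by move/eqP; rewrite mulf_eq0 gt_eqF//= => /eqP.
Qed.

End CommutingShape.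

Arguments gauss_curvature {R n N} G F c Gb Sg A x y z w.

(** * A CR submanifold in one pair of charts *)

Lemma scale_addACA {R : nzRingType} {V : lmodType R} k (a b d e : V) :
  (k *: a + b) + (k *: d + e) = k *: (a + d) + (b + e).
Proof. by rewrite scalerDr addrACA. Qed.

(** The next lemmas are the final eliminations in the proofs of the Gauss and Codazzi
    equations, with the geometric quantities abstracted to numbers. *)
Lemma gauss_half_algebra {R : realType} {X K Y L L' B S : R} :
  X + K = Y + L -> L = L' -> K = L' + B + S -> X = Y - (S + B).
Proof. by move=> E EL F; lra. Qed.

Lemma gauss_algebra {R : realType} {X1 X2 s Y1 Y2 S1 S2 B1 B2 : R} :
  X1 - X2 = s -> X1 = Y1 - (S1 + B1) -> X2 = Y2 - (S2 + B2) ->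
  Y1 - Y2 = s + (S1 - S2) + (B1 - B2).
Proof. by move=> E1 E2 E3; lra. Qed.

Lemma addr_self_eq0 {R : realType} {a b : R} : a + b = 0 -> b = a -> a = 0.
Proof. by move=> E F; lra. Qed.

Lemma codazzi_half_algebra {R : realType} {L X K m B B' P Q l1 l2 : R} :
  L = X + K -> K = l2 -> L = m * B -> B = - B' -> B' = P + Q -> Q = - l1 ->
  X = m * (l1 - P) - l2.
Proof.
move=> E1 E2 E3 E4 E5 E6; rewrite -[LHS](addrK K) -E1 E3 E4 E5 E6 E2; ring.
Qed.

Lemma codazzi_algebra {R : realType} {X1 X2 m' m lam gv gx q P1 P2 c : R} :
  X1 - X2 = - (2 * c * q) ->
  X1 = m' * (lam * gv - P1) - lam ^+ 2 * gv ->
  X2 = m' * (lam * gx - P2) - lam ^+ 2 * gx ->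
  P1 = P2 -> gv = q -> gx = - q -> m' = m ->
  q * c = q * (lam ^+ 2 - m * lam).
Proof. by move=> E E1 E2 PE gE gE' mE; rewrite E1 E2 PE gE gE' mE in E; lra. Qed.

Lemma codazzi_gauss_eq0 {R : realType} {c lam m : R} :
  c = lam ^+ 2 - m * lam -> (lam - m) * (c + lam * m) = 0 -> c = 0.
Proof.
move=> cE /eqP; rewrite mulf_eq0 => /orP[/eqP lm|/eqP lm].
  have lE : lam = m by lra.
  by rewrite cE lE; ring.
have /eqP : lam ^+ 2 = 0 by lra.
by rewrite sqrf_eq0 => /eqP l0; rewrite cE l0; ring.
Qed.

(** The immersion, the normal field and the shape operator in coordinates: [phi] maps
    the open set [Om] of a chart of M into the chart [O] of the ambient manifold. *)
Section LocalSubmanifold.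
Local Open Scope classical_set_scope.
Local Open Scope ring_scope.
Context {R : realType} {n p : nat}.
Local Notation N := (n + p)%N.
Context {O : set 'rV[R]_N} {Gm J : 'rV[R]_N -> 'M[R]_N}.
Context {Om : set 'rV[R]_n} {G : 'rV[R]_n -> 'M[R]_n}.
Context {phi : 'rV[R]_n -> 'rV[R]_N} {xi : 'rV[R]_n -> 'rV[R]_N}.
Context {A : 'rV[R]_n -> 'M[R]_n} {c : R}.
Hypothesis GO : metric_on O Gm.
Hypothesis JO : kaehler_on O Gm J.
Hypothesis GOm : metric_on Om G.
Hypothesis phiO : map_into O Om phi.
Local Notation T := (jacobian phi).
Local Notation Gb y := (Gm (phi y)).
Local Notation covp := (cov Gm phi).
Hypothesis phi_diff3 : forall a b y, Om y ->
  differentiable ('D_a ('D_b phi)) y.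
Hypothesis iso : forall y, Om y -> G y = T y *m Gb y *m (T y)^T.
Hypothesis xi_diff : forall y, Om y -> differentiable xi y.
Hypothesis xi_diff2 : forall a y, Om y -> differentiable ('D_a xi) y.
Hypothesis xi_unit : forall y, Om y -> form (Gb y) (xi y) (xi y) = 1.
Hypothesis xi_normal : forall y u, Om y -> form (Gb y) (u *m T y) (xi y) = 0.
Hypothesis xi_CR : forall y, Om y -> (T y *m J (phi y) <= T y + xi y)%MS.
Hypothesis n_odd : odd n.
Hypothesis pn : (p < n)%N.
Hypothesis A_diff : forall y, Om y -> differentiable A y.
Hypothesis shape : forall y X, Om y -> exists2 D : 'rV[R]_N,
  (forall X' : 'rV[R]_n, form (Gb y) (X' *m T y) D = 0) &
  covp X xi y = - (X *m A y *m T y) + D.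

Let dphi := mi_diff phiO.
Let dphi2 := mi_diff2 phiO.
Let Oz y (Oy : Om y) : O (phi y) := mi_in phiO y Oy.
Let nOm y : Om y -> \forall x \near y, Om x.
Proof. exact/open_near/(mo_open GOm). Qed.

Lemma TD u y : Om y -> 'D_u phi y = u *m T y.
Proof. by move=> Oy; apply: deriveEjacobian; exact: dphi. Qed.

Lemma differentiable_T y : Om y -> differentiable T y.
Proof.
move=> Oy; apply/differentiable_mxE => i j.
have /differentiable_mxE/(_ 0 j) := dphi2 (delta_mx 0 i) y Oy.
apply: near_eq_differentiable; near=> z.
by rewrite TD -?rowE ?mxE//; near: z; exact: nOm.
Unshelve. all: by end_near. Qed.

Lemma derive_T u w y : Om y -> 'D_u ('D_w phi) y = w *m 'D_u T y.
Proof.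
move=> Oy; have dT := differentiable_T y Oy.
have dw : differentiable (fun=> w : 'rV[R]_n) y by exact: differentiable_cst.
have E : \forall z \near y, 'D_w phi z = w *m T z.
  by near=> z; apply: TD; near: z; exact: nOm.
rewrite (near_eq_derive _ E).
rewrite (derive_mulmx (fun=> w) T y u dw dT).
by rewrite derive_cst mul0mx add0r.
Unshelve. all: by end_near. Qed.

Section AtPoint.
Variable y : 'rV[R]_n.
Hypothesis Oy : Om y.
Local Notation g := (form (G y)).
Local Notation h := (form (Gb y)).
Let Gs := mo_sym GOm y Oy.
Let Gpos v := mo_pos GOm y v Oy.
Let Gbs := mo_sym GO _ (Oz y Oy).
Let JJ := ko_sq JO _ (Oz y Oy).
Let Jiso u v := ko_iso JO _ u v (Oz y Oy).
Let gC u v : g u v = g v u. Proof. exact: formC. Qed.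
Let hC u v : h u v = h v u. Proof. exact: formC. Qed.
Let Gu : G y \in unitmx. Proof. exact: form_unitmx Gpos. Qed.
Let Jsk u v : h (u *m J (phi y)) v = - h u (v *m J (phi y)).
Proof. exact: isometry_skew. Qed.
Let mJJ (v : 'rV[R]_N) : v *m J (phi y) *m J (phi y) = - v.
Proof. by rewrite -mulmxA JJ mulmxN mulmx1. Qed.

(** [tan_proj y] takes an ambient vector to the coordinates of its tangential part,
    [CR_F] and [CR_U] are the tangential parts of J and of - J xi, [nor_proj] is the
    projection onto the normals orthogonal to [xi], and [CR_Sg] is the part of the
    second fundamental form there. *)
Definition tan_proj y : 'M[R]_(N, n) := Gb y *m (T y)^T *m invmx (G y).
Definition CR_F y : 'M[R]_n := T y *m J (phi y) *m tan_proj y.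
Definition CR_U y : 'rV[R]_n := - (xi y *m J (phi y) *m tan_proj y).
Definition nor_proj y : 'M[R]_N :=
  1%:M - tan_proj y *m T y - Gb y *m (xi y)^T *m xi y.
Definition CR_Sg y u v : 'rV[R]_N := covp u ('D_v phi) y *m nor_proj y.
Local Notation Tp := (tan_proj y).
Local Notation F := (CR_F y).
Local Notation U := (CR_U y).
Local Notation Pn := (nor_proj y).
Local Notation Jy := (J (phi y)).
Local Notation X := (xi y).

Lemma form_T (u v : 'rV[R]_n) : h (u *m T y) (v *m T y) = g u v.
Proof. by rewrite (iso y Oy) form_mulmx. Qed.

Lemma form_tan_proj (a : 'rV[R]_N) (v : 'rV[R]_n) :
  g (a *m Tp) v = h a (v *m T y).
Proof.
rewrite /Defs.form /tan_proj !mulmxA mulmxKV//.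
by rewrite trmx_mul !mulmxA.
Qed.

Lemma CR_FE (v : 'rV[R]_n) : v *m F = v *m T y *m Jy *m Tp.
Proof. by rewrite /CR_F; move: Tp => P; rewrite !mulmxA. Qed.

Lemma T_inj (u : 'rV[R]_n) : u *m T y = 0 -> u = 0.
Proof.
move=> u0; apply: (form_nondeg Gpos) => v.
by rewrite -form_T u0 form0l.
Qed.

Lemma T_tan_proj (u : 'rV[R]_n) : u *m T y *m Tp = u.
Proof. by apply: (form_inj Gpos) => v; rewrite form_tan_proj form_T. Qed.

Lemma xi_tan_proj : X *m Tp = 0.
Proof.
apply: (form_nondeg Gpos) => v.
by rewrite form_tan_proj hC xi_normal.
Qed.

Let XX : h X X = 1. Proof. exact: xi_unit. Qed.
Let XT (u : 'rV[R]_n) : h X (u *m T y) = 0. Proof. by rewrite hC xi_normal. Qed.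
Let TX (u : 'rV[R]_n) : h (u *m T y) X = 0. Proof. exact: xi_normal. Qed.
Let XJX : h (X *m Jy) X = 0.
Proof. by have := Jsk X X; rewrite (hC X (X *m _)); lra. Qed.

Lemma form_U (v : 'rV[R]_n) : g v U = h (v *m T y *m Jy) X.
Proof. by rewrite gC /CR_U formNl form_tan_proj Jsk opprK hC. Qed.

(** The normal part of J on tangent vectors is along [xi] by the hypothesis
    [xi_CR]. *)
Lemma TJ (v : 'rV[R]_n) : v *m T y *m Jy = v *m F *m T y + g v U *: X.
Proof.
have [w [b E]] : exists (w : 'rV[R]_n) (b : R),
    v *m T y *m Jy = w *m T y + b *: X.
  have sub : (v *m T y *m Jy <= T y + X)%MS.
    by rewrite -mulmxA (submx_trans _ (xi_CR y Oy))// submxMl.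
  have /sub_addsmxP [[w b] /= E] := sub.
  exists w, (b 0 0); rewrite E; congr (_ + _).
  by rewrite [b in LHS]mx11_scalar mul_scalar_mx.
have -> : g v U = b by rewrite form_U E formDl TX formZl XX add0r mulr1.
have -> : v *m F = w.
  by rewrite CR_FE E mulmxDl T_tan_proj -scalemxAl xi_tan_proj scaler0 addr0.
by [].
Qed.

Lemma form_F (u v : 'rV[R]_n) : g (u *m F) v = h (u *m T y *m Jy) (v *m T y).
Proof. by rewrite CR_FE form_tan_proj. Qed.

Lemma F_U (v : 'rV[R]_n) : g (v *m F) U = 0.
Proof.
have : h (v *m T y *m Jy *m Jy) X = 0 by rewrite mJJ formNl TX oppr0.
rewrite TJ mulmxDl formDl -scalemxAl formZl XJX mulr0 addr0.
by rewrite -form_U.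
Qed.

Lemma TJJ (v : 'rV[R]_n) : v *m F *m F *m T y + g v U *: (X *m Jy) = - (v *m T y).
Proof.
have := mJJ (v *m T y); rewrite TJ mulmxDl -scalemxAl TJ F_U scale0r addr0.
by [].
Qed.

(** Otherwise [F] would square to - 1, but [n] is odd and a determinant has a
    nonnegative square. *)
Lemma U_neq0 : U != 0.
Proof.
apply/eqP => U0.
have FF : F *m F = (-1)%:M.
  apply/row_matrixP => i; rewrite !rowE; set d := delta_mx _ _.
  have := TJJ d; rewrite U0 form0r scale0r addr0 => E.
  rewrite mulmxA mul_mx_scalar scaleN1r; apply/eqP; rewrite -subr_eq0 opprK.
  by apply/eqP/T_inj; rewrite mulmxDl E addNr.
have := congr1 determinant FF; rewrite det_mulmx det_scalar -signr_odd n_odd expr1.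
by move=> E; have := sqr_ge0 (\det F); rewrite expr2 E ler0N1.
Qed.

(** Applying J twice to the tangent vector [U] expresses |U|^2 J xi through tangent
    vectors, so J xi is tangent and equals its tangential part. *)
Lemma xiJ : X *m Jy = - (U *m T y).
Proof.
have UU0 : g U U != 0 by rewrite (form_eq0 Gpos) U_neq0.
have [w E] : exists w : 'rV[R]_n, X *m Jy = w *m T y.
  exists ((g U U)^-1 *: (- (U + U *m F *m F))).
  rewrite -scalemxAl; apply: (scalerI UU0); rewrite scalerA mulfV// scale1r.
  rewrite (mulNmx (U + U *m F *m F)) (mulmxDl U) opprD -(TJJ U).
  by rewrite addrAC subrr add0r.
rewrite E -mulNmx; congr (_ *m _).
by rewrite /CR_U E T_tan_proj opprK.
Qed.

Lemma U_unit : g U U = 1.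
Proof. by rewrite -form_T -[LHS]opprK -formNl -formNr -xiJ Jiso. Qed.

Lemma FF_U (v : 'rV[R]_n) : v *m F *m F = - v + g v U *: U.
Proof.
apply/eqP; rewrite -subr_eq0; apply/eqP/T_inj.
have := TJJ v; rewrite xiJ scalerN => E.
rewrite mulmxBl mulmxDl mulNmx -E -scalemxAl subrK subrr//.
Qed.

Lemma F_skew (u v : 'rV[R]_n) : g (u *m F) v = - g u (v *m F).
Proof. by rewrite form_F Jsk (gC u) form_F hC. Qed.

Lemma nor_projE (a : 'rV[R]_N) :
  a *m Pn = a - a *m Tp *m T y - h a X *: X.
Proof.
rewrite /nor_proj; move: Tp => P; rewrite !mulmxBr mulmx1 !mulmxA; congr (_ - _).
by rewrite [_ *m _ *m _^T]mx11_scalar mul_scalar_mx.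
Qed.

Lemma T_nor (u : 'rV[R]_n) : u *m T y *m Pn = 0.
Proof. by rewrite nor_projE T_tan_proj TX scale0r subr0 subrr. Qed.

Lemma xi_nor : X *m Pn = 0.
Proof. by rewrite nor_projE xi_tan_proj mul0mx XX scale1r subr0 subrr. Qed.

Lemma nor_T (a : 'rV[R]_N) (v : 'rV[R]_n) : h (a *m Pn) (v *m T y) = 0.
Proof.
by rewrite nor_projE !(formDl, formNl, formZl) XT form_T form_tan_proj mulr0 subr0 subrr.
Qed.

Lemma nor_xi (a : 'rV[R]_N) : h (a *m Pn) X = 0.
Proof. by rewrite nor_projE !(formDl, formNl, formZl) TX XX mulr1 subr0 subrr. Qed.

Lemma nor_id (a : 'rV[R]_N) : (forall v : 'rV[R]_n, h a (v *m T y) = 0) ->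
  h a X = 0 -> a *m Pn = a.
Proof.
move=> aT aX; rewrite nor_projE aX scale0r subr0.
have -> : a *m Tp = 0.
  by apply: (form_nondeg Gpos) => v; rewrite form_tan_proj.
by rewrite mul0mx subr0.
Qed.

Lemma nor_nor (a : 'rV[R]_N) : a *m Pn *m Pn = a *m Pn.
Proof. by apply: nor_id; [exact: nor_T|exact: nor_xi]. Qed.

Lemma nor_J (a : 'rV[R]_N) : a *m Jy *m Pn = a *m Pn *m Jy.
Proof.
have E : a = a *m Pn + a *m Tp *m T y + h a X *: X.
  by rewrite nor_projE -!addrA [_ *m T y + _]addrC !addrA !subrK.
rewrite {1}E !mulmxDl TJ mulmxDl T_nor -!scalemxAl xiJ xi_nor mulNmx T_nor.
rewrite oppr0 !scaler0 !addr0; apply: nor_id => [v|].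
  by rewrite Jsk TJ formDr formZr nor_T nor_xi mulr0 addr0 oppr0.
by rewrite Jsk xiJ formNr nor_T !oppr0.
Qed.

Lemma form_split (a b : 'rV[R]_N) : h a b =
  g (a *m Tp) (b *m Tp) + h a X * h b X + h (a *m Pn) (b *m Pn).
Proof.
have E : b = b *m Pn + b *m Tp *m T y + h b X *: X.
  by rewrite nor_projE -!addrA [_ *m T y + _]addrC !addrA !subrK.
rewrite {1}E !formDr formZr -form_tan_proj.
have -> : h a (b *m Pn) = h (a *m Pn) (b *m Pn).
  rewrite [in RHS]nor_projE !(formDl, formNl, formZl) !(hC _ (b *m Pn)) nor_T nor_xi.
  by rewrite mulr0 !subr0.
by rewrite mulrC addrC addrA [g _ _ + _]addrC addrAC addrC addrA.
Qed.

(** [nor_proj y] kills the tangent space and [xi], so its rank is at most p - 1.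
    Together with orthogonality to [U] this makes at most p < n linear
    conditions. *)
Lemma normal_kernel (M : 'M[R]_(n, N)) : exists v : 'rV[R]_n,
  [/\ v != 0, g v U = 0 & v *m (M *m Pn) = 0].
Proof.
pose K : 'M[R]_(n + 1, N) := col_mx (T y) X.
have KP : K *m Pn = 0.
  rewrite mul_col_mx xi_nor (_ : T y *m Pn = 0) ?col_mx0//.
  by apply/row_matrixP => i; rewrite row_mul rowE T_nor row0.
have rK : \rank K = (n + 1)%N.
  apply/eqP; apply: inj_row_free => v; rewrite -[v]hsubmxK mul_row_col => E.
  have b0 : rsubmx v = 0.
    have : h (lsubmx v *m T y + rsubmx v *m X) X = 0 by rewrite E form0l.
    rewrite [rsubmx v]mx11_scalar mul_scalar_mx formDl TX formZl XX add0r mulr1.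
    by move=> ->; rewrite -scalemx1 scale0r.
  move: E; rewrite b0 mul0mx addr0 => /T_inj ->; exact: row_mx0.
have rP : (\rank Pn <= p.-1)%N.
  have := mulmx0_rank_max KP; rewrite rK; lia.
have p0 : (0 < p)%N.
  have := rank_leq_col K; rewrite rK; lia.
have [|v v0] := kernel_lt (row_mx (M *m Pn) (G y *m U^T)).
  have r1 := rank_leq_col (G y *m U^T).
  have r2 : (\rank (row_mx (M *m Pn) (G y *m U^T)) <=
      \rank (M *m Pn) + \rank (G y *m U^T))%N.
    rewrite -mxrank_tr tr_row_mx -addsmxE -[X in (_ <= X + _)%N]mxrank_tr.
    rewrite -[X in (_ <= _ + X)%N]mxrank_tr; exact: mxrank_adds_leqif.
  apply: (leq_ltn_trans r2).
  have := leq_trans (mxrankM_maxr M Pn) rP; move: r1.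
  move: (\rank _) (\rank _) => a b r1 r3; lia.
rewrite mul_mx_row => /eqP; rewrite row_mx_eq0 => /andP[/eqP h1 /eqP h2].
by exists v; split => //; rewrite /Defs.form -mulmxA h2 mxE.
Qed.

End AtPoint.

Let dGb y (Oy : Om y) : differentiable (fun z => Gb z) y :=
  differentiable_metric_along GO phiO y Oy.
Let dJphi y (Oy : Om y) : differentiable (fun z => J (phi z)) y.
Proof.
exact: (differentiable_comp (dphi y Oy) (ko_diff JO _ (Oz y Oy))).
Qed.

Lemma differentiable_tan_proj y : Om y -> differentiable tan_proj y.
Proof.
move=> Oy; apply: differentiable_mulmx; last first.
  apply: differentiable_invmx; last exact: (mo_diff GOm).
  near=> z; apply: form_unitmx => v; apply: (mo_pos GOm).
  by near: z; exact: nOm.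
apply: differentiable_mulmx; first exact: dGb.
by apply: differentiable_trmx; exact: differentiable_T.
Unshelve. all: by end_near. Qed.

Lemma differentiable_xiJ y : Om y ->
  differentiable (fun z => xi z *m J (phi z)) y.
Proof. by move=> Oy; apply: differentiable_mulmx; [exact: xi_diff|exact: dJphi]. Qed.

Lemma differentiable_U y : Om y -> differentiable CR_U y.
Proof.
move=> Oy; apply: differentiableN; apply: differentiable_mulmx.
  exact: differentiable_xiJ.
exact: differentiable_tan_proj.
Qed.

Lemma differentiable_F y : Om y -> differentiable CR_F y.
Proof.
move=> Oy; apply: differentiable_mulmx; last exact: differentiable_tan_proj.
by apply: differentiable_mulmx; [exact: differentiable_T|exact: dJphi].
Qed.

Let chr y (Oy : Om y) := christoffel_bilin GO _ (Oz y Oy).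

Let chr0 y a : Om y -> christoffel Gm (phi y) a 0 = 0.
Proof.
move=> Oy; have := (chr y Oy).2 a (-1) 0 0.
by rewrite scaler0 addr0 scaleN1r addNr.
Qed.

Lemma cov_lin k u u' W y : Om y -> differentiable W y ->
  covp (k *: u + u') W y = k *: covp u W y + covp u' W y.
Proof.
move=> Oy dW; rewrite /cov.
have -> : 'D_(k *: u + u') W y = k *: 'D_u W y + 'D_u' W y.
  by rewrite !(deriveE _ dW) linearP.
have -> : 'D_(k *: u + u') phi y = k *: 'D_u phi y + 'D_u' phi y.
  by rewrite !(deriveE _ (dphi y Oy)) linearP.
have -> := (chr y Oy).1 (W y) k ('D_u phi y) ('D_u' phi y).
exact: scale_addACA.
Qed.

Lemma cov_tangent u (W : 'rV[R]_n -> 'rV[R]_n) y : Om y -> differentiable W y ->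
  covp u (fun z => W z *m T z) y = 'D_u W y *m T y + covp u ('D_(W y) phi) y.
Proof.
move=> Oy dW; rewrite /cov.
have -> := derive_mulmx W T y u dW (differentiable_T y Oy).
have -> := derive_T u (W y) y Oy; have -> := TD (W y) y Oy.
by rewrite addrA.
Qed.

Lemma cov_xi_scaled u (B : 'rV[R]_n -> 'M[R]_1) y : Om y -> differentiable B y ->
  B y = 0 -> covp u (fun z => B z *m xi z) y = 'D_u B y *m xi y.
Proof.
move=> Oy dB B0; rewrite /cov.
have -> := derive_mulmx B xi y u dB (xi_diff y Oy).
by rewrite B0 !mul0mx chr0// !addr0.
Qed.

Lemma cov_add u W1 W2 y : Om y -> differentiable W1 y -> differentiable W2 y ->
  covp u (fun z => W1 z + W2 z) y = covp u W1 y + covp u W2 y.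
Proof.
move=> Oy d1 d2; rewrite /cov.
have -> : 'D_u (fun z => W1 z + W2 z) y = 'D_u W1 y + 'D_u W2 y.
  by apply: deriveD; exact: diff_derivable.
have := (chr y Oy).2 ('D_u phi y) 1 (W1 y) (W2 y); rewrite !scale1r => ->.
exact: addrACA.
Qed.

Lemma cov_opp u W y : Om y -> differentiable W y ->
  covp u (fun z => - W z) y = - covp u W y.
Proof.
move=> Oy dW; rewrite /cov.
have -> : 'D_u (fun z => - W z) y = - 'D_u W y.
  by apply: deriveN; exact: diff_derivable.
have := (chr y Oy).2 ('D_u phi y) (-1) (W y) 0.
rewrite !scaleN1r chr0// !addr0 => ->.
by rewrite opprD.
Qed.

Lemma cov_id_cst a b z : cov G (@id 'rV[R]_n) a (fun=> b) z = christoffel G z a b.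
Proof.
rewrite /cov derive_cst add0r.
by have -> : 'D_a (@id 'rV[R]_n) z = a by exact: derive_id.
Qed.

Lemma Sg_sym y u v : Om y -> CR_Sg y u v = CR_Sg y v u.
Proof.
move=> Oy; rewrite /CR_Sg.
by have -> := cov_torsion GO phiO u v y Oy.
Qed.

(** Differentiate J (d phi v) = d phi (F v) + beta xi, with beta(z) = < v, U > zero at
    [y].  The derivatives of [F] and of beta only contribute vectors along the tangent
    space and [xi], which [nor_proj] kills. *)
Lemma Sg_J y u v : Om y -> form (G y) v (CR_U y) = 0 ->
  CR_Sg y u (v *m CR_F y) = CR_Sg y u v *m J (phi y).
Proof.
move=> Oy vU; rewrite /CR_Sg -nor_J//.
pose B z : 'M[R]_1 := v *m G z *m (CR_U z)^T.
have dv : differentiable (fun=> v : 'rV[R]_n) y by exact: differentiable_cst.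
have dB : differentiable B y.
  apply: differentiable_mulmx; last exact/differentiable_trmx/differentiable_U.
  by apply: differentiable_mulmx => //; exact: (mo_diff GOm).
have B0 : B y = 0.
  by rewrite [B y]mx11_scalar (_ : B y 0 0 = 0)// -scalemx1 scale0r.
have dvF : differentiable (fun z => v *m CR_F z) y.
  by apply: differentiable_mulmx => //; exact: differentiable_F.
have CJ := cov_J JO u _ y phiO Oy (dphi2 v y Oy).
have E : \forall z \near y, 'D_v phi z *m J (phi z)
    = v *m CR_F z *m T z + B z *m xi z.
  near=> z; have Oz' : Om z by near: z; exact: nOm.
  by rewrite TD// TJ// [B z]mx11_scalar mul_scalar_mx.
have CN := @cov_near _ _ Gm _ phi u _ _ y E.
have d1 : differentiable (fun z => v *m CR_F z *m T z) y.
  by apply: differentiable_mulmx => //; exact: differentiable_T.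
have d2 : differentiable (fun z => B z *m xi z) y.
  by apply: differentiable_mulmx => //; exact: xi_diff.
have CA := cov_add u _ _ y Oy d1 d2.
have CT := cov_tangent u _ y Oy dvF; have CX := cov_xi_scaled u B y Oy dB B0.
have CE := etrans (esym CJ) (etrans CN CA); rewrite CT CX in CE.
move: CE; move: (covp u ('D_v phi) y) (covp u _ y) => a b.
move: ('D_u _ y) ('D_u B y) => d k ->; rewrite !mulmxDl T_nor// add0r.
by rewrite [k]mx11_scalar mul_scalar_mx -scalemxAl xi_nor// scaler0 addr0.
Unshelve. all: by end_near. Qed.

Lemma cr_data_at y : Om y -> cr_data (G y) (CR_F y) (CR_U y) (Gb y)
  (J (phi y)) (nor_proj y) (CR_Sg y).
Proof.
move=> Oy; have zy := Oz y Oy; split.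
- exact: (mo_sym GOm).
- by move=> v; exact: (mo_pos GOm).
- by move=> x; exact: FF_U.
- by move=> x w; exact: F_skew.
- exact: U_unit.
- exact: (mo_sym GO).
- exact: (ko_sq JO).
- move=> u v; apply: isometry_skew; first exact: (ko_sq JO).
  by move=> *; exact: (ko_iso JO).
- move=> k x x' w; rewrite /CR_Sg cov_lin//; last exact: dphi2.
  by rewrite mulmxDl -scalemxAl.
- by move=> x w; exact: Sg_sym.
- by move=> x w; exact: Sg_J.
- by move=> x w; exact: nor_nor.
- exact: normal_kernel.
Qed.

(** The Weingarten relation, by differentiating < d phi v, xi > = 0. *)
Lemma cov_phi_xi y u v : Om y ->
  form (Gb y) (covp u ('D_v phi) y) (xi y) = form (G y) (u *m A y) v.
Proof.
move=> Oy; have [D Dn E] := shape y u Oy.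
have Z : 'D_u (fun z => form (Gb z) ('D_v phi z) (xi z)) y = 0.
  rewrite (@near_eq_derive _ _ _ _ (cst (0 : R))) ?derive_cst//.
  near=> z; have Oz' : Om z by near: z; exact: nOm.
  by rewrite TD// xi_normal.
have M := cov_metric GO phiO u _ _ y Oy (dphi2 v y Oy) (xi_diff y Oy).
rewrite M E TD// formDr formNr Dn addr0 form_T// in Z.
rewrite (formC _ _ (mo_sym GOm y Oy)); lra.
Unshelve. all: by end_near. Qed.

Lemma shape_sym y u v : Om y -> form (G y) (u *m A y) v = form (G y) u (v *m A y).
Proof.
move=> Oy; have E1 := cov_phi_xi y u v Oy; have E2 := cov_phi_xi y v u Oy.
have Tt := cov_torsion GO phiO u v y Oy.
rewrite Tt in E1; rewrite -E1 E2.
exact: (formC (v *m A y) u (mo_sym GOm y Oy)).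
Qed.

(** Both sides are given by the Koszul formula: the left one is symmetric in [u] and
    [v], and its two permutations add up to the derivative of the metric. *)
Lemma cov_phi_tan y u v t : Om y ->
  form (Gb y) (covp u ('D_v phi) y) ('D_t phi y) =
  form (G y) (christoffel G y u v) t.
Proof.
move=> Oy; rewrite (form_christoffel GOm)//.
have [P PE] : exists P : 'rV[R]_n -> 'rV[R]_n -> 'rV[R]_n -> R, forall a b d,
    P a b d = form (Gb y) (covp a ('D_b phi) y) ('D_d phi y).
  by exists (fun a b d => form (Gb y) (covp a ('D_b phi) y) ('D_d phi y)).
have Ps a b d : P a b d = P b a d.
  by rewrite (PE a) (PE b); have -> := cov_torsion GO phiO a b y Oy.
have PG a b d : form ('D_a G y) b d = P a b d + P a d b.
  have M := cov_metric GO phiO a _ _ y Oy (dphi2 b y Oy) (dphi2 d y Oy).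
  have db : differentiable (fun=> b : 'rV[R]_n) y by exact: differentiable_cst.
  have dd : differentiable (fun=> d : 'rV[R]_n) y by exact: differentiable_cst.
  have [_ E] := derive_form G (fun=> b) (fun=> d) y a
     (mo_diff GOm y Oy) db dd.
  rewrite !derive_cst form0l form0r !addr0 in E; rewrite -E.
  have C := formC ('D_b phi y) (covp a ('D_d phi) y)
    (mo_sym GO _ (Oz y Oy)).
  rewrite (PE a b d) (PE a d b).
  apply: (etrans _ (etrans M (congr1 (GRing.add _) C))).
  apply: near_eq_derive; near=> z; have Oz' : Om z by near: z; exact: nOm.
  have -> := TD b z Oz'; have -> := TD d z Oz'.
  by apply/esym; exact: form_T.
rewrite /christoffel1 (PG u v t) (PG v u t) (PG t u v) -PE.
rewrite (Ps v u t) (Ps t u v) (Ps t v u); by field.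
Unshelve. all: by end_near. Qed.

Lemma cov_phi_tan_proj y u v : Om y ->
  covp u ('D_v phi) y *m tan_proj y = christoffel G y u v.
Proof.
move=> Oy; apply: (form_inj (fun v => mo_pos GOm y v Oy)) => t.
by rewrite form_tan_proj// -TD// cov_phi_tan.
Qed.

Let covG := cov G (@id 'rV[R]_n).

(** The derivative in the direction [u] of < D_v (d phi w), d phi t > =
    < Gamma(v, w), t > ([cov_phi_tan]), computed on both sides with metric
    compatibility; the products of first covariant derivatives differ by their normal
    components along [xi] and in the range of [nor_proj] ([form_split]). *)
Lemma gauss_half y u v w t : Om y ->
  form (Gb y) (covp u (covp v ('D_w phi)) y) ('D_t phi y) =
  form (G y) (covG u (covG v (fun=> w)) y) t
  - (form (Gb y) (CR_Sg y v w) (CR_Sg y u t)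
     + form (G y) (v *m A y) w * form (G y) (u *m A y) t).
Proof.
move=> Oy.
have cst_diff (a z : 'rV[R]_n) : differentiable (fun=> a : 'rV[R]_n) z.
  exact: differentiable_cst.
have covGc a b z : covG a (fun=> b) z = christoffel G z a b.
  exact: cov_id_cst.
have dC : differentiable (covp v ('D_w phi)) y.
  apply: (differentiable_cov GO phiO) => //; first exact: dphi2.
  exact: phi_diff3.
have dchr : differentiable (covG v (fun=> w)) y.
  apply: (@near_eq_differentiable _ _ _ (fun z => christoffel G z v w)).
    by near=> z; rewrite covGc.
  exact: (differentiable_christoffel GOm).
have M1 := cov_metric GO phiO u _ _ y Oy dC (dphi2 t y Oy).
have M2 := cov_metric GOm (map_into_id GOm) u (covG v (fun=> w)) (fun=> t) y Oy
  dchr (cst_diff t y).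
have E : 'D_u (fun z => form (Gb z) (covp v ('D_w phi) z) ('D_t phi z)) y =
   'D_u (fun z => form (G z) (covG v (fun=> w) z) t) y.
  apply: near_eq_derive; near=> z; have Oz' : Om z by near: z; exact: nOm.
  by rewrite cov_phi_tan// covGc.
have EE := etrans (esym M1) (etrans E M2).
have GG : form (G y) (covG v (fun=> w) y) (covG u (fun=> t) y) =
    form (G y) (christoffel G y v w) (christoffel G y u t).
  by congr (form _ _ _); exact: cov_id_cst.
apply: (gauss_half_algebra EE GG).
have [a aE] : exists a, covp v ('D_w phi) y = a by eexists.
have [b bE] : exists b, covp u ('D_t phi) y = b by eexists.
have t1 : a *m tan_proj y = christoffel G y v w.
  by rewrite -aE; exact: cov_phi_tan_proj.
have t2 : b *m tan_proj y = christoffel G y u t.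
  by rewrite -bE; exact: cov_phi_tan_proj.
have x1 : form (Gb y) a (xi y) = form (G y) (v *m A y) w.
  by rewrite -aE; exact: cov_phi_xi.
have x2 : form (Gb y) b (xi y) = form (G y) (u *m A y) t.
  by rewrite -bE; exact: cov_phi_xi.
have s1 : CR_Sg y v w = a *m nor_proj y := congr1 (mulmx^~ (nor_proj y)) aE.
have s2 : CR_Sg y u t = b *m nor_proj y := congr1 (mulmx^~ (nor_proj y)) bE.
apply: (etrans (congr2 (form (Gb y)) aE bE)).
by rewrite (form_split y Oy a b) t1 t2 x1 x2 s1 s2.
Unshelve. all: by end_near. Qed.

Hypothesis space_form : forall z x v w t, O z ->
  form (Gm z) (Riem Gm z x v w) t =
  space_form_curvature (Gm z) (J z) c x v w t.
Hypothesis curv_comm : forall y u v w, Om y ->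
  Riem G y u v (w *m A y) = Riem G y u v w *m A y.

Lemma space_form_T y u v w t : Om y ->
  space_form_curvature (Gb y) (J (phi y)) c
    (u *m T y) (v *m T y) (w *m T y) (t *m T y) =
  space_form_curvature (G y) (CR_F y) c u v w t.
Proof.
move=> Oy; rewrite /space_form_curvature -!form_F//.
by rewrite !form_T.
Qed.

Local Notation gauss y := (gauss_curvature (G y) (CR_F y) c (Gb y)
  (CR_Sg y) (A y)).

Lemma gauss_equation y u v w t : Om y ->
  form (G y) (Riem G y u v w) t = gauss y u v w t.
Proof.
move=> Oy.
have H1 := gauss_half y u v w t Oy; have H2 := gauss_half y v u w t Oy.
have K := cov_curvature GO phiO u v _ y Oy (dphi2 w)
  (fun a => phi_diff3 a w).
have B := Riem_cst GOm u v w y Oy.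
have SF := space_form (phi y) (u *m T y) (v *m T y) (w *m T y) (t *m T y) (Oz y Oy).
rewrite (space_form_T y u v w t Oy) in SF.
rewrite (TD u y Oy) (TD v y Oy) (TD w y Oy) in K.
have KT := congr1 (fun a => form (Gb y) a (t *m T y)) K.
rewrite /= SF formDl formNl in KT.
rewrite (TD t y Oy) in H1 H2.
have BT := congr1 (fun a => form (G y) a t) B; rewrite /= formDl formNl in BT.
rewrite BT /gauss_curvature /partial_curvature.
exact: (gauss_algebra KT H1 H2).
Qed.

Lemma gauss_comm y x v z w : Om y ->
  gauss y x v (z *m A y) w = gauss y x v z (w *m A y).
Proof.
by move=> Oy; rewrite -!gauss_equation// curv_comm// shape_sym.
Qed.

Lemma umbilical y : Om y -> c != 0 -> exists lam mu x,
  [/\ CR_U y *m A y = mu *: CR_U y,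
     forall x, form (G y) x (CR_U y) = 0 -> x *m A y = lam *: x,
     (lam - mu) * (c + lam * mu) = 0 &
     [/\ x != 0, form (G y) x (CR_U y) = 0 & CR_Sg y (CR_U y) x = 0]].
Proof.
move=> Oy c0; apply: (eta_umbilical _ (cr_data_at y Oy)) => //.
- by move=> u v; exact: shape_sym.
- by move=> *; exact: gauss_comm.
Qed.

Local Notation xiJf := (fun z => xi z *m J (phi z)).

Lemma cov_xiJ u y : Om y -> covp u xiJf y = covp u xi y *m J (phi y).
Proof. move=> Oy; exact: (cov_J JO u xi y phiO Oy (xi_diff y Oy)). Qed.

Lemma cov_xi_xi u y : Om y -> form (Gb y) (covp u xi y) (xi y) = 0.
Proof.
move=> Oy; have dx := xi_diff y Oy.
have M := cov_metric GO phiO u _ _ y Oy dx dx.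
have Z : 'D_u (fun z => form (Gb z) (xi z) (xi z)) y = 0.
  rewrite (@near_eq_derive _ _ _ _ (cst (1 : R))) ?derive_cst//.
  by near=> z; apply: xi_unit; near: z; exact: nOm.
have C := formC (xi y) (covp u xi y) (mo_sym GO _ (Oz y Oy)).
exact: (addr_self_eq0 (etrans (esym M) Z) C).
Unshelve. all: by end_near. Qed.

(** The normal part [D] of the derivative of [xi] is orthogonal to [xi].  The tangent
    field U is - J xi, so the derivative of U has [nor_proj]-part - J D; that part is
    Sg(x, U), which vanishes by assumption. *)
Lemma cov_xi_parallel x y : Om y -> CR_Sg y (CR_U y) x = 0 ->
  covp x xi y = - (x *m A y *m T y).
Proof.
move=> Oy Sx; have [D Dn E] := shape y x Oy.
suff D0 : D = 0 by rewrite E D0 addr0.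
have DX : form (Gb y) D (xi y) = 0.
  have := cov_xi_xi x y Oy; rewrite E formDl formNl xi_normal//.
  by rewrite oppr0 add0r.
have DT v : form (Gb y) D (v *m T y) = 0.
  by rewrite (formC _ _ (mo_sym GO _ (Oz y Oy))).
have DP : covp x xi y *m nor_proj y = D.
  by rewrite E mulmxDl mulNmx T_nor// oppr0 add0r; exact: nor_id.
have dU := differentiable_U y Oy.
have CT := cov_tangent x CR_U y Oy dU.
have CN : covp x (fun z => CR_U z *m T z) y = covp x (fun z => - xiJf z) y.
  apply: cov_near; near=> z; have Oz' : Om z by near: z; exact: nOm.
  by rewrite xiJ// opprK.
have CO := cov_opp x xiJf y Oy (differentiable_xiJ y Oy).
have CJ := cov_xiJ x y Oy.
have EE := congr1 (mulmx^~ (nor_proj y))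
  (etrans (esym CT) (etrans CN (etrans CO (congr1 -%R CJ)))).
rewrite /= mulmxDl T_nor// add0r mulNmx nor_J// DP in EE.
have S0 : CR_Sg y x (CR_U y) = 0 by rewrite Sg_sym.
have DJ : D *m J (phi y) = 0 by apply: oppr_inj; rewrite oppr0 -EE.
have JJ := ko_sq JO _ (Oz y Oy).
by apply: oppr_inj; rewrite oppr0 -[D]mulmx1 -mulmxN -JJ mulmxA DJ mul0mx.
Unshelve. all: by end_near. Qed.

(** One of the two terms of the Codazzi equation for [x] and [v], paired with J xi.
    It comes from differentiating < D_v xi, J xi > = mu beta, where
    beta(z) = < v, U > = - < d phi v, J xi >.  As beta vanishes at [y], the derivative of
    mu does not enter. *)
Lemma codazzi_half x v lam y (mu := fun z => form (G z) (CR_U z *m A z) (CR_U z)) :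
  Om y -> (forall z, Om z -> CR_U z *m A z = mu z *: CR_U z) ->
  form (G y) x (CR_U y) = 0 -> form (G y) v (CR_U y) = 0 ->
  covp x xi y = - (lam *: (x *m T y)) -> covp v xi y = - (lam *: (v *m T y)) ->
  form (Gb y) (covp x (covp v xi) y) (xi y *m J (phi y)) =
  mu y * (lam * form (G y) v (x *m CR_F y)
     - form (Gb y) (covp x ('D_v phi) y) (xi y *m J (phi y)))
  - lam ^+ 2 * form (G y) v (x *m CR_F y).
Proof.
move=> Oy hopf xU vU cx cv.
pose beta z := form (G z) v (CR_U z).
have dU := differentiable_U y Oy; have dA := A_diff y Oy.
have dv : differentiable (fun=> v : 'rV[R]_n) y by exact: differentiable_cst.
have dUA : differentiable (fun z => CR_U z *m A z) y by exact: differentiable_mulmx.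
have dGy := mo_diff GOm y Oy.
have [dmu _] := derive_form G _ CR_U y 0 dGy dUA dU.
have [dbeta _] := derive_form G (fun=> v) CR_U y 0 dGy dv dU.
have dJ := differentiable_xiJ y Oy.
have dC : differentiable (covp v xi) y.
  apply: (differentiable_cov GO phiO) => //; first exact: xi_diff.
  exact: xi_diff2.
have CJ : covp x xiJf y = - (lam *: (x *m CR_F y *m T y)).
  by rewrite cov_xiJ// cx mulNmx -scalemxAl TJ// xU scale0r addr0.
have E1 : 'D_x (fun z => form (Gb z) (covp v xi z) (xi z *m J (phi z))) y =
   'D_x ((mu : _ -> R) * beta) y.
  apply: near_eq_derive; near=> z; have Oz' : Om z by near: z; exact: nOm.
  have [D Dn DE] := shape z v Oz'.
  rewrite xiJ// DE formNr formDl formNl.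
  have -> : form (Gb z) D (CR_U z *m T z) = 0.
    by rewrite (formC _ _ (mo_sym GO _ (Oz z Oz'))).
  rewrite form_T// addr0 opprK shape_sym// hopf// formZr.
  by [].
have M1 := cov_metric GO phiO x _ _ y Oy dC dJ.
have E2 : 'D_x ((mu : _ -> R) * beta) y = mu y * 'D_x beta y.
  rewrite deriveM; [|exact: diff_derivable|exact: diff_derivable].
  have -> : beta y = 0 by exact: vU.
  by rewrite scale0r addr0.
have M2 := cov_metric GO phiO x _ _ y Oy (dphi2 v y Oy) dJ.
have E3 : 'D_x beta y =
    - 'D_x (fun z => form (Gb z) ('D_v phi z) (xi z *m J (phi z))) y.
  have [dM2 _] := derive_form (fun z => Gb z) ('D_v phi) xiJf y 0
    (dGb y Oy) (dphi2 v y Oy) dJ.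
  rewrite -deriveN; last exact: diff_derivable.
  apply: near_eq_derive; near=> z; have Oz' : Om z by near: z; exact: nOm.
  have TDz := TD v z Oz'.
  have H : form (Gb z) ('D_v phi z) (xi z *m J (phi z)) = - beta z.
    by rewrite TDz xiJ // formNr form_T.
  by rewrite -[LHS]opprK -H.
have Q1 : form (Gb y) (covp v xi y) (covp x xiJf y) =
    lam ^+ 2 * form (G y) v (x *m CR_F y).
  rewrite CJ cv !(formNl, formNr, formZl, formZr) form_T//; ring.
have Q2 : form (Gb y) ('D_v phi y) (covp x xiJf y) =
    - (lam * form (G y) v (x *m CR_F y)).
  by rewrite CJ (TD v y Oy) !(formNr, formZr) form_T.
exact: (codazzi_half_algebra M1 Q1 (etrans E1 E2) E3 M2 Q2).
Unshelve. all: by end_near. Qed.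

(** With v = F x, the difference of the two instances of [codazzi_half] is the ambient
    curvature < R(x, Fx) xi, J xi > = - 2 c |x|^2.  The terms with second derivatives of
    [phi] cancel since [cov] is torsion free, and c = lam^2 - mu lam remains. *)
Lemma local_flat y : Om y -> c = 0.
Proof.
move=> Oy; apply/eqP/negPn/negP => c0.
pose mu z := form (G z) (CR_U z *m A z) (CR_U z).
have hopf z : Om z -> CR_U z *m A z = mu z *: CR_U z.
  move=> Oz'; have [lam [m [x [UA _ _ _]]]] := umbilical z Oz' c0.
  by rewrite /mu UA formZl U_unit// mulr1.
have [lam [m [x [UA HA lm [x0 xU Sx]]]]] := umbilical y Oy c0.
have mE : mu y = m by rewrite /mu UA formZl U_unit// mulr1.
pose v := x *m CR_F y.
have vU : form (G y) v (CR_U y) = 0 by exact: F_U.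
have Sv : CR_Sg y (CR_U y) v = 0 by rewrite Sg_J// Sx mul0mx.
have cx : covp x xi y = - (lam *: (x *m T y)).
  by rewrite cov_xi_parallel// HA// scalemxAl.
have cv : covp v xi y = - (lam *: (v *m T y)).
  by rewrite cov_xi_parallel// HA// scalemxAl.
have H1 := codazzi_half x v lam y Oy hopf xU vU cx cv.
have H2 := codazzi_half v x lam y Oy hopf vU xU cv cx.
have K := cov_curvature GO phiO x v xi y Oy xi_diff xi_diff2.
rewrite (TD x y Oy) (TD v y Oy) in K.
have KT := congr1 (fun a => form (Gb y) a (xi y *m J (phi y))) K.
rewrite /= formDl formNl in KT.
have SR := space_form (phi y) (x *m T y) (v *m T y) (xi y)
  (xi y *m J (phi y)) (Oz y Oy).
have Tt := cov_torsion GO phiO x v y Oy.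
have P := congr1 (fun a => form (Gb y) a (xi y *m J (phi y))) Tt.
have FFx : v *m CR_F y = - x.
  by apply: (etrans (FF_U y Oy x)); rewrite xU scale0r addr0.
have xx : form (G y) v (x *m CR_F y) = form (G y) x x.
  by apply: (etrans (F_skew y Oy x v)); rewrite FFx formNr opprK.
have xv : form (G y) x (v *m CR_F y) = - form (G y) x x.
  by rewrite FFx formNr.
have SF : space_form_curvature (Gb y) (J (phi y)) c (x *m T y) (v *m T y)
    (xi y) (xi y *m J (phi y)) = - (2 * c * form (G y) x x).
  rewrite /space_form_curvature.
  have -> : form (Gb y) (v *m T y) (xi y) = 0 by exact: xi_normal.
  have -> : form (Gb y) (x *m T y) (xi y) = 0 by exact: xi_normal.
  have -> : form (Gb y) (v *m T y *m J (phi y)) (xi y) = 0.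
    by apply: (etrans (esym (form_U y Oy v))).
  have -> : form (Gb y) (x *m T y *m J (phi y)) (xi y) = 0.
    by apply: (etrans (esym (form_U y Oy x))).
  have -> : form (Gb y) (x *m T y *m J (phi y)) (v *m T y) = form (G y) x x.
    by apply: (etrans (esym (form_F y Oy x v))); rewrite -xx.
  have -> : form (Gb y) (xi y *m J (phi y)) (xi y *m J (phi y)) = 1.
    apply: (etrans (ko_iso JO _ _ _ (Oz y Oy))); exact: xi_unit.
  ring.
have xp : 0 < form (G y) x x by exact: (mo_pos GOm).
have cE : c = lam ^+ 2 - m * lam.
  apply: (mulfI (lt0r_neq0 xp)).
  exact: (codazzi_algebra
    (etrans KT (etrans SR SF)) H1 H2 P xx xv mE).
by case/negP: c0; apply/eqP; exact: (codazzi_gauss_eq0 cE lm).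
Qed.

End LocalSubmanifold.

(** * Charts of the manifolds *)

Section Charts.
Local Open Scope classical_set_scope.
Local Open Scope ring_scope.
Context {R : realType}.

Lemma smooth_diff {V W : normedModType R} {U : set V} {f : V -> W} {x} :
  smooth_on U f -> U x -> differentiable f x.
Proof. by move=> /(_ 1%N) [df _]; exact: df. Qed.

Lemma smooth_derive {V W : normedModType R} {U : set V} {f : V -> W} v :
  smooth_on U f -> smooth_on U ('D_v f).
Proof. by move=> sf k; have [_] := sf k.+1; exact. Qed.

Lemma smooth_cst {V W : normedModType R} (U : set V) (w : W) :
  smooth_on U (fun=> w : W).
Proof.
move=> k; elim: k w => [|k IH] w /=.
  by move=> x _; exact: cst_continuous.
split=> [x _|v]; first exact: differentiable_cst.
have -> : 'D_v (fun=> w : W) = (fun=> 0) :> (V -> W).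
  by apply/funext => x; exact: derive_cst.
exact: IH.
Qed.

Lemma metric_chart {n : nat} (M : manifold R n) (g : metric M) i {O : set _} :
  open O -> O `<=` img i -> metric_on O (g i).
Proof.
move=> oO sO; have S := @metric_smooth R n M g i; split => //.
- by move=> z /sO Oz; exact: smooth_diff S Oz.
- by move=> a z /sO Oz; exact: smooth_diff (smooth_derive a S) Oz.
- by move=> z /sO Oz; exact: Defs.metric_sym.
- by move=> z v /sO Oz v0; exact: Defs.metric_pos.
Qed.

Lemma kaehler_chart {n : nat} {M : manifold R n} {g : metric M} {J : endo_field M} i :
  kaehler g J -> kaehler_on (img i) (g i) (J i).
Proof.
move=> K; have S := @endo_smooth R n M J i; split.
- by move=> z Oz; exact: smooth_diff S Oz.
- by move=> a z Oz; exact: smooth_diff (smooth_derive a S) Oz.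
- by move=> z /K[].
- by move=> z u v /K[].
- by move=> z v w Oz; have [_ _] := K i z Oz; apply; exact: smooth_cst.
Qed.

Lemma space_form_chart {n : nat} {M : manifold R n} {g : metric M}
    {J : endo_field M} {c i z} x v w t :
  complex_space_form g J (4 * c) -> img i z ->
  form (g i z) (Riem (g i) z x v w) t =
  space_form_curvature (g i z) (J i z) c x v w t.
Proof.
move=> [K S] Oz.
have GO : metric_on (img i) (g i) by apply: metric_chart => //; exact: img_open.
apply: (Riem_space_form GO (kaehler_chart i K)) => //.
by move=> u u0; exact: S.
Qed.

Lemma open_loc_dom {n m} {M : manifold R n} {N : manifold R m} {f : M -> N} i j :
  continuous f -> open (loc_dom f i j).
Proof.
move=> cf; rewrite openE => y [yi yj]; rewrite /interior.
have n1 : nbhs y (img i) by apply: open_nbhs_nbhs; split => //; exact: img_open.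
have n2 : nbhs y (fun z => dom j (f (param i z))).
  have cp := param_continuous yi.
  have := cf (param i y) (dom j).
  have /[swap]/[apply] : nbhs (f (param i y)) (dom j).
    by apply: open_nbhs_nbhs; split => //; exact: dom_open.
  by move=> /cp.
exact: filterI n1 n2.
Qed.

End Charts.

Theorem theorem1 (R : realType) (n p : nat) (c : R)
    (Mbar : manifold R (n + p)) (gbar : metric Mbar) (J : endo_field Mbar)
    (M : manifold R n) (g : metric M) (f : M -> Mbar)
    (xi : field_along f) (A : endo_field M) :
  (3 <= n)%N -> (p < n)%N ->
  complex_space_form gbar J (4 * c) ->
  immersion f -> isometric f g gbar ->
  maximal_CR f J ->
  distinguished_normal gbar J xi ->
  shape_operator gbar xi A ->
  curvature_commutes g A ->
  flat gbar /\ c = 0.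
Proof.
move=> n3 pn SF [[cf sf] imm] iso CR dn sh cc.
suff c0 : c = 0.
  split => // j y u v w jy.
  have Gpos a := @Defs.metric_pos R _ Mbar gbar j y a jy.
  apply: (form_nondeg Gpos) => t.
  by rewrite (space_form_chart _ _ _ _ SF jy)
    /space_form_curvature c0 mul0r.
have [x0 _] := @man_nonempty R n M.
have [i ix] := dom_cover x0; have [j jx] := dom_cover (f x0).
have Oy : loc_dom f i j (Defs.coord i x0).
  by split; [exists x0|rewrite coordK].
have oO := open_loc_dom i j cf.
have GO : metric_on (img j) (gbar j).
  by apply: metric_chart => //; exact: img_open.
have GOm : metric_on (loc_dom f i j) (g i).
  by apply: metric_chart => // y [].
have JO := kaehler_chart j SF.1.
have sphi := sf i j; have sxi := @field_smooth R n (n + p)%N M Mbar f xi i j.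
have phiO : map_into (img j) (loc_dom f i j) (loc f i j).
  split => //.
  - by move=> y [_ jy]; exists (f (param i y)).
  - by move=> y; exact: smooth_diff.
  - by move=> a y; apply: smooth_diff; exact: smooth_derive.
have TDi y u : loc_dom f i j y -> 'D_u (loc f i j) y = u *m tangent f i j y.
  by move=> yO; apply: deriveEjacobian; exact: smooth_diff sphi yO.
apply: (local_flat (xi := xi j \o param i) (A := A i) GO JO GOm phiO
  _ _ _ _ _ _ _ _ pn _ _ _ _ _ Oy).
- move=> a b y; apply: smooth_diff; exact/smooth_derive/smooth_derive.
- by move=> y; exact: iso.
- by move=> y; exact: smooth_diff.
- by move=> a y; apply: smooth_diff; exact: smooth_derive.
- by move=> y /dn[].
- by move=> y u /dn[].
- by move=> y /dn[].
- by rewrite (CR i j _ Oy) /= odd_double.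
- by move=> y [iy _]; exact: smooth_diff (@endo_smooth R n M A i) iy.
- move=> y X yO; have [D Dn E] := sh i j y yO X; exists D => //.
  by rewrite -E /nabla_along /cov TDi.
- by move=> z x v w t zj; exact: space_form_chart.
- by move=> y u v w [iy _]; exact: cc.
Qed.
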